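(* Let $\varphi:\mathbb{R}\to\mathbb{R}$ be continuous and nondecreasing and let $u_0\in L^1(\mathbb{R}^N)\cap L^\infty(\mathbb{R}^N)$. Let $\Lambda$ be a nonnegative Radon measure on $\mathbb{R}^N\times\mathbb{R}^N\setminus D$, where $D=\{(x,x):x\in\mathbb{R}^N\}$, satisfying: (A$_{\lambda 0}$) $\Lambda(\mathrm{d}x,\mathrm{d}y)=\tilde\lambda(x,\mathrm{d}y)\,\mathrm{d}x$ for a kernel $\tilde\lambda\ge 0$ on $\mathbb{R}^N\times\mathcal{B}(\mathbb{R}^N\setminus\{x\})$; (A$_{\lambda 1}$) the translated kernel $\lambda(x,\mathrm{d}z):=\tilde\lambda(x,x+\mathrm{d}z)$ satisfies $\int_{0<|z|\le 1}|z|^2\lambda(x,\mathrm{d}z)\in L^1_{\mathrm{loc}}(\mathbb{R}^N)$ and $\int_{|z|>1}\lambda(x,\mathrm{d}z)\in L^1_{\mathrm{loc}}(\mathbb{R}^N)$ (as functions of $x$). Then there is at most one (up to a.e. equality) energy solution $u$ of the Cauchy problem $\partial_t u-A^\lambda[\varphi(u)]=0$ in $Q_T$, $u(\cdot,0)=u_0$ on $\mathbb{R}^N$, in the class $$\mathscr{UC}:=\{u\in L^1(Q_T)\cap L^\infty(Q_T):\varphi(u)\in X\}.$$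
   Context: $T>0$ and $Q_T:=\mathbb{R}^N\times(0,T)$. A kernel $\tilde\lambda(x,\mathrm{d}y)$ on $\mathbb{R}^N\times\mathcal{B}(\mathbb{R}^N\setminus\{x\})$ is such that $B\mapsto\tilde\lambda(x,B)$ is a positive measure on the Borel sets of $\mathbb{R}^N\setminus\{x\}$ for each $x$, and $x\mapsto\tilde\lambda(x,B)$ is Borel measurable for each such $B$. Bilinear form: $$\mathcal{E}_\lambda[f,g]:=\frac12\int_{\mathbb{R}^N}\int_{|z|>0}\big(f(x+z)-f(x)\big)\big(g(x+z)-g(x)\big)\,\lambda(x,\mathrm{d}z)\,\mathrm{d}x .$$ $A^\lambda$ is its generator, formally $\mathcal{E}_\lambda[f,g]=-\int f A^\lambda[g]\,\mathrm{d}x$ (only $\mathcal E_\lambda$ is used in the notion of solution). Set $|f|_{E_\lambda}^2:=\mathcal{E}_\lambda[f,f]$, $E_\lambda(\mathbb{R}^N):=\{f \text{ measurable}: |f|_{E_\lambda}<\infty\}$, $|f|_{T,E_\lambda}^2:=\int_0^T|f(\cdot,t)|_{E_\lambda}^2\,\mathrm{d}t$, and $L^2(0,T;E_\lambda(\mathbb{R}^N)):=\{f:Q_T\to\mathbb{R}\text{ measurable}:|f|_{T,E_\lambda}<\infty\}$. Energy solution: $u\in L^1_{\mathrm{loc}}(Q_T)$ such that (i) $\varphi(u)\in L^2(0,T;E_\lambda(\mathbb{R}^N))$ and (ii) for all $\psi\in C_c^\infty(\mathbb{R}^N\times[0,T))$, $$\int_0^T\Big(\int_{\mathbb{R}^N}u\,\partial_t\psi\,\mathrm{d}x-\mathcal{E}_\lambda[\varphi(u),\psi]\Big)\mathrm{d}t+\int_{\mathbb{R}^N}u_0(x)\psi(x,0)\,\mathrm{d}x=0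 .$$ The space $X$ is the set of all $f\in L^\infty(Q_T)\cap L^2(0,T;E_\lambda(\mathbb{R}^N))$ for which there is a sequence $\{\psi_n\}\subset C_c^\infty(\mathbb{R}^N\times[0,T))$ with $|\psi_n-f|_{T,E_\lambda}\to0$ and $\iint_{Q_T}\psi_n\phi\,\mathrm{d}x\mathrm{d}t\to\iint_{Q_T}f\phi\,\mathrm{d}x\mathrm{d}t$ for all $\phi\in L^1(Q_T)$ as $n\to\infty$. *)

(* Defs.v *)
From HB Require Import structures.
From mathcomp Require Import all_boot all_order all_algebra.
From mathcomp Require Import all_classical all_reals all_analysis measurable_realfun.

Set Implicit Arguments.
Unset Strict Implicit.
Unset Printing Implicit Defensive.

Import Order.TTheory GRing.Theory Num.Theory.
Import numFieldNormedType.Exports.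

Local Open Scope classical_set_scope.
Local Open Scope ring_scope.

Definition rV_borel_display : measure_display. Proof. exact. Qed.

Section rV_measurable.
Variables (R : realType) (n : nat).

HB.instance Definition _ := @isMeasurable.Build rV_borel_display 'rV[R]_n
  <<s @open 'rV[R]_n >> (@sigma_algebra0 _ setT _) (@sigma_algebraC _ _)
  (@sigma_algebra_bigcup _ setT _).

Lemma rV_open_measurable (A : set 'rV[R]_n) : open A -> measurable A.
Proof. by move=> oA; exact: sub_sigma_algebra. Qed.

Lemma rV_coord_measurable (i : 'I_n) :
  measurable_fun setT (fun v : 'rV[R]_n => v ord0 i).
Proof.
apply: (measurability _ (RGenOpens.measurableE R)).
move=> _ [_ [a [b ->]] <-]; rewrite setTI; apply: rV_open_measurable.
apply: open_comp; last exact: interval_open.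
by move=> v _; exact: coord_continuous.
Qed.

Lemma rV_measurableP d (X : measurableType d) (f : X -> 'rV[R]_n) :
  (forall i, measurable_fun setT (fun x => f x ord0 i)) ->
  measurable_fun setT f.
Proof.
move=> mf; apply: (measurability _ (erefl <<s @open 'rV[R]_n >>)).
move=> _ [U oU <-]; rewrite setTI.
pose Q := [set k : 'rV[rat]_n * rat |
  [set v : 'rV[R]_n | forall i, `|v ord0 i - ratr (k.1 ord0 i)| < ratr k.2]
    `<=` U].
have -> : f @^-1` U = \bigcup_(k in Q) \bigcap_(i in [set: 'I_n])
    [set x | `|f x ord0 i - ratr (k.1 ord0 i)| < ratr k.2].
  apply/seteqP; split=> [x Ux|x [k Qk kx]]; last by apply: Qk => i; exact: kx.
  have /nbhs_ballP[e /= e0 eU] := open_nbhs_nbhs (conj oU Ux).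
  have [r r0 re] : exists2 r : rat, 0 < ratr r :> R & ratr r < e / 2.
    have [r] := rat_in_itvoo (divr_gt0 e0 (ltr0Sn R 1)).
    by rewrite in_itv/= => /andP[? ?]; exists r.
  have xr i : exists q : rat, `|f x ord0 i - ratr q| < ratr r.
    have [|q] := @rat_in_itvoo R (f x ord0 i - ratr r) (f x ord0 i + ratr r).
      by rewrite ltrD2l gtrN.
    rewrite in_itv/= => /andP[q1 q2]; exists q.
    by rewrite ltr_distlC q1 q2.
  have [q xq] := choice xr.
  exists (\row_i q i, r) => /=; last by move=> i _ /=; rewrite mxE.
  move=> v /= vq; apply: eU; split=> // i j; rewrite ord1.
  rewrite /ball/= (splitr e) (le_lt_trans (ler_distD (ratr (q j)) _ _))//.
  apply: ltrD; first exact: lt_trans (xq j) re.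
  by rewrite distrC (lt_trans _ re)//; have := vq j; rewrite mxE.
have -> : \bigcup_(k in Q) \bigcap_(i in [set: 'I_n])
    [set x | `|f x ord0 i - ratr (k.1 ord0 i)| < ratr k.2] =
  \bigcup_m if unpickle m is Some k then
    if k \in Q then \bigcap_(i in [set: 'I_n])
    [set x | `|f x ord0 i - ratr (k.1 ord0 i)| < ratr k.2] else set0 else set0.
  apply/seteqP; split=> [x [k Qk kx]|x [m _]].
    by exists (pickle k) => //; rewrite pickleK mem_set.
  by case: unpickle => // k; case: ifPn => // /set_mem Qk kx; exists k.
apply: bigcupT_measurable => m; case: unpickle => // k; case: ifPn => // _.
apply: fin_bigcap_measurable => // i _.
have mi : measurable_fun setT
    (fun x => `|f x ord0 i - ratr (k.1 ord0 i)| : measurableTypeR R).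
  by apply: measurableT_comp => //; apply: measurable_funB.
rewrite (_ : [set x | _] = setT `&` (fun x =>
    `|f x ord0 i - ratr (k.1 ord0 i)|) @^-1` `]-oo, ratr k.2[%classic).
  by apply: mi.
by rewrite setTI; apply/seteqP; split => x /=; rewrite in_itv.
Qed.

End rV_measurable.

Lemma sigma_finite_prod d1 d2 (T1 : measurableType d1) (T2 : measurableType d2)
    (R : realType) (m1 : {sigma_finite_measure set T1 -> \bar R})
    (m2 : {sigma_finite_measure set T2 -> \bar R}) :
  sigma_finite setT (m1 \x m2)%E.
Proof.
have /sigma_finiteP[F [TF ndF Foo]] := sigma_finiteT m1.
have /sigma_finiteP[G [TG ndG Goo]] := sigma_finiteT m2.
exists (fun n => F n `*` G n).
  rewrite -setXTT TF TG predeqE => -[x y]; split.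
    move=> [/= [n _ Fnx] [k _ Gky]]; exists (maxn n k) => //; split.
    - by move: x Fnx; exact/subsetPset/ndF/leq_maxl.
    - by move: y Gky; exact/subsetPset/ndG/leq_maxr.
  by move=> [n _ []/= ? ?]; split; exists n.
move=> k; have [? ?] := Foo k; have [? ?] := Goo k.
split; first exact: measurableX.
by rewrite product_measure1E// lte_mul_pinfty// ge0_fin_numE.
Qed.

(* Lebesgue measure on R^n, built by iterating the product with Lebesgue
   measure on R: the measure on R^n.+1 is the image of the product measure on
   R * R^n under the identification of R * R^n with R^n.+1. *)
Section rV_lebesgue.
Variable R : realType.

Definition rV_cons n (p : measurableTypeR R * 'rV[R]_n) : 'rV[R]_n.+1 :=
  row_mx (\row_(_ < 1) p.1) p.2.

Definition rV_uncons n (v : 'rV[R]_n.+1) : measurableTypeR R * 'rV[R]_n :=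
  (v ord0 ord0, \row_i v ord0 (lift ord0 i)).

Lemma rV_cons0 n p : @rV_cons n p ord0 ord0 = p.1.
Proof.
rewrite /rV_cons (_ : ord0 = lshift n (ord0 : 'I_1)); last exact/val_inj.
by rewrite (row_mxEl (\row_(_ < 1) p.1) p.2) mxE.
Qed.

Lemma rV_cons_lift n p i : @rV_cons n p ord0 (lift ord0 i) = p.2 ord0 i.
Proof.
rewrite /rV_cons (_ : lift ord0 i = rshift 1 i); last exact/val_inj.
by rewrite (row_mxEr (\row_(_ < 1) p.1) p.2).
Qed.

Lemma rV_consK n : cancel (@rV_cons n) (@rV_uncons n).
Proof.
move=> [x v]; rewrite /rV_uncons rV_cons0; congr pair.
by apply/rowP => i; rewrite mxE rV_cons_lift.
Qed.

Lemma rV_unconsK n : cancel (@rV_uncons n) (@rV_cons n).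
Proof.
move=> v; apply/rowP => i; have [j ->|->] := unliftP ord0 i.
  by rewrite rV_cons_lift mxE.
by rewrite rV_cons0.
Qed.

Lemma measurable_rV_cons n : measurable_fun setT (@rV_cons n).
Proof.
apply: rV_measurableP => i; have [j ->|->] := unliftP ord0 i.
  under eq_fun do rewrite rV_cons_lift.
  exact: (measurableT_comp (@rV_coord_measurable R n j)).
by under eq_fun do rewrite rV_cons0; exact: measurable_fst.
Qed.

Lemma measurable_rV_uncons n : measurable_fun setT (@rV_uncons n).
Proof.
apply/measurable_fun_pairP; split; first exact: rV_coord_measurable.
apply: rV_measurableP => i; rewrite /comp/=.
by under eq_fun do rewrite mxE; exact: rV_coord_measurable.
Qed.

Section step.
Variables (n : nat) (m : {sigma_finite_measure set 'rV[R]_n -> \bar R}).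

Definition rV_step : set 'rV[R]_n.+1 -> \bar R :=
  pushforward (@lebesgue_measure R \x m)%E (@rV_cons n).

Let rV_step0 : rV_step set0 = 0%E.
Proof. by rewrite /rV_step /pushforward preimage_set0 measure0. Qed.

Let rV_step_ge0 A : (0 <= rV_step A)%E.
Proof. exact: (measure_ge0 (@lebesgue_measure R \x m)%E). Qed.

Let mcons A : measurable A -> measurable (@rV_cons n @^-1` A).
Proof.
by move=> mA; rewrite -[X in measurable X]setTI; exact: measurable_rV_cons.
Qed.

Let rV_step_sigma_additive : semi_sigma_additive rV_step.
Proof.
move=> F mF tF mUF; rewrite /rV_step /pushforward preimage_bigcup.
apply: measure_semi_sigma_additive.
- by move=> k; exact: mcons.
- apply/trivIsetP => /= i j _ _ ij; rewrite -preimage_setI.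
  by move/trivIsetP : tF => /(_ _ _ _ _ ij) ->//; rewrite preimage_set0.
- by rewrite -preimage_bigcup; exact: mcons.
Qed.

HB.instance Definition _ := isMeasure.Build _ _ _ rV_step
  rV_step0 rV_step_ge0 rV_step_sigma_additive.

Let rV_step_sigma_finite : sigma_finite setT rV_step.
Proof.
have [F FT Fm] := sigma_finite_prod (@lebesgue_measure R) m.
exists (fun k => @rV_uncons n @^-1` F k).
  by rewrite -preimage_bigcup -FT preimage_setT.
move=> k; have [mF Foo] := Fm k; split.
  by rewrite -[X in measurable X]setTI; exact: measurable_rV_uncons.
rewrite /rV_step /pushforward -comp_preimage.
rewrite (_ : _ \o _ = id) ?preimage_id//.
by apply/funext => x /=; rewrite rV_consK.
Qed.

HB.instance Definition _ := Measure_isSigmaFinite.Build _ _ _ rV_step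
  rV_step_sigma_finite.

End step.

Fixpoint rV_lebesgue (n : nat) : {sigma_finite_measure set 'rV[R]_n -> \bar R} :=
  match n with
  | 0 => \d_(0 : 'rV[R]_0)
  | k.+1 => rV_step (rV_lebesgue k)
  end.

End rV_lebesgue.

Section smooth.
Variables (R : realType) (V : normedModType R).

(* In finite dimension, f is C^k iff all its iterated directional derivatives
   of order at most k exist and are continuous. *)
Fixpoint is_Ck (k : nat) (f : V -> R) : Prop :=
  continuous f /\
  (if k is k'.+1 then
     forall v : V, (forall x, derivable f x v) /\ is_Ck k' ('D_v f)
   else True).

Definition is_smooth (f : V -> R) : Prop := forall k, is_Ck k f.

End smooth.

Section lebesgue_classes.
Context d (X : measurableType d) (R : realType).
Variables (mu : {measure set X -> \bar R}) (D : set X).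

Definition in_L1 (f : X -> R) : Prop := mu.-integrable D (EFin \o f).

Definition in_Linfty (f : X -> R) : Prop :=
  measurable_fun D f /\
  exists M : R, {ae mu, forall x, D x -> `|f x| <= M}.

End lebesgue_classes.

Section energy.
Variables (R : realType) (N : nat).

Local Notation Rn := ('rV[R]_N).
Local Notation leb := (rV_lebesgue R N).

(* The library's norm on row vectors is the sup norm. *)
Definition enorm (z : Rn) : R := Num.sqrt (\sum_i z ord0 i ^+ 2).

Definition diagonal : set (Rn * Rn) := [set p | p.1 = p.2].

(* A measure on (Rn * Rn) \ D is encoded as a measure on Rn * Rn for which D is
   null; on this open set, a positive Borel measure is Radon iff it is finite
   on compact sets. *)
Definition radon_off_diagonal (Lambda : {measure set (Rn * Rn) -> \bar R}) :
    Prop :=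
  Lambda diagonal = 0%E /\
  forall K, compact K -> K `<=` ~` diagonal -> (Lambda K < +oo)%E.

(* Likewise, a kernel of measures on Rn \ {x} is a kernel of measures on Rn
   for which {x} is null. *)
Definition punctured_kernel (lamt : R.-ker Rn ~> Rn) : Prop :=
  forall x, lamt x [set x] = 0%E.

(* Lambda(dx,dy) = lamt(x,dy) dx *)
Definition disintegrates (Lambda : {measure set (Rn * Rn) -> \bar R})
    (lamt : R.-ker Rn ~> Rn) : Prop :=
  forall C, measurable C -> C `<=` ~` diagonal ->
    Lambda C = (\int[leb]_x lamt x (xsection C x))%E.

Definition translated (lamt : R.-ker Rn ~> Rn) (x : Rn) : set Rn -> \bar R :=
  pushforward (lamt x) (fun y : Rn => y - x).

Section with_kernel.
Variable lam : Rn -> set Rn -> \bar R.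

Definition levy_integrable : Prop :=
  forall K : set Rn, compact K ->
    leb.-integrable K (fun x =>
      \int[lam x]_(z in [set z | (0 < enorm z <= 1)%R]) (enorm z ^+ 2)%:E)%E /\
    leb.-integrable K (fun x => lam x [set z | 1 < enorm z]).

Definition energy (f g : Rn -> R) : \bar R :=
  ((2^-1)%:E * \int[leb]_x \int[lam x]_(z in [set z | (0 < enorm z)%R])
     ((f (x + z) - f x) * (g (x + z) - g x))%:E)%E.

Variable T : R.

Definition Q : set (Rn * R) := [set p | 0 < p.2 < T].

Definition lebQ : {measure set (Rn * measurableTypeR R)%type -> \bar R} :=
  (leb \x @lebesgue_measure R)%E.

Definition energy_normT (f : Rn * R -> R) : \bar R :=
  ((\int[lebesgue_measure]_(t in `]0%R, T[)
      energy (fun x => f (x, t)) (fun x => f (x, t))) `^ 2^-1)%E.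

Definition in_L2E (f : Rn * R -> R) : Prop :=
  measurable_fun (Q : set (Rn * measurableTypeR R)) f /\
  (energy_normT f < +oo)%E.

(* All functions on Rn * (0,T) are Borel functions, not a.e. classes: if the
   kernel charges null sets, the energy depends on the representative. Only
   their values on Q matter. *)

(* C_c^oo(Rn * [0,T)): the elements are represented by smooth extensions to
   Rn * R with compact support contained in Rn * (-oo,T). *)
Definition test_fun (psi : Rn * R -> R) : Prop :=
  [/\ is_smooth psi,
      compact (closure [set p | psi p != 0]) &
      closure [set p | psi p != 0] `<=` [set p | p.2 < T]].

Definition in_L1locQ (u : Rn * R -> R) : Prop :=
  forall K : set (Rn * R), compact K -> K `<=` Q -> in_L1 lebQ K u.

Definition energy_solution (phi : R -> R) (u0 : Rn -> R) (u : Rn * R -> R) :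
    Prop :=
  [/\ in_L1locQ u,
      in_L2E (phi \o u) &
      forall psi, test_fun psi ->
        (\int[lebesgue_measure]_(t in `]0%R, T[)
           ((\int[leb]_x (u (x, t) * derive1 (fun s => psi (x, s)) t)%:E) -
            energy (fun x => phi (u (x, t))) (fun x => psi (x, t))) +
         \int[leb]_x (u0 x * psi (x, 0%R))%:E)%E = 0%E].

Definition in_X (f : Rn * R -> R) : Prop :=
  [/\ in_Linfty lebQ Q f,
      in_L2E f &
      exists psi_ : nat -> Rn * R -> R,
        [/\ forall n, test_fun (psi_ n),
            energy_normT (psi_ n \- f)%R @[n --> \oo] --> 0%E &
            forall h, in_L1 lebQ Q h ->
              (\int[lebQ]_(p in Q) (psi_ n p * h p)%:E)%E @[n --> \oo] -->
              (\int[lebQ]_(p in Q) (f p * h p)%:E)%E]].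

Definition in_UC (phi : R -> R) (u : Rn * R -> R) : Prop :=
  [/\ in_L1 lebQ Q u, in_Linfty lebQ Q u & in_X (phi \o u)].

End with_kernel.

End energy.

(* Main.v *)
(* Oleinik's argument. Let w = phi(u) - phi(v), U = u - v, and let f be phi(u)
   or phi(v), with approximating test functions psi_n. Testing both equations
   with the primitive zeta_n(x,t) = int_t^T (T - s) psi_n(x,s) ds, subtracting
   and letting n -> oo gives
     int_Q (T - t) U f
       + 1/2 int_Lambda int int_{t <= s} (T - s) Dw(t) Df(s) ds dt = 0,
   where Dg(x,y,t) = g(y,t) - g(x,t). With the usual weight 1 the double
   integral for f = w would be (int_0^T Dw)^2 / 2, which controls only the
   total time integral; hence the weight T - t. Subtracting the identities
   for phi(u) and phi(v) puts w in the place of f. The first term is then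
   nonnegative because phi is nondecreasing, and the second one is a
   multiple of
     int_Lambda int_0^T (int_0^r Dw(t) dt)^2 dr,
   so both vanish and, by differentiation in r, Dw = 0 almost everywhere for
   Lambda (x) dt. Hence the energies of phi(u) and phi(v) against any test
   function coincide at almost every time, even when they are infinite for
   some test functions, which may happen since Lambda is not symmetric. The
   two weak equations then give int_Q U g = 0 for all bumps g, and U = 0
   almost everywhere. *)
Require Import Defs.
From HB Require Import structures.
From mathcomp Require Import all_boot all_order all_algebra.
From mathcomp Require Import all_classical all_reals all_analysis.
From mathcomp Require Import measurable_realfun ring lra.

Set Implicit Arguments.
Unset Strict Implicit.
Unset Printing Implicit Defensive.

Import Order.TTheory GRing.Theory Num.Theory.
Import numFieldNormedType.Exports.

Local Open Scope classical_set_scope.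
Local Open Scope ring_scope.


(** * Iterated derivatives and averages along segments *)

(** Three obstacles shape the argument. First, [lamt] need not be a sigma-finite kernel: the Levy
    condition gives finite mass away from the diagonal only at almost every [x]. The kernel is
    therefore replaced by zero outside a set [G] of full measure, and the measurability of its
    sections comes from a countable cover of the complement of the diagonal. Second, energies are
    extended real numbers and may be infinite on test functions. The equation itself repairs this:
    its initial term is finite, which forces the energy term to be integrable in time; and a test
    function close enough to an element of finite energy has finite energy as well. Third, the two
    terms pass to the limit differently. The first one uses the weak convergence in the definition
    of X, tested against [(T - t) U], which is in L1 because [u] and [v] are. The second one uses
    the convergence in energy, paired with the fixed square integrable function [Dw]; only [f] is
    approximated, never [w] on both sides. Functions on the slab are extended by zero and time
    carries the restriction of Lebesgue measure to (0, T), so that all integrals run over whole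
    spaces. *)

Section real_integrable.
Context d (X : measurableType d) (R : realType) (mu : {measure set X -> \bar R}).
Variables (D : set X) (mD : measurable D).
Implicit Types f g : X -> R.

Lemma integrable_EFinB f g : mu.-integrable D (EFin \o f) ->
  mu.-integrable D (EFin \o g) -> mu.-integrable D (EFin \o (f \- g)).
Proof. by move=> fi gi; have := integrableB mD fi gi. Qed.

Lemma integrable_EFinZ (k : R) f : mu.-integrable D (EFin \o f) ->
  mu.-integrable D (EFin \o (fun x => k * f x)).
Proof. by move=> fi; have := integrableZl mD k fi. Qed.

End real_integrable.

Section iterated_derivatives.
Context {R : realType} {V : normedModType R}.
Implicit Types (f g : V -> R).

Lemma is_Ck_continuous k f : is_Ck k f -> continuous f.
Proof. by case: k => [|k] []. Qed.

Lemma is_CkS k f : is_Ck k.+1 f -> is_Ck k f.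
Proof.
elim: k f => [|k IH] f [cf df]; first by split.
by split => // v; have [dv kv] := df v; split => //; exact: IH.
Qed.

Lemma is_Ck_cst k (c : R) : is_Ck k (cst c : V -> R).
Proof.
elim: k c => [|k IH] c; first by split => // x; exact: cvg_cst.
split => [x|v]; first exact: cvg_cst.
split=> [x|]; first exact: derivable_cst.
rewrite (_ : 'D_v _ = cst 0); first exact: IH.
by apply/funext => x; rewrite derive_cst.
Qed.

Lemma is_CkD k f g : is_Ck k f -> is_Ck k g -> is_Ck k (f \+ g).
Proof.
elim: k f g => [|k IH] f g [cf df] [cg dg].
  by split => // x; apply: cvgD; [exact: cf|exact: cg].
split => [x|v]; first by apply: cvgD; [exact: cf|exact: cg].
have [dfv kfv] := df v; have [dgv kgv] := dg v.
split=> [x|]; first exact: derivableD.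
rewrite (_ : 'D_v _ = 'D_v f \+ 'D_v g); first exact: IH.
by apply/funext => x; rewrite deriveD.
Qed.

Lemma is_CkM k f g : is_Ck k f -> is_Ck k g -> is_Ck k (f \* g).
Proof.
elim: k f g => [|k IH] f g Ckf Ckg.
  case: Ckf Ckg => [cf _] [cg _].
  by split => // x; apply: cvgM; [exact: cf|exact: cg].
move: (Ckf) (Ckg) => [cf df] [cg dg].
split => [x|v]; first by apply: cvgM; [exact: cf|exact: cg].
have [dfv kfv] := df v; have [dgv kgv] := dg v.
split=> [x|]; first exact: derivableM.
rewrite (_ : 'D_v _ = (f \* 'D_v g) \+ (g \* 'D_v f)).
  by apply: is_CkD; apply: IH => //; exact: is_CkS.
by apply/funext => x; rewrite deriveM.
Qed.

Section comp_affine.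
Variables (l : V -> R) (a : R).
Hypotheses (l_lin : forall (t : R) u v, l (t *: u + v) = t * l u + l v)
  (l_cont : continuous l).

(** By linearity of [l], the two difference quotients are the same function of [t]. *)
Lemma derive_comp_affine (h : R -> R) (v x : V) :
  'D_v (fun x => h (l x + a)) x = 'D_(l v) h (l x + a).
Proof.
rewrite /derive; set F := (F in lim (F @ _) = _).
set G := (G in _ = lim (G @ _)); suff -> : F = G by [].
by apply/funext => t; rewrite /F /G /= l_lin -addrA.
Qed.

Lemma derivable_comp_affine (h : R -> R) (v x : V) :
  derivable h (l x + a) (l v) -> derivable (fun x => h (l x + a)) x v.
Proof.
rewrite /derivable; set F := (F in cvg (F @ _) -> _).
set G := (G in _ -> cvg (G @ _)); suff -> : F = G by [].
by apply/funext => t; rewrite /F /G /= l_lin -addrA.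
Qed.

Lemma is_smooth_comp_affine (h : R -> R) :
  is_smooth h -> is_smooth (fun x => h (l x + a)).
Proof.
have ch (h' : R -> R) : continuous h' -> continuous (fun x : V => h' (l x + a)).
  move=> ch' x; apply: (@continuous_comp _ _ _ (fun x => l x + a) h').
    by apply: cvgD; [exact: l_cont|exact: cvg_cst].
  exact: ch'.
move=> sh k; move: {sh}(sh k); elim: k h => [|k IH] h [chh dh].
  by split => //; exact: ch.
split => [|v]; first exact: ch.
have [dhv khv] := dh (l v); split => [x|].
  by apply: (@derivable_comp_affine h); exact: dhv.
rewrite (_ : 'D_v _ = (fun x => 'D_(l v) h (l x + a))).
  exact: (IH ('D_(l v) h)).

by apply/funext => x; rewrite derive_comp_affine.
Qed.

End comp_affine.

Lemma is_smooth_cst (c : R) : is_smooth (cst c : V -> R).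
Proof. by move=> k; exact: is_Ck_cst. Qed.

Lemma is_smoothM f g : is_smooth f -> is_smooth g -> is_smooth (f \* g).
Proof. by move=> sf sg k; exact: is_CkM. Qed.

Lemma is_smooth_prod (I : Type) (r : seq I) (P : pred I) (F : I -> V -> R) :
  (forall i, is_smooth (F i)) -> is_smooth (fun x => \prod_(i <- r | P i) F i x).
Proof.
move=> sF; elim: r => [|i r IH].
  rewrite (_ : (fun _ => _) = cst 1); first exact: is_smooth_cst.
  by apply/funext => x; rewrite big_nil.
case: (boolP (P i)) => Pi.
  rewrite (_ : (fun _ => _) =
      F i \* (fun x => \prod_(i <- r | P i) F i x)); first exact: is_smoothM.
  by apply/funext => x; rewrite big_cons Pi.
under eq_fun do rewrite big_cons (negbTE Pi).
exact: IH.
Qed.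

End iterated_derivatives.

Section average_along_a_segment.
Context {R : realType} {V : normedModType R}.
Variables (e : V) (c : R).
Hypothesis c_ge0 : 0 <= c.
Local Notation mu := (@lebesgue_measure R).
Implicit Types g : V -> R.

Definition segment_integral g (p : V) : R :=
  \int[mu]_(s in `[0, c]) g (p + s *: e).

Let continuous_along g p : continuous g -> continuous (fun s : R => g (p + s *: e)).
Proof.
move=> cg s.
apply: (@continuous_comp _ _ _ (fun s : R => p + s *: e) g); last exact: cg.
by apply: cvgD; [exact: cvg_cst|apply: cvgZr_tmp; exact: cvg_id].
Qed.

Lemma continuous_itv_integrable (h : R -> R) (a b : R) : continuous h ->
  mu.-integrable `[a, b] (EFin \o h).
Proof.
move=> ch; apply: continuous_compact_integrable; first exact: segment_compact.
exact: continuous_subspaceT.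
Qed.

Let integrable_along g p : continuous g ->
  mu.-integrable `[0, c] (EFin \o (fun s : R => g (p + s *: e))).
Proof. by move=> cg; apply/continuous_itv_integrable/continuous_along. Qed.

(** Compactness of [0, c] turns joint continuity in the base point and in [s] into a neighbourhood
    of [p] that serves all [s] at once. *)
Let near_uniform g (p : V) (eps : R) : continuous g -> 0 < eps ->
  \forall q \near p, forall s : R, s \in `[0, c] ->
    `|g (p + s *: e) - g (q + s *: e)| < eps.
Proof.
move=> cg eps0.
have /compact_near_coveringP K : compact `[0, c] := @segment_compact R 0 c.
have /= := K V (nbhs p) (fun q s => `|g (p + s *: e) - g (q + s *: e)| < eps) _.
apply => s _ /=.
have cts : {for (s, p), continuous (fun z : R * V =>
    `|g (p + z.1 *: e) - g (z.2 + z.1 *: e)|)}.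
  apply: (@continuous_comp _ _ _ (fun z : R * V => g (p + z.1 *: e) - g (z.2 + z.1 *: e)) Num.norm); last exact: norm_continuous.
  have c1 : {for (s, p), continuous (fun z : R * V => z.1 *: e)}.
    by apply: cvgZr_tmp; exact: cvg_fst.
  apply: cvgB.
    apply: (@continuous_comp _ _ _ (fun z : R * V => p + z.1 *: e) g).
      by apply: cvgD => //; exact: cvg_cst.
    exact: cg.
  apply: (@continuous_comp _ _ _ (fun z : R * V => z.2 + z.1 *: e) g).
    by apply: cvgD => //; exact: cvg_snd.
  exact: cg.
have := cts; rewrite /prop_for /continuous_at /= subrr normr0.
move=> /cvgrPdist_lt /(_ _ eps0); apply: filterS => z /=.
by rewrite sub0r normrN normr_id.
Qed.

Let le_segment (h : R -> R) (eps : R) : mu.-integrable `[0, c] (EFin \o h) ->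
  0 <= eps -> (forall s : R, s \in `[0, c] -> `|h s| <= eps) ->
  `|\int[mu]_(s in `[0, c]) h s| <= eps * c.
Proof.
move=> ih e0 heps; apply: le_trans (le_normr_Rintegral _ ih) _ => //.
have -> : eps * c = \int[mu]_(s in `[0, c]) eps.
  rewrite Rintegral_cst//= lebesgue_measure_itv/= lte_fin.
  by case: ltP => [_|c0]; rewrite ?sube0 ?subr0//= (le_anti (introT andP (conj c0 c_ge0))) mulr0.
apply: le_Rintegral => //.
- exact: integrable_norm.
- by apply: continuous_itv_integrable => x; exact: cvg_cst.
Qed.

Let segment_cts g : continuous g -> continuous (segment_integral g).
Proof.
move=> cg p; apply/cvgrPdist_le => eps eps0.
(* [c] may be 0, hence the denominator [c + 1]. *)
have eps1 : 0 < eps / (c + 1) by rewrite divr_gt0// ltr_wpDl.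
near=> q.
rewrite /segment_integral -RintegralB//; [|exact: integrable_along..].
apply: (@le_trans _ _ (eps / (c + 1) * c)).
  apply: (le_segment _ (ltW eps1)).
  - by apply: integrable_EFinB => //; exact: integrable_along.
  - move=> s sc; apply/ltW; move: s sc; near: q; exact: near_uniform.
by rewrite mulrAC ler_pdivrMr ?ltr_wpDl// ler_wpM2l ?lerDl// ltW.
Unshelve. all: by end_near. Qed.

(** Differentiation under the integral sign: each difference quotient of [g] is a value of ['D_v g]
    at a nearby point, and [near_uniform] for ['D_v g] controls the error uniformly along the
    segment. *)
Let segment_derive_cvg g v p : continuous g ->
  (forall x, derivable g x v) -> continuous ('D_v g) ->
  (fun h : R => h^-1 *: ((segment_integral g \o shift p) (h *: v) - segment_integral g p))
    @ 0^' --> segment_integral ('D_v g) p.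
Proof.
move=> cg dg cdg; apply/cvgrPdist_le => eps eps0.
have eps1 : 0 < eps / (c + 1) by rewrite divr_gt0// ltr_wpDl.
have [d /= d0 dP] : exists2 d : R, 0 < d & forall q : V, `|q - p| < d ->
    forall s : R, s \in `[0, c] -> `|'D_v g (p + s *: e) - 'D_v g (q + s *: e)| < eps / (c + 1).
  have /nbhs_ballP[d d0 H] := near_uniform p cdg eps1.
  by exists d => // q qp; apply: H; rewrite -ball_normE/= distrC.
(* Mean value theorem for [g] on the line through [p + s *: e] with direction [v]. The factor is the
   norm of [v] plus 1 because [v] may vanish. *)
have quot (s h : R) : 0 < `|h| -> `|h| * (`|v| + 1) < d -> s \in `[0, c] ->
    `|'D_v g (p + s *: e) - h^-1 * (g (h *: v + p + s *: e) - g (p + s *: e))|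
      <= eps / (c + 1).
  move=> h0 hd sc.
  pose G (t : R) := g (t *: v + (p + s *: e)).
  have dG (t : R) : is_derive t (1 : R) G ('D_v g (t *: v + (p + s *: e))).
    have E : (fun k : R => k^-1 *: ((G \o shift t) (k *: (1 : R)) - G t)) =
        (fun k : R => k^-1 *: ((g \o shift (t *: v + (p + s *: e))) (k *: v)
           - g (t *: v + (p + s *: e)))).
      apply/funext => k /=; have -> : k *: (1 : R) = k by exact: mulr1.
      by rewrite /G scalerDl -(addrA (k *: v)).
    apply: DeriveDef; rewrite /derivable /derive E//.
    exact: dg.
  have cG : continuous G.
    move=> t; apply: differentiable_continuous.
    by apply/derivable1_diffP; exact: ex_derive.
  have [t th Gt] : exists2 t : R, `|t| <= `|h| & G h - G 0 = 'D_v g (t *: v + (p + s *: e)) * h.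
    have [h1|h1] := ltP 0 h.
      have [|t] := @MVT R G _ 0 h h1 (fun t _ => dG t); first exact: continuous_subspaceT.
      rewrite in_itv/= => /andP[t0 t1] ->; exists t; last by rewrite subr0.
      by rewrite !ger0_norm// ltW.
    have h2 : h < 0 by rewrite lt_neqAle h1 andbT -normr_gt0.
    have [|t] := @MVT R G _ h 0 h2 (fun t _ => dG t); first exact: continuous_subspaceT.
    rewrite in_itv/= => /andP[t0 t1] E; exists t.
      by rewrite !ltr0_norm// lerN2 ltW.
    by rewrite -opprB E sub0r mulrN opprK.
  have -> : g (h *: v + p + s *: e) - g (p + s *: e) = G h - G 0.
    by rewrite /G scale0r add0r addrA.
  rewrite Gt mulrCA mulVf ?mulr1 -?normr_gt0// addrA.
  apply/ltW/dP => //; rewrite addrK normrZ (le_lt_trans _ hd)//.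
  by rewrite ler_pM// lerDl.
near=> h.
have h0 : 0 < `|h| by rewrite normr_gt0; near: h; exact: nbhs_dnbhs_neq.
have hd : `|h| * (`|v| + 1) < d.
  rewrite -ltr_pdivlMr ?ltr_wpDl//; near: h.
  by apply: dnbhs0_lt; rewrite divr_gt0// ltr_wpDl.
have i1 q : mu.-integrable `[0, c] (EFin \o (fun s : R => g (q + s *: e))).
  exact: integrable_along.
have i2 : mu.-integrable `[0, c] (EFin \o (fun s : R =>
    (g (h *: v + p + s *: e) - g (p + s *: e)))).
  by apply: integrable_EFinB.
have scaleE (a b : R) : a *: b = a * b by [].
rewrite /segment_integral /= -RintegralB// scaleE -RintegralZl//.
rewrite -RintegralB//; last 2 first.
- exact: (integrable_along _ cdg).
- exact: (integrable_EFinZ _ _ i2).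
apply: (@le_trans _ _ (eps / (c + 1) * c)).
  apply: (le_segment _ (ltW eps1)) => [|s sc]; last exact: quot.
  apply: integrable_EFinB => //; first exact: (integrable_along p cdg).
  exact: (integrable_EFinZ _ _ i2).
by rewrite mulrAC ler_pdivrMr ?ltr_wpDl// ler_wpM2l ?lerDl// ltW.
Unshelve. all: by end_near. Qed.

Lemma derive_segment_integral g v : continuous g ->
  (forall x, derivable g x v) -> continuous ('D_v g) ->
  'D_v (segment_integral g) = segment_integral ('D_v g).
Proof.
move=> cg dg cdg; apply/funext => p; rewrite /derive.
by apply: cvg_lim => //; exact: segment_derive_cvg.
Qed.

Lemma is_smooth_segment_integral g : is_smooth g -> is_smooth (segment_integral g).
Proof.
move=> sg k; move: {sg}(sg k); elim: k g => [|k IH] g [cg dg].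
  by split => //; exact: segment_cts.
split=> [|v]; first exact: segment_cts.
have [dgv kgv] := dg v; have cdg := is_Ck_continuous kgv.
split; last by rewrite derive_segment_integral//; exact: IH.
move=> x; apply/cvg_ex; exists (segment_integral ('D_v g) x).
exact: segment_derive_cvg.
Qed.

End average_along_a_segment.

(** * Time primitives of test functions *)

Section time_primitive.
Context {R : realType} {N : nat}.
Local Notation Rn := ('rV[R]_N).
Local Notation mu := (@lebesgue_measure R).
Local Notation e2 := ((0, 1) : Rn * R).
Implicit Types g psi : Rn * R -> R.

Definition supp g : set (Rn * R) := closure [set p | g p != 0].

Lemma supp0 g p : ~ supp g p -> g p = 0.
Proof. by move=> gp; apply: contrapT => /eqP gp0; apply/gp/subset_closure. Qed.

Lemma suppM_compact g h : compact (supp g) -> compact (supp (h \* g)).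
Proof.
move=> cg; apply: (subclosed_compact _ cg); first exact: closed_closure.
by apply: closureS => p /=; apply: contra => /eqP ->; rewrite mulr0.
Qed.

Lemma suppM_sub g h : supp (h \* g) `<=` supp g.
Proof. by apply: closureS => p /=; apply: contra => /eqP ->; rewrite mulr0. Qed.

Lemma pairD_e2 (x : Rn) (t s : R) : (x, t) + s *: e2 = (x, t + s).
Proof.
rewrite [LHS]surjective_pairing /=; congr pair; first by rewrite scaler0 addr0.
by congr (_ + _); exact: mulr1.
Qed.

Lemma shift_e2 (x : Rn) (t k : R) : k *: e2 + (x, t) = (x, k *: (1 : R) + t).
Proof. by rewrite addrC pairD_e2 addrC; congr (_, _ + _); exact/esym/mulr1. Qed.

Lemma derive1_slice g x t : derive1 (fun s => g (x, s)) t = 'D_e2 g (x, t).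
Proof.
rewrite derive1E /derive; set F := (F in lim (F @ _) = _).
set G := (G in _ = lim (G @ _)); suff -> : F = G by [].
by apply/funext => k; rewrite /F /G /= shift_e2.
Qed.

Lemma derivable_slice g x t :
  derivable g (x, t) e2 -> derivable (fun s => g (x, s)) t 1.
Proof.
rewrite /derivable; set F := (F in cvg (F @ _) -> _).
set G := (G in _ -> cvg (G @ _)); suff -> : F = G by [].
by apply/funext => k; rewrite /F /G /= shift_e2.
Qed.

Lemma continuous_slice g x : continuous g -> continuous (fun s : R => g (x, s)).
Proof.
move=> cg s; apply: (@continuous_comp _ _ _ (fun s : R => (x, s)) g); last exact: cg.
exact: (@cvg_pair _ _ _ (nbhs s) (nbhs x) (nbhs s) _ _ _ (fun=> x) id
  (cvg_cst _) cvg_id).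
Qed.


Variable T : R.
Hypothesis T_gt0 : 0 < T.

(* Averaging over the time window [t, t + T] yields a primitive of - g on
   (0, T) which, unlike the integral from t to T, has compact support in Rn * R. *)
Definition time_primitive g := segment_integral e2 T g.

Section properties.
Variable g : Rn * R -> R.
Hypotheses (sg : is_smooth g) (cg : compact (supp g))
  (gT : supp g `<=` [set p | p.2 < T]).

Let g_late x t : T <= t -> g (x, t) = 0.
Proof. by move=> Tt; apply: supp0 => /gT /=; rewrite ltNge Tt. Qed.

Lemma time_primitive_test : test_fun T (time_primitive g).
Proof.
pose F (z : (Rn * R) * R) := z.1 - z.2 *: e2.
(* If the average at [p] is nonzero, some [p + s *: e2] lies in the support of [g], so [p] is that
   point moved back in time by [s]. Moving back keeps the time below T. *)
pose K := F @` (supp g `*` `[0, T]).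
have cF : continuous F.
  move=> z; apply: cvgB; first exact: cvg_fst.
  by apply: cvgZr_tmp; exact: cvg_snd.
have cK : compact K.
  apply: continuous_compact; first exact: continuous_subspaceT.
  by apply: compact_setX => //; exact: segment_compact.
have sK : supp (time_primitive g) `<=` K.
  have /closure_id -> := compact_closed (@norm_hausdorff _ _) cK.
  apply: closureS => p /= pz; apply: contrapT => pK.
  move/eqP : pz; apply; rewrite /time_primitive /segment_integral.
  rewrite (eq_Rintegral _ _ (g := cst 0)); first by rewrite Rintegral_cst// mul0r.
  move=> s /set_mem sT; apply: supp0 => ps; apply: pK.
  by exists (p + s *: e2, s) => //=; rewrite /F/= addrK.
split.
- exact: (is_smooth_segment_integral _ (ltW T_gt0)).
- by apply: subclosed_compact cK sK; exact: closed_closure.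
- move=> p /sK [[q s] [/= /gT/= qT]]; rewrite in_itv/= => /andP[s0 _] <- /=.
  by rewrite (le_lt_trans _ qT)// gerBl// [_ *: _]mulr1.
Qed.

(** The derivative goes under the integral, where the direction of differentiation is that of the
    segment, so the fundamental theorem of calculus leaves the two endpoints. *)
Let deriv x t : 'D_e2 (time_primitive g) (x, t) = g (x, t + T) - g (x, t).
Proof.
have [c0 d1] := sg 1; have [dg [cdg _]] := d1 e2.
have -> : 'D_e2 (time_primitive g) (x, t) = segment_integral e2 T ('D_e2 g) (x, t).
  exact: (congr1 (@^~ (x, t)) (derive_segment_integral e2 (ltW T_gt0) c0 dg cdg)).
rewrite /segment_integral.
have E s : 'D_e2 g ((x, t) + s *: e2) = derive1 (fun s => g (x, t + s)) s.
  rewrite pairD_e2 -derive1_slice !derive1E /derive.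
  set F := (F in lim (F @ _) = _).
  set G := (G in _ = lim (G @ _)); suff -> : F = G by [].
  by apply/funext => k; rewrite /F /G /= addrCA.
have c1 : continuous (fun s : R => g (x, t + s)).
  move=> s; apply: (@continuous_comp _ _ _ (fun s : R => t + s) (fun r => g (x, r))).
    by apply: cvgD; [exact: cvg_cst|exact: cvg_id].
  exact: continuous_slice.
rewrite /Rintegral (@continuous_FTC2 _ _ (fun s => g (x, t + s)))//.
- by rewrite addr0.
- apply: continuous_subspaceT => s.
  apply: (@continuous_comp _ _ _ (fun s : R => (x, t) + s *: e2) ('D_e2 g)).
    by apply: cvgD; [exact: cvg_cst|apply: cvgZr_tmp; exact: cvg_id].
  exact: cdg.
- split.
  + move=> s _.
    have := derivable_slice (dg (x, t + s)); rewrite /derivable.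
    set F := (F in cvg (F @ _) -> _).
    set G := (G in _ -> cvg (G @ _)); suff -> : F = G by [].
    by apply/funext => k; rewrite /F /G /= addrCA.
  + apply: cvg_at_right_filter; exact: c1.
  + apply: cvg_at_left_filter; exact: c1.
Qed.

Lemma derive1_time_primitive x t : 0 < t ->
  derive1 (fun s => time_primitive g (x, s)) t = - g (x, t).
Proof.
by move=> t0; rewrite derive1_slice deriv g_late ?sub0r// lerDr ltW.
Qed.

(** [- time_primitive T g] is an antiderivative of [g] on this interval, and it vanishes at T
    because [g] vanishes from time T on. *)
Lemma time_primitive_itv x t : 0 < t < T ->
  time_primitive g (x, t) = \int[mu]_(s in `[t, T]) g (x, s).
Proof.
move=> /andP[t0 tT]; have [smz _ _] := time_primitive_test.
have [cz dz] := smz 1; have [dze _] := dz e2.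
rewrite /Rintegral (@continuous_FTC2 _ _ (fun s => - time_primitive g (x, s)))//.
- rewrite /= (_ : time_primitive g (x, T) = 0) ?oppr0 ?sub0r ?opprK//.
  rewrite /time_primitive /segment_integral (eq_Rintegral _ _ (g := cst 0)).
    by rewrite Rintegral_cst// mul0r.
  move=> s /set_mem /=; rewrite in_itv/= => /andP[s0 _].
  by rewrite pairD_e2 g_late// lerDl.
- by apply: continuous_subspaceT; apply: continuous_slice; case: (sg 0).
- have cN : continuous (fun s => - time_primitive g (x, s)).
    by move=> s; apply: cvgN; exact: continuous_slice.
  split.
  + by move=> s _; apply: derivableN; exact: derivable_slice.
  + by apply: cvg_at_right_filter; exact: cN.
  + by apply: cvg_at_left_filter; exact: cN.
- move=> s; rewrite in_itv/= => /andP[ts sT].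
  rewrite derive1E deriveN; last exact: derivable_slice.
  by rewrite -derive1E derive1_time_primitive ?opprK// (lt_trans t0).
Qed.

End properties.

End time_primitive.

(** * Smooth bumps *)

Section flat_exponential.
Context {R : realType}.
Implicit Types (p : {poly R}) (x v : R).

(* The derivatives at 0 of x |-> exp (- 1 / x) stay in this class. *)
Definition poly_expV p x : R := if 0 < x then p.[x^-1] * expR (- x^-1) else 0.

Lemma poly_expR_bounded p : exists C, forall z : R, 0 <= z ->
  `|p.[z] * expR (- z)| <= C.
Proof.
(* From [z ^ i <= i! * exp z], term by term of the exponential series. *)
exists (\sum_(i < size p) `|p`_i| * i`!%:R) => z z0.
rewrite normrM (ger0_norm (expR_ge0 _)) expRN ler_pdivrMr ?expR_gt0//.
rewrite horner_coef mulr_suml (le_trans (ler_norm_sum _ _ _))//.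
apply: ler_sum => i _; rewrite normrM -mulrA ler_wpM2l// ger0_norm ?exprn_ge0//.
case: (val i) => [|n]; first by rewrite fact0 mul1r expr0 -expR0 ler_expR.
rewrite -ler_pdivrMl ?ltr0n ?fact_gt0// mulrC.
by apply: le_trans (expR_ge1Dxn n z0); rewrite lerDr.
Qed.

(** The bound on [p * 'X^2] at [x^-1] gains a factor [x ^+ 2]; this is what makes the function
    differentiable at 0. *)
Let poly_expV_sqr p : exists C, forall x, `|poly_expV p x| <= C * x ^+ 2.
Proof.
have [C HC] := poly_expR_bounded (p * 'X^2); exists C => x.
rewrite /poly_expV; case: ifPn => [x0|_].
  have := HC x^-1; rewrite invr_ge0 (ltW x0) => /(_ isT).
  rewrite hornerM hornerXn mulrAC normrM [X in _ * X]ger0_norm ?exprn_ge0 ?invr_ge0 ?(ltW x0)//.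
  by rewrite exprVn ler_pdivrMr// exprn_gt0.
rewrite normr0 mulr_ge0 ?sqr_ge0//.
by apply: le_trans (HC 0 (lexx 0)).
Qed.

Let is_derive1_poly_expV p x : is_derive x (1 : R) (poly_expV p)
  (poly_expV ('X^2 * (p - p^`())) x).
Proof.
have [x0|x0|->] := ltgtP x 0.
- rewrite [X in is_derive _ _ _ X]/poly_expV lt_gtF//.
  apply: (@near_eq_is_derive _ _ _ (cst 0)).
    near=> y; rewrite /poly_expV /= lt_gtF//; near: y; exact: lt_nbhsl.
- rewrite [X in is_derive _ _ _ X]/poly_expV x0.
  have dV : is_derive x (1 : R) (fun y : R => y^-1) (- x ^- 2 *: 1).
    by apply: is_deriveV; rewrite gt_eqF.
  have dp : is_derive x (1 : R) (fun y => p.[y^-1]) (p^`().[x^-1] * (- x ^- 2 *: 1)).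
    exact: (@is_derive1_comp _ (horner p)).
  have dE : is_derive x (1 : R) (fun y => expR (- y^-1)) (expR (- x^-1) * - (- x ^- 2 *: 1)).
    exact: (@is_derive1_comp _ expR (fun y => - y^-1)).
  have D : is_derive x (1 : R) (fun y => p.[y^-1] * expR (- y^-1))
      (('X^2 * (p - p^`())).[x^-1] * expR (- x^-1)).
    have D0 : is_derive x (1 : R) (fun y => p.[y^-1] * expR (- y^-1)) _ :=
      is_deriveM dp dE.
    apply: (is_derive_eq D0).
    have scaleE (a b : R) : a *: b = a * b by [].
    rewrite !scaleE hornerM hornerXn hornerD hornerN exprVn.
    ring.
  apply: (near_eq_is_derive _ D).
  near=> y; rewrite /poly_expV /= ifT//; near: y; exact: lt_nbhsr.
- rewrite [X in is_derive _ _ _ X]/poly_expV ltxx.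
  (* At 0 the quadratic bound makes the difference quotient of order [h], so the derivative is 0. *)
  have [C HC] := poly_expV_sqr p.
  have C0 : 0 <= C by have := le_trans (normr_ge0 _) (HC 1); rewrite expr1n mulr1.
  have H : (fun h : R => h^-1 *: ((poly_expV p \o shift 0) (h *: (1 : R)) - poly_expV p 0))
      @ 0^' --> (0 : R).
    apply/cvgrPdist_le => e e0; near=> h.
    have h0 : 0 < `|h| by rewrite normr_gt0; near: h; exact: nbhs_dnbhs_neq.
    rewrite sub0r normrN /= {2}/poly_expV ltxx subr0 addr0.
    have -> : h *: (1 : R) = h by exact: mulr1.
    have scaleE (a b : R) : a *: b = a * b by [].
    rewrite scaleE normrM normfV mulrC ler_pdivrMr// (le_trans (HC _))//.
    rewrite -[h ^+ 2]ger0_norm ?sqr_ge0// normrX expr2 mulrA ler_wpM2r//.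
    apply: (@le_trans _ _ ((C + 1) * `|h|)); first by rewrite ler_wpM2r// lerDl.
    rewrite -ler_pdivlMl ?ltr_wpDl//; near: h.
    by apply: dnbhs0_le; rewrite mulr_gt0// invr_gt0 ltr_wpDl.
  apply: DeriveDef; first by apply/cvg_ex; exists 0.
  exact: cvg_lim.
Unshelve. all: by end_near. Qed.

Lemma derivable_poly_expV p v x : derivable (poly_expV p) x v.
Proof.
apply: diff_derivable; apply/derivable1_diffP.
by have [] := is_derive1_poly_expV p x.
Qed.

Lemma derive_poly_expV p v :
  'D_v (poly_expV p) = poly_expV (v *: ('X^2 * (p - p^`()))).
Proof.
apply/funext => x; have [d1 E] := is_derive1_poly_expV p x.
have df : differentiable (poly_expV p) x by apply/derivable1_diffP.
rewrite deriveE// -[v in LHS]mulr1 linearZ_LR -deriveE// E.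
rewrite /poly_expV; case: ifPn => _; last exact: mulr0.
by rewrite hornerZ -mulrA.
Qed.

Lemma is_smooth_poly_expV p : is_smooth (poly_expV p).
Proof.
have cp q : continuous (poly_expV q).
  move=> x; apply: differentiable_continuous; apply/derivable1_diffP.
  exact: derivable_poly_expV.
move=> k; elim: k p => [|k IH] p; first by split.
split => // v; split => [x|]; first exact: derivable_poly_expV.
by rewrite derive_poly_expV.
Qed.

Definition expV : R -> R := poly_expV 1.

Lemma expVE x : expV x = if 0 < x then expR (- x^-1) else 0.
Proof. by rewrite /expV /poly_expV hornerC mul1r. Qed.

Lemma expV_ge0 x : 0 <= expV x.
Proof. by rewrite expVE; case: ifP => // _; exact: expR_ge0. Qed.

Lemma expV_le1 x : expV x <= 1.
Proof. by rewrite expVE; case: ifPn => // x0; rewrite expR_le1 oppr_le0 invr_ge0 ltW. Qed.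

Lemma expV_le0 x : x <= 0 -> expV x = 0.
Proof. by rewrite expVE leNgt => /negbTE ->. Qed.

Lemma expV_ge x : 0 < x -> 1 - x^-1 <= expV x.
Proof. by move=> x0; rewrite expVE x0 expR_ge1Dx. Qed.

(** The lower bound [1 - (n * d)^-1] is explicit. [u] is a sequence rather than a constant because
    the upper time edge of the bumps moves with [n]. *)
Lemma expV_cvg1 (u : nat -> R) (d : R) : 0 < d ->
  (\forall n \near \oo, d <= u n) -> expV (n%:R * u n) @[n --> \oo] --> (1 : R).
Proof.
move=> d0 ud; apply/cvgrPdist_le => e e0; near=> n.
have n0 : 0 < n%:R :> R by rewrite ltr0n; near: n; exact: nbhs_infty_gt.
have un : d <= u n by near: n.
have u0 : 0 < u n := lt_le_trans d0 un.
rewrite ger0_norm ?subr_ge0 ?expV_le1// lerBlDr -lerBlDl.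
apply: le_trans (expV_ge (mulr_gt0 n0 u0)); rewrite lerD2l lerN2.
have H : (e * d)^-1 <= n%:R by near: n; exact: nbhs_infty_ger.
rewrite -(ler_pM2r (mulr_gt0 n0 u0)) mulVf ?gt_eqF ?mulr_gt0//.
apply: (@le_trans _ _ (e * (n%:R * d))); last by rewrite !ler_pM2l.
by rewrite mulrCA mulrC -ler_pdivrMl ?mulr_gt0// mulr1.
Unshelve. all: by end_near. Qed.

End flat_exponential.

Section bumps.
Context {R : realType} {N : nat}.
Local Notation Rn := ('rV[R]_N).

(** A smooth approximation from below of the indicator of the open interval from [a] to [b]: each
    factor vanishes beyond its endpoint and tends to 1 on the inner side. *)
Definition bump (n : nat) (a b t : R) : R :=
  expV (n%:R * (t - a)) * expV (n%:R * (b - t)).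

Lemma bump_ge0 n a b t : 0 <= bump n a b t.
Proof. by rewrite mulr_ge0 ?expV_ge0. Qed.

Lemma bump_le1 n a b t : bump n a b t <= 1.
Proof. by rewrite mulr_ile1 ?expV_ge0 ?expV_le1. Qed.

Lemma bump_out n a b t : ~~ (a < t < b) -> bump n a b t = 0.
Proof.
rewrite negb_and -!leNgt => /orP[ta|bt]; rewrite /bump.
  by rewrite expV_le0 ?mul0r// mulr_ge0_le0// subr_le0.
by rewrite [X in _ * X]expV_le0 ?mulr0// mulr_ge0_le0// subr_le0.
Qed.

Lemma bump_cvg1 (a t : R) (b : nat -> R) (d : R) : 0 < d -> a < t ->
  (\forall n \near \oo, d <= b n - t) ->
  bump n a (b n) t @[n --> \oo] --> (1 : R).
Proof.
move=> d0 at_ bt; rewrite -[1]mulr1; apply: cvgM; last exact: expV_cvg1 bt.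
apply: (@expV_cvg1 _ _ (t - a)); first by rewrite subr_gt0.
by near=> n.
Unshelve. all: by end_near. Qed.

Lemma is_smooth_bump (V : normedModType R) (l : V -> R) n a b :
  (forall (t : R) u v, l (t *: u + v) = t * l u + l v) -> continuous l ->
  is_smooth (fun x => bump n a b (l x)).
Proof.
move=> l_lin cl.
have ls (c : R) : (forall (t : R) u v, c * l (t *: u + v) = t * (c * l u) + c * l v)
    /\ continuous (fun x => c * l x).
  split; first by move=> t u v; rewrite l_lin mulrDr mulrCA.
  by move=> x; apply: cvgM; [exact: cvg_cst|exact: cl].
rewrite (_ : (fun x => _) = (fun x => expV (n%:R * l x + - (n%:R * a))) \*
    (fun x => expV (- n%:R * l x + n%:R * b))).
  have [? ?] := ls n%:R; have [? ?] := ls (- n%:R).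
  by apply: is_smoothM; apply: is_smooth_comp_affine => //;
    exact: is_smooth_poly_expV.
apply/funext => x; rewrite /bump /=; congr (expV _ * expV _).
  by rewrite mulrBr.
by rewrite mulrBr mulNr addrC.
Qed.

Lemma continuous_coord1 (i : 'I_N) : continuous (fun p : Rn * R => p.1 ord0 i).
Proof.
move=> p; apply: (@continuous_comp _ _ _ fst (fun x : Rn => x ord0 i)).
  exact: cvg_fst.
exact: coord_continuous.
Qed.

Definition box (a b : Rn) (c d : R) : set (Rn * R) :=
  [set p : Rn * R | (forall i, a ord0 i < p.1 ord0 i < b ord0 i) /\ c < p.2 < d].

Definition box_bump (a b : Rn) (c d : R) (n : nat) (p : Rn * R) : R :=
  (\prod_(i < N) bump n (a ord0 i) (b ord0 i) (p.1 ord0 i)) * bump n c d p.2.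

Lemma is_smooth_box_bump a b c d n : is_smooth (box_bump a b c d n).
Proof.
apply: is_smoothM.
  apply: is_smooth_prod => i; apply: is_smooth_bump.
    by move=> t u v /=; rewrite !mxE.
  exact: continuous_coord1.
by apply: is_smooth_bump => // p; exact: cvg_snd.
Qed.

Lemma box_bump_out a b c d n p : ~ box a b c d p -> box_bump a b c d n p = 0.
Proof.
move=> /not_andP[|/negP H]; last by rewrite /box_bump [X in _ * X]bump_out ?mulr0.
move=> /existsNP[i /negP H]; rewrite /box_bump (bigD1 i)//=.
by rewrite bump_out// !mul0r.
Qed.

Lemma box_bump_itv a b c d n p : 0 <= box_bump a b c d n p <= 1.
Proof.
have P0 : 0 <= \prod_(i < N) bump n (a ord0 i) (b ord0 i) (p.1 ord0 i).
  by apply: prodr_ge0 => i _; exact: bump_ge0.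
rewrite mulr_ge0 ?bump_ge0//= mulr_ile1 ?bump_ge0 ?bump_le1//.
by apply: prodr_ile1 => i _; rewrite bump_ge0 bump_le1.
Qed.

Lemma supp_box_bump a b c d n : supp (box_bump a b c d n) `<=`
  [set x : Rn | forall i, x ord0 i \in `[a ord0 i, b ord0 i]] `*` `[c, d].
Proof.
set K := _ `*` _.
have cK : compact K.
  apply: compact_setX; last exact: segment_compact.
  by apply: (@rV_compact R N (fun i => [set` `[a ord0 i, b ord0 i]])) => i; exact: segment_compact.
have /closure_id -> := compact_closed (@norm_hausdorff _ _) cK.
apply: closureS => p /= H.
have : box a b c d p.
  by apply: contrapT => /box_bump_out pb; move: H; rewrite pb eqxx.
move=> [p1 /andP[p2 p3]]; split => [i|] /=; rewrite in_itv/=; last by rewrite !ltW.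
by have /andP[? ?] := p1 i; rewrite !ltW.
Qed.

Lemma compact_supp_box_bump a b c d n : compact (supp (box_bump a b c d n)).
Proof.
apply: subclosed_compact (@supp_box_bump a b c d n); first exact: closed_closure.
apply: compact_setX; last exact: segment_compact.
by apply: (@rV_compact R N (fun i => [set` `[a ord0 i, b ord0 i]])) => i; exact: segment_compact.
Qed.

(** Admissible test functions must end strictly before T, whereas the limiting box may reach T; so
    the upper edge [d_ n] is allowed to approach [d] from below. *)
Lemma box_bump_cvg a b c (d_ : nat -> R) d p :
  (forall n, d_ n <= d) -> d_ n @[n --> \oo] --> d ->
  box_bump a b c (d_ n) n p @[n --> \oo] --> (\1_(box a b c d) p : R).
Proof.
move=> dd dcv; have [pB|pB] := pselect (box a b c d p); last first.
  rewrite indicE memNset//; apply: cvg_near_cst; near=> n.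
  apply: box_bump_out => -[p1 /andP[p2 p3]]; apply: pB; split => //.
  by rewrite p2 (lt_le_trans p3).
rewrite indicE mem_set//; case: pB => p1 /andP[p2 p3].
rewrite /= -[1%:R]mulr1; apply: cvgM; last first.
  apply: (@bump_cvg1 _ _ _ ((d - p.2) / 2)) => //.
    by rewrite divr_gt0 ?subr_gt0.
  near=> n; rewrite lerBrDr.
  have /ltW : (d - p.2) / 2 + p.2 < d_ n; last by [].
  near: n; apply: (cvgr_gt d) => //.
  by rewrite -ltrBrDr ltr_pdivrMr// mulr_natr mulr2n ltrDl subr_gt0.
have := @cvg_big R 'I_N *%R 1 xpredT (@mul_continuous R) nat \oo (index_enum _)
  (fun i n => bump n (a ord0 i) (b ord0 i) (p.1 ord0 i)) (fun=> 1) _.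
rewrite big1//; apply => i _; have /andP[ai bi] := p1 i.
apply: (@bump_cvg1 _ _ _ (b ord0 i - p.1 ord0 i)) => //.
  by rewrite subr_gt0.
exact: nearW.
Unshelve. all: by end_near. Qed.

End bumps.

(** * Borel sets of the product and bumps on boxes *)

Lemma bigcup_countable_measurable d (X : measurableType d) (I : countType)
    (P : set I) (F : I -> set X) : (forall i, P i -> measurable (F i)) ->
  measurable (\bigcup_(i in P) F i).
Proof.
move=> mF; rewrite (_ : \bigcup_(i in P) F i = \bigcup_n
    (if unpickle n is Some i then if i \in P then F i else set0 else set0)).
  apply: bigcupT_measurable => n; case: unpickle => // i.
  by case: ifPn => // /set_mem; exact: mF.
apply/seteqP; split=> [x [i Pi Fx]|x [n _]].
  by exists (pickle i) => //; rewrite pickleK mem_set.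
by case: unpickle => // i; case: ifPn => // /set_mem Pi Fx; exists i.
Qed.

Lemma rV_compact_measurable (R : realType) n (A : set 'rV[R]_n) :
  compact A -> measurable A.
Proof.
move=> cA; rewrite -[X in measurable X]setCK; apply: measurableC.
by apply: rV_open_measurable; apply: closed_openC; exact: compact_closed.
Qed.

Section borel_product.
Context {R : realType} {N : nat}.
Local Notation Rn := ('rV[R]_N).
Local Notation Rt := (measurableTypeR R).

(** Second countability: [O] is the union of the products of balls with rational centres and radius
    [k.2.+1%:R^-1] that it contains, and there are countably many. *)
Lemma open_prod_measurable (O : set (Rn * R)) :
  open O -> measurable (O : set (Rn * Rt)).
Proof.
move=> oO.
pose B (k : 'rV[rat]_N * rat * nat) : set (Rn * Rt) :=
  ball (map_mx ratr k.1.1 : Rn) (k.2.+1%:R^-1) `*` ball (ratr k.1.2 : R) (k.2.+1%:R^-1).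
rewrite (_ : O = \bigcup_(k in [set k | B k `<=` O]) B k); last first.
  apply/seteqP; split=> [p Op|p [k kO kp]]; last exact: kO.
  have /nbhs_ballP[e /= e0 eO] := open_nbhs_nbhs (conj oO Op).
  have e2 : 0 < e / 2 by rewrite divr_gt0.
  have [n ne] : exists n, n.+1%:R^-1 < e / 2.
    exists (Num.truncn (e / 2)^-1).
    by rewrite invf_plt ?posrE// truncnS_gt.
  have app (r : R) : exists q : rat, ball (ratr q : R) n.+1%:R^-1 r.
    have [|q] := @rat_in_itvoo R (r - n.+1%:R^-1) (r + n.+1%:R^-1).
      by rewrite ltrD2l gtrN.
    rewrite in_itv/= => /andP[q1 q2]; exists q.
    by rewrite -ball_normE/= ltr_distl q1.
  have [q1 Hq1] := choice (fun i => app (p.1 ord0 i)).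
  have [q2 Hq2] := app p.2.
  exists (\row_i q1 i, q2, n) => /=; last first.
    split => //=; split => // i j; rewrite !mxE ord1; exact: Hq1.
  move=> [x t] [/= [_ xq] tq]; apply: eO; split => /=.
    split => // i j; rewrite (splitr e).
    apply: (@ball_triangle _ _ (ratr (q1 j) : R)).
      by apply: ball_sym; apply: (le_ball (ltW ne)); rewrite ord1; exact: Hq1.
    by apply: (le_ball (ltW ne)); have := xq i j; rewrite !mxE.
  rewrite (splitr e); apply: (@ball_triangle _ _ (ratr q2 : R)).
    by apply: ball_sym; exact: (le_ball (ltW ne)).
  exact: (le_ball (ltW ne)).
apply: bigcup_countable_measurable => k _; apply: measurableX.
  by apply: rV_open_measurable; exact: ball_open.
exact: measurable_ball.
Qed.

Lemma continuous_prod_measurable (f : Rn * R -> R) :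
  continuous f -> measurable_fun setT (f : Rn * Rt -> R).
Proof.
move=> cf; apply: (measurability _ (RGenOpens.measurableE R)).
move=> _ [_ [a [b ->]] <-]; rewrite setTI; apply: open_prod_measurable.
by apply: open_comp => //; exact: interval_open.
Qed.

Lemma coord1_measurable d (X : measurableType d) (f : X -> Rn) (i : 'I_N) :
  measurable_fun setT f -> measurable_fun setT (fun x => f x ord0 i).
Proof. by move=> mf; exact: (measurableT_comp (@rV_coord_measurable R N i)). Qed.

Lemma measurable_box (a b : Rn) c d : measurable (box a b c d : set (Rn * Rt)).
Proof.
rewrite (_ : box a b c d = \bigcap_(i in [set: 'I_N])
   ((fun p : Rn * Rt => p.1 ord0 i) @^-1` `]a ord0 i, b ord0 i[) `&`
   ((fun p : Rn * Rt => p.2) @^-1` `]c, d[)); last first.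
  apply/seteqP; split=> [p [p1 p2]|p [/= p1 p2]].
    by split => [i _|]; rewrite /= in_itv/=.
  by split; [move=> i; have := p1 i I|]; rewrite /= in_itv in p2 *.
apply: measurableI.
  apply: fin_bigcap_measurable => // i _; rewrite -[X in measurable X]setTI.
  exact: (@coord1_measurable _ _ fst).
by rewrite -[X in measurable X]setTI; apply: measurable_snd.
Qed.

Definition boxes : set (set (Rn * Rt)) :=
  [set B | exists a b c d, B = box a b c d].

Lemma boxes_setI_closed : setI_closed boxes.
Proof.
move=> _ _ [a [b [c [d ->]]]] [a' [b' [c' [d' ->]]]].
exists (\row_i Num.max (a ord0 i) (a' ord0 i)), (\row_i Num.min (b ord0 i) (b' ord0 i)),
  (Num.max c c'), (Num.min d d').
apply/seteqP; split=> p.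
  move=> [[p1 /andP[p2 p3]] [p1' /andP[p2' p3']]]; split; last first.
    by rewrite gt_max lt_min p2 p3 p2' p3'.
  move=> i; rewrite !mxE gt_max lt_min.
  by have /andP[-> ->] := p1 i; have /andP[-> ->] := p1' i.
move=> [p1]; rewrite gt_max lt_min => /andP[/andP[? ?] /andP[? ?]].
split; split; (try by apply/andP); move=> i; have := p1 i; rewrite !mxE gt_max lt_min.
  by move=> /andP[/andP[-> _] /andP[-> _]].
by move=> /andP[/andP[_ ->] /andP[_ ->]].
Qed.

Lemma near_lt_nat (p : Rn * R) : \forall n \near \oo,
  (forall i, `|p.1 ord0 i| < n%:R) /\ `|p.2| < n%:R.
Proof.
near=> n; split; last by near: n; exact: nbhs_infty_gtr.
near: n; apply: filter_forall => i; exact: nbhs_infty_gtr.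
Unshelve. all: by end_near. Qed.

(** For the nontrivial inclusion, the identity from the space carrying the sigma-algebra of the
    boxes is measurable because its coordinates are: a slab in one coordinate is the union over [n]
    of boxes whose other edges are [- n] and [n]. *)
Lemma boxes_generate : @measurable _ (Rn * Rt)%type = <<s boxes >>.
Proof.
apply/seteqP; split; last first.
  apply: smallest_sub; first exact: sigma_algebra_measurable.
  by move=> _ [a [b [c [d ->]]]]; exact: measurable_box.
move=> A mA.
pose X := g_sigma_algebraType boxes.
pose big (n : nat) : Rn := const_mx n%:R.
have lt_natP (p : Rn * R) : exists n : nat, (forall i, `|p.1 ord0 i| < n%:R) /\ `|p.2| < n%:R.
  by have [n _ /(_ n (leqnn n))] := near_lt_nat p; exists n.
have m1 i : measurable_fun setT (fun p : X => (p : Rn * Rt).1 ord0 i).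
  apply: (measurability _ (RGenOpens.measurableE R)).
  move=> _ [_ [a [b ->]] <-]; rewrite setTI.
  rewrite (_ : _ @^-1` _ = \bigcup_n
    (box (\row_j if j == i then a else - n%:R) (\row_j if j == i then b else n%:R)
      (- n%:R) n%:R)); last first.
    apply/seteqP; split=> [p /=|p [n _ [p1 _]]]; rewrite /= in_itv/=; last first.
      by have := p1 i; rewrite !mxE eqxx.
    move=> pab; have [n [n1 n2]] := lt_natP p.
    exists n => //; split; last by rewrite -ltr_norml.
    by move=> j; rewrite !mxE; case: eqP => [->//|_]; rewrite -ltr_norml.
  apply: (@bigcupT_measurable _ X) => n; apply: sub_sigma_algebra.
  by do 4 eexists; reflexivity.
have m2 : measurable_fun setT (fun p : X => (p : Rn * Rt).2).
  apply: (measurability _ (RGenOpens.measurableE R)).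
  move=> _ [_ [a [b ->]] <-]; rewrite setTI.
  rewrite (_ : _ @^-1` _ = \bigcup_n (box (- big n) (big n) a b)); last first.
    apply/seteqP; split=> [p /=|p [n _ [_ p2]]]; rewrite /= in_itv//=.
    move=> pab; have [n [n1 n2]] := lt_natP p.
    by exists n => //; split=> // i; rewrite !mxE -ltr_norml.
  apply: (@bigcupT_measurable _ X) => n; apply: sub_sigma_algebra.
  by do 4 eexists; reflexivity.
have mid : measurable_fun setT (fun p : X => (p : Rn * Rt)).
  apply/measurable_fun_pairP; split => //.
  exact: rV_measurableP.
by have := mid measurableT A mA; rewrite setTI.
Qed.

End borel_product.

Lemma dominated_multiplier_cvg d (X : measurableType d) (R : realType)
    (mu : {measure set X -> \bar R}) (U : X -> R) (h_ : nat -> X -> R) (h : X -> R) :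
  mu.-integrable setT (EFin \o U) ->
  (forall n, measurable_fun setT (h_ n)) -> measurable_fun setT h ->
  (forall n x, `|h_ n x| <= 1) ->
  (forall x, h_ n x @[n --> \oo] --> h x) ->
  (\int[mu]_x (U x * h_ n x)%:E)%E @[n --> \oo] --> (\int[mu]_x (U x * h x)%:E)%E.
Proof.
move=> iU mh_ mh h1 hcv.
have mU : measurable_fun setT U by apply/measurable_EFinP; exact: measurable_int iU.
have [] := @dominated_convergence _ X R mu setT measurableT
  (fun n x => (U x * h_ n x)%:E) (fun x => (U x * h x)%:E) (abse \o (EFin \o U)).
- by move=> n; apply/measurable_EFinP; exact: measurable_funM.
- by apply/measurable_EFinP; exact: measurable_funM.
- apply: aeW => x _; apply: cvg_EFin; first exact: nearW.
  by apply: cvgM; [exact: cvg_cst|exact: hcv].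
- exact: integrable_abse.
- by apply: aeW => x n _ /=; rewrite lee_fin normrM ler_piMr.
by [].
Qed.

Section box_bumps_determine.
Context {R : realType} {N : nat}.
Local Notation Rn := ('rV[R]_N).
Local Notation Rt := (measurableTypeR R).
Local Notation mu := (lebQ R N).

Lemma measurable_Q (T : R) : measurable (Q T : set (Rn * Rt)).
Proof.
rewrite (_ : Q T = (fun p : Rn * Rt => p.2) @^-1` `]0, T[); last first.
  by apply/seteqP; split=> p; rewrite /Q /= in_itv.
by rewrite -[X in measurable X]setTI; apply: measurable_snd.
Qed.

(** The sets over which [U] integrates to 0 form a Dynkin system, and the boxes are stable under
    intersection and generate. *)
Lemma integral_eq0_on_boxes_ae0 (U : Rn * Rt -> R) :
  mu.-integrable setT (EFin \o U) ->
  (forall a b c d, (\int[mu]_(p in box a b c d) (U p)%:E = 0)%E) ->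
  {ae mu, forall p, U p = 0}.
Proof.
move=> iU U0.
have intI (A : set (Rn * Rt)) : measurable A ->
    (\int[mu]_(p in A) (U p)%:E = \int[mu]_p (U p * \1_A p)%:E)%E.
  move=> mA; rewrite integral_mkcond; apply: eq_integral => p _.
  rewrite patchE indicE; case: ifPn => _; rewrite ?mulr1 ?mulr0//.
(* The whole space is only an increasing union of boxes; its integral is needed for complements in
   the Dynkin induction. *)
have UT : (\int[mu]_p (U p)%:E = 0)%E.
  pose B (n : nat) : set (Rn * Rt) := box (- const_mx n%:R) (const_mx n%:R) (- n%:R) n%:R.
  have : (\int[mu]_p (U p * \1_(B n) p)%:E)%E @[n --> \oo] --> (\int[mu]_p (U p * cst 1 p)%:E)%E.
    apply: dominated_multiplier_cvg => //.
    - by move=> n; apply: measurable_indic; exact: measurable_box.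
    - by move=> n p; rewrite indicE; case: (_ \in _); rewrite ?normr1 ?normr0.
    - move=> p; apply: cvg_near_cst; near=> n.
      have [n1 n2] : (forall i, `|p.1 ord0 i| < n%:R) /\ `|p.2| < n%:R.
        by near: n; exact: near_lt_nat.
      rewrite indicE mem_set//; split; last by rewrite -ltr_norml.
      by move=> i; rewrite !mxE -ltr_norml.
  rewrite (_ : (fun n => _) = cst 0%E); last first.
    by apply/funext => n; rewrite -intI; [exact: U0|exact: measurable_box].
  move=> /cvg_lim => /(_ (@ereal_hausdorff _)); rewrite lim_cst// => ->.
  by apply: eq_integral => p _; rewrite mulr1.
have UE (A : set (Rn * Rt)) : measurable A -> (\int[mu]_(p in A) (U p)%:E = 0)%E.
  rewrite boxes_generate.
  apply: (@dynkin_induction _ _ boxes (fun A => (\int[mu]_(p in A) (U p)%:E = 0)%E)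
    boxes_generate) => //.
  - exact: boxes_setI_closed.
  - by move=> _ [a [b [c [d ->]]]]; exact: U0.
  - move=> S mS US.
    have := @integral_setU _ _ _ mu S (~` S) (EFin \o U) mS (measurableC mS).
    rewrite setUv => /(_ (measurable_int _ iU)) /=; rewrite UT US add0e => <- //.
    exact/disj_setPCl.
  - move=> F mF tF F0.
    rewrite integral_bigcup//; first by rewrite eseries0.
    by apply: integrableS iU => //; exact: bigcupT_measurable.
have := @integral_ae_eq _ _ _ mu setT measurableT (cst 0%E) (EFin \o U) iU
  (measurable_cst _).
case.
  by move=> E _ mE; rewrite UE// integral0.
move=> A [mA muA sA]; exists A; split => // p /= pU; apply: sA => /= H.
by apply: pU; have [] := H I.
Unshelve. all: by end_near. Qed.

Lemma box_bumps_determine (T : R) (U : Rn * Rt -> R) : 0 < T ->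
  in_L1 mu (Q T) U ->
  (forall a b c d n, d < T ->
    (\int[mu]_(p in Q T) (U p * box_bump a b c d n p)%:E = 0)%E) ->
  {ae mu, forall p, Q T p -> U p = 0}.
Proof.
move=> T0 iU U0.
pose V : Rn * Rt -> R := U \_ (Q T).
have iV : mu.-integrable setT (EFin \o V).
  rewrite /V -restrict_EFin; apply/integrable_restrict => //.
    exact: measurable_Q.
  by rewrite setTI.
suff : {ae mu, forall p, V p = 0}.
  by apply: filterS => p; rewrite /V patchE => + Qp; rewrite mem_set.
apply: integral_eq0_on_boxes_ae0 => // a b c d.
(* Stays strictly below T and tends to [Num.min d T]; the box ending there has the same trace on the
   slab as the box ending at [d]. *)
pose d_ (n : nat) := Num.min d T - n.+1%:R^-1.
have V0 n : (\int[mu]_p (V p * box_bump a b c (d_ n) n p)%:E = 0)%E.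
  rewrite -(U0 a b c (d_ n) n); last first.
    by rewrite /d_ ltrBlDr (@le_lt_trans _ _ T)// ?ge_min ?lexx ?orbT// ltrDl invr_gt0.
  rewrite [RHS]integral_mkcond; apply: eq_integral => p _.
  by rewrite /V !patchE; case: ifPn => // _; rewrite mul0r.
have : (\int[mu]_p (V p * box_bump a b c (d_ n) n p)%:E)%E @[n --> \oo] -->
    (\int[mu]_p (V p * \1_(box a b c (Num.min d T)) p)%:E)%E.
  apply: dominated_multiplier_cvg => //.
  - move=> n; apply: continuous_prod_measurable.
    by have [] := @is_smooth_box_bump R N a b c (d_ n) n 0.
  - by apply: measurable_indic; exact: measurable_box.
  - move=> n p; have /andP[b0 b1] := box_bump_itv a b c (d_ n) n p.
    by rewrite ger0_norm.
  - move=> p; apply: box_bump_cvg.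
      by move=> n; rewrite /d_ gerBl.
    rewrite -[X in _ --> X]subr0; apply: cvgB; first exact: cvg_cst.
    exact: cvg_harmonic.
under eq_fun do rewrite V0.
move=> /cvg_lim => /(_ (@ereal_hausdorff _)); rewrite lim_cst// => E.
rewrite [RHS]E integral_mkcond; apply: eq_integral => p _.
rewrite patchE indicE /V patchE.
have [pQ|pQ] := boolP (p \in Q T); last by rewrite mul0r; case: ifP.
rewrite (_ : (p \in box a b c (Num.min d T)) = (p \in box a b c d)); last first.
  move/set_mem : pQ => /= /andP[_ pT]; apply/idP/idP => /set_mem[p1 p2];
    apply/mem_set; split=> //; move: p2; rewrite lt_min pT andbT//.
by case: (p \in box _ _ _ _); rewrite ?mulr1 ?mulr0.
Qed.

End box_bumps_determine.

(** * Disintegration *)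

Section integral_null_set.
Context d (X : measurableType d) (R : realType) (mu : {measure set X -> \bar R}).
Variable A : set X.
Hypotheses (mA : measurable A) (A0 : mu (~` A) = 0%E).
Local Open Scope ereal_scope.

Import HBNNSimple.

(** The integral is a supremum over simple functions below [f], and cutting a simple function down
    to [A] does not change its integral. This will discard base points where no measurability of the
    kernel integrals is known. *)
Let ge0_integral_conull (f : X -> \bar R) : (forall x, 0 <= f x) ->
  \int[mu]_x f x = \int[mu]_x (f \_ A) x.
Proof.
move=> f0; have fA0 x : 0 <= (f \_ A) x by rewrite patchE; case: ifP.
rewrite !ge0_integralTE//; apply/eqP; rewrite eq_le; apply/andP; split.
  apply: ge_ereal_sup => _ [h /= hf <-].
  have -> : sintegral mu h = sintegral mu (proj_nnsfun h mA).
    rewrite -!integralT_nnsfun (ge0_negligible_integral (measurableC mA))//.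
    - rewrite setTD setCK integral_mkcond; apply: eq_integral => x _ /=.
      by rewrite patchE mindicE; case: ifP => _; rewrite ?mulr1 ?mulr0.
    - exact/measurable_EFinP.
    - by move=> x _; rewrite lee_fin.
  apply: ereal_sup_ubound; exists (proj_nnsfun h mA) => //= x.
  rewrite mindicE; move: (hf x); rewrite patchE; case: ifP => _.
    by rewrite mulr1.
  by rewrite mulr0.
apply: ereal_sup_le => _ [h /= hf <-]; exists h => // x.
by apply: le_trans (hf x) _; rewrite patchE; case: ifP.
Qed.

(* f need not be measurable. *)
Lemma integral_conull (f : X -> \bar R) :
  \int[mu]_x f x = \int[mu]_x (f \_ A) x.
Proof.
rewrite integralE [RHS]integralE funepos_restrict funeneg_restrict.
by rewrite (@ge0_integral_conull f^\+)// (@ge0_integral_conull f^\-).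
Qed.

End integral_null_set.

Section disintegration.
Local Open Scope ereal_scope.
Context d d' (X : measurableType d) (Y : measurableType d') (R : realType).
Variable k : X -> {measure set Y -> \bar R}.
Hypothesis mk : forall C, measurable C ->
  measurable_fun [set: X] (fun x => k x (xsection C x)).

Import HBNNSimple.

(** Measurability of the masses of sections takes the place of s-finiteness of the kernel; it
    extends from sets to simple functions and then to increasing limits. *)
Lemma ge0_measurable_integral_sections (f : X * Y -> \bar R) :
  (forall z, 0 <= f z) -> measurable_fun setT f ->
  measurable_fun setT (fun x => \int[k x]_y f (x, y)).
Proof.
move=> f0 mf; pose f_ := nnsfun_approx measurableT mf.
apply: (measurable_fun_xsection_integral f k f_).
- by move=> a b ab; exact/nd_nnsfun_approx.
- by move=> z; exact/cvg_nnsfun_approx.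
- by move=> n r; exact: mk.
Qed.

Lemma measurable_integral_sections (f : X * Y -> \bar R) :
  measurable_fun setT f -> measurable_fun setT (fun x => \int[k x]_y f (x, y)).
Proof.
move=> mf.
rewrite (_ : (fun x => _) = (fun x => \int[k x]_y f^\+ (x, y)) \-
    (fun x => \int[k x]_y f^\- (x, y))).
  by apply: emeasurable_funB; apply: ge0_measurable_integral_sections => //;
    [exact: measurable_funepos|exact: measurable_funeneg].
apply/funext => x; rewrite integralE.
under eq_integral do rewrite funepos_comp/=.
by under [X in _ - X = _]eq_integral do rewrite funeneg_comp/=.
Qed.

Variables (m : {measure set X -> \bar R}) (L : {measure set (X * Y) -> \bar R}).
Hypothesis Lk : forall C, measurable C -> L C = \int[m]_x k x (xsection C x).

Let integral_nnsfun_section (h : {nnsfun (X * Y) >-> R}) x :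
  \int[k x]_y (h (x, y))%:E =
    \sum_(r \in range h) r%:E * k x (xsection (h @^-1` [set r]) x).
Proof.
under eq_integral do rewrite fimfunE -fsumEFin//.
rewrite ge0_integral_fsum //; last 2 first.
- move=> r; apply/measurable_EFinP/measurableT_comp => //.
  exact/measurableT_comp.
- by move=> r y _; rewrite EFinM nnfun_muleindic_ge0.
apply: eq_fsbigr => r; rewrite inE => -[/= z _ <-{r}].
under eq_integral do rewrite EFinM.
rewrite ge0_integralZl//; last 2 first.
- exact/measurable_EFinP/measurableT_comp.
- by rewrite lee_fin.
congr (_ * _); rewrite integral_indic ?setIT//.
  by congr (k x _); apply/seteqP; split => y; rewrite /xsection /= inE.
rewrite (_ : (fun y => _) = xsection (h @^-1` [set h z]) x).
  exact: measurable_xsection.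
by rewrite /xsection; apply/seteqP; split => y /=; rewrite inE.
Qed.

Let integral_nnsfun (h : {nnsfun (X * Y) >-> R}) :
  \int[L]_z (h z)%:E = \int[m]_x \int[k x]_y (h (x, y))%:E.
Proof.
under [RHS]eq_integral do rewrite integral_nnsfun_section.
rewrite ge0_integral_fsum//; last 2 first.
- by move=> r; apply: measurable_funeM; exact: mk.
- move=> r x _; have [r0|r0] := leP 0%R r; first by rewrite mule_ge0.
  by rewrite preimage_nnfun0// xsection0 measure0 mule0.
rewrite integralT_nnsfun sintegralE; apply: eq_fsbigr => r; rewrite inE.
move=> -[/= z _ <-{r}]; rewrite ge0_integralZl//; [by rewrite Lk|exact: mk|by rewrite lee_fin].
Qed.

Lemma ge0_integral_disintegration (f : X * Y -> \bar R) :
  (forall z, 0 <= f z) -> measurable_fun setT f ->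
  \int[L]_z f z = \int[m]_x \int[k x]_y f (x, y).
Proof.
move=> f0 mf; pose f_ := nnsfun_approx measurableT mf.
have f_nd z : nondecreasing_seq (fun n => (f_ n z)%:E).
  by move=> a b ab; rewrite lee_fin; exact/lefP/nd_nnsfun_approx.
have E1 x : \int[k x]_y f (x, y) = limn (fun n => \int[k x]_y (f_ n (x, y))%:E).
  rewrite -monotone_convergence//.
  - by apply: eq_integral => y _; apply/esym/cvg_lim => //; exact/cvg_nnsfun_approx.
  - by move=> n; apply/measurable_EFinP/measurableT_comp.
  - by move=> n y _; rewrite lee_fin.
under [RHS]eq_integral do rewrite E1.
rewrite monotone_convergence//; last 3 first.
- move=> n; apply: (@ge0_measurable_integral_sections (EFin \o f_ n)).
    by move=> z; rewrite /= lee_fin.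
  exact/measurable_EFinP.
- by move=> n x _; apply: integral_ge0 => y _; rewrite lee_fin.
- move=> x _ a b ab; apply: ge0_le_integral => //.
  + by move=> y _; rewrite lee_fin.
  + by apply/measurable_EFinP/measurableT_comp.
  + by apply/measurable_EFinP/measurableT_comp.
  + by move=> y _; exact: f_nd.
rewrite (_ : (fun n => _) = (fun n => \int[L]_z (f_ n z)%:E)); last first.
  by apply/funext => n; rewrite integral_nnsfun.
rewrite -monotone_convergence//.
- by apply: eq_integral => z _; apply/esym/cvg_lim => //; exact/cvg_nnsfun_approx.
- by move=> n; apply/measurable_EFinP.
- by move=> n y _; rewrite lee_fin.
Qed.

Lemma integral_disintegration (f : X * Y -> \bar R) : L.-integrable setT f ->
  \int[L]_z f z = \int[m]_x \int[k x]_y f (x, y).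
Proof.
move=> iL; have mf := measurable_int _ iL.
have fin (g : X * Y -> \bar R) : (forall z, 0 <= g z) -> L.-integrable setT g ->
    m.-integrable setT (fun x => \int[k x]_y g (x, y)).
  move=> g0 ig; have mg := measurable_int _ ig; apply/integrableP; split.
    exact: ge0_measurable_integral_sections.
  under eq_integral do rewrite gee0_abs ?integral_ge0//.
  rewrite -ge0_integral_disintegration//.
  by case/integrableP : ig => _; under eq_integral do rewrite gee0_abs//.
rewrite [LHS]integralE (@ge0_integral_disintegration f^\+)//; last first.
  exact: measurable_funepos.
rewrite (@ge0_integral_disintegration f^\-)//; last exact: measurable_funeneg.
rewrite -integralB//; last 2 first.
- by apply: fin => //; exact: integrable_funepos.
- by apply: fin => //; exact: integrable_funeneg.
apply: eq_integral => x _; rewrite [RHS]integralE.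
under [in RHS]eq_integral do rewrite funepos_comp/=.
by under [X in _ = _ - X]eq_integral do rewrite funeneg_comp/=.
Qed.

End disintegration.

Section restricted_kernel.
Context d d' d'' (Z : measurableType d) (X : measurableType d')
  (Y : measurableType d'') (R : realType).
Variables (l : R.-ker X ~> Y) (g : Z -> X) (A : set X).

(** With the zero measure outside [A], finiteness known on [A] holds for every parameter. The base
    point is [g z] so that a parameter may carry more than the base point, such as the time. *)
Definition krestr (mg : measurable_fun setT g) (mA : measurable A) (z : Z) :
    {measure set Y -> \bar R} :=
  if g z \in A then l (g z) else mzero.

Variables (mg : measurable_fun setT g) (mA : measurable A).

Let measurable_krestr U : measurable U ->
  measurable_fun [set: Z] (krestr mg mA ^~ U).
Proof.
move=> mU; rewrite (_ : krestr mg mA ^~ U = fun z => (l (g z) U * (\1_A (g z))%:E)%E).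
  apply: emeasurable_funM.
    by apply: (measurableT_comp (measurable_kernel l U mU) mg).
  apply/measurable_EFinP; apply: measurableT_comp mg.
  exact: measurable_indic.
apply/funext => z; rewrite /krestr indicE; case: ifPn => _; first by rewrite mule1.
by rewrite mule0.
Qed.

HB.instance Definition _ := isKernel.Build _ _ _ _ _ (krestr mg mA) measurable_krestr.

End restricted_kernel.

(** * Measurability of sections for kernels singular on the diagonal *)

Section off_diagonal_kernel.
Context {R : realType} {N : nat}.
Local Notation Rn := ('rV[R]_N).
Variables (l : R.-ker Rn ~> Rn) (G : set Rn) (mG : measurable G).
Hypothesis l_fin : forall x r, G x -> 0 < r ->
  (l x [set y | (r < `|y - x|)%R] < +oo)%E.
Hypothesis l_diag : punctured_kernel l.

Lemma measurable_norm_gt (q : Rn) (r : R) : measurable [set y : Rn | r < `|y - q|].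
Proof.
apply: rV_open_measurable.
rewrite (_ : [set _ | _] = (fun y : Rn => `|y - q|) @^-1` `]r, +oo[); last first.
  by apply/seteqP; split => y /=; rewrite in_itv/= andbT.
apply: open_comp; last exact: interval_open.
move=> y _; apply: (@continuous_comp _ _ _ (fun y : Rn => y - q) Num.norm).
  exact: (@cvgB _ _ _ (nbhs y) _ id (cst q) _ _ cvg_id (cvg_cst q)).
exact: norm_continuous.
Qed.

(* Countably many rectangles at positive distance from the diagonal cover its
   complement; on each of them the kernel is finite. *)
Let rad (k : 'rV[rat]_N * nat) : R := k.2.+1%:R^-1.
Let ctr (k : 'rV[rat]_N * nat) : Rn := map_mx ratr k.1.

Definition off_diag_left (j : nat) : set Rn :=
  if unpickle j is Some k then ball (ctr k) (rad k) else set0.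

(** The factor 2 leaves a distance of at least [rad k] between this set and the ball
    [off_diag_left j]. *)
Definition off_diag_right (j : nat) : set Rn :=
  if unpickle j is Some k then [set y | 2 * rad k < `|y - ctr k|] else set0.

Lemma measurable_off_diag_left j : measurable (off_diag_left j).
Proof.
rewrite /off_diag_left; case: unpickle => // k.
by apply: rV_open_measurable; exact: ball_open.
Qed.

Lemma measurable_off_diag_right j : measurable (off_diag_right j).
Proof.
by rewrite /off_diag_right; case: unpickle => // k; exact: measurable_norm_gt.
Qed.

Lemma off_diag_dist j : exists2 r : R, 0 < r & forall x y,
  off_diag_left j x -> off_diag_right j y -> r < `|y - x|.
Proof.
rewrite /off_diag_left /off_diag_right; case: unpickle => [k|]; last by exists 1.
exists (rad k) => [|x y]; first by rewrite /rad invr_gt0.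
rewrite -ball_normE/= => xk yk.
have := ler_distD x y (ctr k) => H.
have : `|x - ctr k| < rad k by rewrite distrC.
move: yk H; lra.
Qed.

Lemma off_diag_cover x y : x != y ->
  exists j, off_diag_left j x /\ off_diag_right j y.
Proof.
(* If the radius is less than a third of the distance and the centre is within one radius of [x],
   then [y] is more than two radii away from the centre. *)
move=> xy; have e0 : 0 < `|y - x| / 3 by rewrite divr_gt0// normr_gt0 subr_eq0 eq_sym.
have [n ne] : exists n, n.+1%:R^-1 < `|y - x| / 3.
  exists (Num.truncn (`|y - x| / 3)^-1).
  by rewrite invf_plt ?posrE// truncnS_gt.
have app (r : R) : exists q : rat, ball (ratr q : R) n.+1%:R^-1 r.
  have [|q] := @rat_in_itvoo R (r - n.+1%:R^-1) (r + n.+1%:R^-1).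
    by rewrite ltrD2l gtrN.
  rewrite in_itv/= => /andP[q1 q2]; exists q.
  by rewrite -ball_normE/= ltr_distl q1.
have [q Hq] := choice (fun i => app (x ord0 i)).
exists (pickle (\row_i q i, n)).
rewrite /off_diag_left /off_diag_right pickleK.
have bx : ball (ctr (\row_i q i, n)) (rad (\row_i q i, n)) x.
  split => [|i j]; first by rewrite /rad invr_gt0.
  by rewrite !mxE ord1; exact: Hq.
split => //=; move: bx; rewrite -ball_normE/= /rad/=.
set c := ctr _; move=> xc.
have := ler_distD c y x.
move: xc ne; rewrite /rad /=; move: (n.+1%:R^-1 : R) => r; lra.
Qed.

Section sections.
Context d (Z : measurableType d).
Variables (g : Z -> Rn) (mg : measurable_fun setT g).

(** The rectangles are made disjoint so that the mass of a section is the sum of the masses of its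
    pieces. *)
Let P j := seqDU (fun j => off_diag_left j `*` off_diag_right j) j.

Let P_sub j x y : P j (x, y) -> off_diag_left j x /\ off_diag_right j y.
Proof. by move=> [[]]. Qed.

Let mP j : measurable (P j).
Proof.
rewrite /P /seqDU; apply: measurableD.
  by apply: measurableX; [exact: measurable_off_diag_left|exact: measurable_off_diag_right].
apply: bigsetU_measurable => i _.
by apply: measurableX; [exact: measurable_off_diag_left|exact: measurable_off_diag_right].
Qed.

Let mAG j : measurable (off_diag_left j `&` G).
Proof. by apply: measurableI => //; exact: measurable_off_diag_left. Qed.

Let piece (C : set (Z * Rn)) j := C `&` (fun w => (g w.1, w.2)) @^-1` P j.

Let in_piece C j z y : xsection (piece C j) z y -> C (z, y) /\ P j (g z, y).
Proof. by move=> /xsectionP. Qed.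

Let mpiece C j : measurable C -> measurable (piece C j).
Proof.
move=> mC; apply: measurableI => //; rewrite -[X in measurable X]setTI.
have : measurable_fun setT (fun w : Z * Rn => (g w.1, w.2)).
  apply/measurable_fun_pairP; split => /=; last exact: measurable_snd.
  exact: (measurableT_comp mg measurable_fst).
exact.
Qed.

Let mpiece_section C j : measurable C ->
  measurable_fun setT (fun z => krestr l mg (mAG j) z
    (xsection (piece C j) z `&` off_diag_right j)).
Proof.
move=> mC.
pose k : R.-ker Z ~> Rn := krestr l mg (mAG j).
have [] // := @measurable_prod_subset_xsection_kernel _ _ _ _ _ k _
  (measurable_off_diag_right j) _ _ (mpiece j mC).
(* The bound may depend on [z], but it has to be strict, hence [+ 1]. *)
move=> z; exists (fine (k z (off_diag_right j)) + 1) => U mU.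
have kfin : (k z (off_diag_right j) < +oo)%E.
  rewrite /k/= /krestr; case: ifPn => [/set_mem[zj zG]|]; last by rewrite ltry.
  have [r r0 jr] := off_diag_dist j.
  apply: le_lt_trans (l_fin zG r0); apply: le_measure; rewrite ?inE.
  - exact: measurable_off_diag_right.
  - exact: measurable_norm_gt.
  - by move=> y yj; exact: jr.
rewrite EFinD fineK ?ge0_fin_numE//.
apply: (@le_lt_trans _ _ (k z (off_diag_right j))).
  apply: le_measure; rewrite ?inE//; [apply: measurableI => //|].
  - exact: measurable_off_diag_right.
  - exact: measurable_off_diag_right.
by rewrite lteDl ?lte01// ge0_fin_numE.
Qed.

(** The mass of a section is a countable sum over the pieces, each governed by a finite kernel; the
    point [g z] itself, which no piece contains, is null by [l_diag]. *)
Lemma measurable_krestr_xsection C : measurable C ->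
  measurable_fun setT (fun z => krestr l mg mG z (xsection C z)).
Proof.
move=> mC.
rewrite (_ : (fun z => _) = (fun z => \sum_(j <oo)
    krestr l mg (mAG j) z
      (xsection (piece C j) z `&` off_diag_right j))%E); last first.
  apply/funext => z; rewrite /krestr.
  have [zG|zG] := boolP (g z \in G); last first.
    rewrite /mzero/= eseries0// => j _ _; rewrite ifF//.
    by apply/negP => /set_mem[_ /mem_set]; exact/negP.
  have mz j : measurable (xsection (piece C j) z).
    by apply: measurable_xsection; exact: mpiece.
  have -> : l (g z) (xsection C z) = l (g z) (\bigcup_j xsection (piece C j) z).
    have m1 : measurable [set g z].
      by apply: rV_compact_measurable; exact: compact_set1.
    have mCz : measurable (xsection C z) by exact: measurable_xsection.
    rewrite (measureDI _ mCz m1) [X in (_ + X)%E](_ : _ = 0%E) ?adde0; last first.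
      apply/eqP; rewrite eq_le measure_ge0 andbT -(l_diag (g z)).
      by apply: le_measure; rewrite ?inE//; exact: measurableI.
    congr (l _ _); apply/seteqP; split=> [y [/xsectionP Cy /eqP yz]|y [j _ /in_piece]].
      have /off_diag_cover[j jP] : g z != y by rewrite eq_sym.
      have : (\bigcup_j P j) (g z, y).
        by rewrite /P -seqDU_bigcup_eq; exists j.
      by move=> [i _ iP]; exists i => //; apply/xsectionP.
    move=> [Cy /P_sub[zj yj]]; split; first exact/xsectionP.
    move=> yz; have [r r0 /(_ _ _ zj yj)] := off_diag_dist j.
    by rewrite yz subrr normr0 ltNge ltW.
  rewrite measure_semi_bigcup//; last 2 first.
  - apply/trivIsetP => i j _ _ ij; apply/seteqP; split => // y.
    move=> [/in_piece[_ iP] /in_piece[_ jP]].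
    have /trivIsetP/(_ i j I I ij) := @trivIset_seqDU _ (fun j => off_diag_left j `*` off_diag_right j).
    by move=> /seteqP[/(_ (g z, y)) + _]; apply.
  - exact: bigcupT_measurable.
  apply: eq_eseriesr => j _; case: ifPn => [/set_mem[zj _]|zj].
    congr (l _ _); rewrite setIidl// => y /in_piece[_ /P_sub[]]//.
  rewrite /mzero (_ : xsection _ _ = set0) ?measure0//.
  apply/seteqP; split => // y /in_piece[_ /P_sub[zj1 _]].
  by move/negP : zj; apply; apply/mem_set; split=> //; exact/set_mem.
apply: ge0_emeasurable_sum => // j _; exact: mpiece_section.
Qed.

End sections.
End off_diagonal_kernel.

Section euclidean_norm.
Context {R : realType} {N : nat}.
Local Notation Rn := ('rV[R]_N).
Implicit Type z : Rn.

Lemma enorm_ge0 z : 0 <= enorm z.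
Proof. exact: sqrtr_ge0. Qed.

Lemma norm_le_enorm z : `|z| <= enorm z.
Proof.
rewrite /Num.norm/= mx_normrE; apply: bigmax_le; first exact: enorm_ge0.
move=> [i j] _ /=; rewrite ord1 /enorm -sqrtr_sqr ler_wsqrtr//.
by rewrite (bigD1 j)//= lerDl sumr_ge0// => k _; exact: sqr_ge0.
Qed.

Lemma enorm_gt0 z : (0 < enorm z) = (z != 0).
Proof.
apply/idP/idP => [|z0]; last by rewrite (lt_le_trans _ (norm_le_enorm z))// normr_gt0.
apply: contraTN => /eqP ->; rewrite /enorm big1 ?sqrtr0 ?ltxx// => i _.
by rewrite mxE expr0n.
Qed.

Lemma measurable_enorm : measurable_fun setT (@enorm R N).
Proof.
apply: (measurableT_comp (continuous_measurable_fun (@sqrt_continuous R))).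
by apply: measurable_sum => i; apply: measurable_funX; exact: rV_coord_measurable.
Qed.

Lemma measurable_rV_sub (x : Rn) : measurable_fun setT (fun y : Rn => y - x).
Proof.
apply: rV_measurableP => i; under eq_fun do rewrite !mxE.
by apply: measurable_funB => //; exact: rV_coord_measurable.
Qed.

Lemma measurable_rV_add (x : Rn) : measurable_fun setT (fun y : Rn => x + y).
Proof.
apply: rV_measurableP => i; under eq_fun do rewrite !mxE.
by apply: measurable_funD => //; exact: rV_coord_measurable.
Qed.

End euclidean_norm.

(** * Finite mass away from the diagonal at almost every point *)

Section levy_good_set.
Context {R : realType} {N : nat}.
Local Notation Rn := ('rV[R]_N).
Local Notation leb := (rV_lebesgue R N).
Variable lamt : R.-ker Rn ~> Rn.
Hypothesis levy : levy_integrable (translated lamt).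
Local Open Scope ereal_scope.

Let F1 (x : Rn) := \int[translated lamt x]_(z in [set z | (0 < enorm z <= 1)%R])
  (enorm z ^+ 2)%:E.
Let F2 (x : Rn) := translated lamt x [set z | (1 < enorm z)%R].

Let mS1 : measurable [set z : Rn | (0 < enorm z <= 1)%R].
Proof.
rewrite (_ : [set _ | _] = setT `&` @enorm R N @^-1` `]0%R, 1%R]); last first.
  by rewrite setTI; apply/seteqP; split => z /=; rewrite in_itv.
by apply: measurable_enorm.
Qed.

Let mS2 : measurable [set z : Rn | (1 < enorm z)%R].
Proof.
rewrite (_ : [set _ | _] = setT `&` @enorm R N @^-1` `]1%R, +oo[); last first.
  by rewrite setTI; apply/seteqP; split => z /=; rewrite in_itv/= andbT.
by apply: measurable_enorm.
Qed.

(** Chebyshev's inequality: where [r] is exceeded and the Euclidean norm is at most 1, the integrand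
    of [F1] is at least [r ^+ 2], as the sup norm is below the Euclidean one. The remaining part is
    [F2]. *)
Let F_fin x r : F1 x \is a fin_num -> F2 x \is a fin_num -> (0 < r)%R ->
  lamt x [set y | (r < `|y - x|)%R] < +oo.
Proof.
move=> F1fin F2fin r0.
pose phi (y : Rn) := (y - x)%R.
pose A1 := phi @^-1` [set z : Rn | (0 < enorm z <= 1)%R].
pose A2 := phi @^-1` [set z : Rn | (1 < enorm z)%R].
pose B := [set y : Rn | (r < `|y - x|)%R].
have mA1 : measurable A1.
  by rewrite -[X in measurable X]setTI; exact: (measurable_rV_sub x).
have mA2 : measurable A2.
  by rewrite -[X in measurable X]setTI; exact: (measurable_rV_sub x).
have mB : measurable B by exact: measurable_norm_gt.
apply: (@le_lt_trans _ _ (lamt x ((A1 `&` B) `|` A2))).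
  apply: le_measure; rewrite ?inE//; first by apply: measurableU => //; exact: measurableI.
  move=> y rB; have [y1|y1] := leP (enorm (phi y)) 1%R; [left|right]=> //.
  split => //; rewrite /A1 /= y1 andbT (lt_le_trans _ (norm_le_enorm _))//.
  exact: lt_trans rB.
apply: le_lt_trans (measureU2 _ _ _) _ => //; first exact: measurableI.
rewrite lte_add_pinfty//; last by rewrite -ge0_fin_numE.
have : (r ^+ 2)%:E * lamt x (A1 `&` B) < +oo.
  rewrite -integral_cst; last exact: measurableI.
  apply: (@le_lt_trans _ _ (F1 x)); last first.
    by move: F1fin; rewrite fin_numElt => /andP[].
  rewrite /F1 /translated (ge0_integral_pushforward (measurable_rV_sub x))//; last 2 first.
  - apply/measurable_EFinP; apply: measurable_funX; apply: measurable_funTS.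
    exact: measurable_enorm.
  - by move=> z _; rewrite lee_fin sqr_ge0.
  have m1 : measurable_fun setT (fun y => ((enorm (phi y)) ^+ 2)%:E).
    apply/measurable_EFinP; apply: measurable_funX.
    by apply: measurableT_comp; [exact: measurable_enorm|exact: measurable_rV_sub].
  apply: (@le_trans _ _ (\int[lamt x]_(y in A1 `&` B) (enorm (phi y) ^+ 2)%:E)).
    apply: ge0_le_integral => //.
    + exact: measurableI.
    + by move=> y _; rewrite lee_fin sqr_ge0.
    + exact: measurable_funTS.
    + move=> y [_ /= yB]; rewrite lee_fin ler_sqr ?nnegrE ?enorm_ge0 ?(ltW r0)//.
      by rewrite (le_trans (ltW yB))// norm_le_enorm.
  apply: ge0_subset_integral => //; [exact: measurableI|exact: measurable_funTS|].
  by move=> y _; rewrite lee_fin sqr_ge0.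
have r20 : (0 < r ^+ 2)%R by rewrite exprn_gt0.
have cancel (L : \bar R) : (r ^+ 2)%:E * L < +oo -> L < +oo.
  by case: L => [s _||//]; rewrite ?ltry// gt0_muley// lte_fin.
exact: cancel.
Qed.

Lemma levy_good_set : exists G : set Rn, [/\ measurable G, leb (~` G) = 0 &
  forall x r, G x -> (0 < r)%R -> lamt x [set y | (r < `|y - x|)%R] < +oo].
Proof.
pose G := [set x | F1 x \is a fin_num /\ F2 x \is a fin_num].
pose K (n : nat) : set Rn := [set v | forall i, [set` `[- n%:R, n%:R]%R] (v ord0 i)].
have cK n : compact (K n).
  by apply: (@rV_compact R N (fun=> [set` `[- n%:R, n%:R]%R])) => i; exact: segment_compact.
have mK n : measurable (K n) by exact: rV_compact_measurable.
have KT x : exists n, K n x.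
  have [n _ /(_ n (leqnn n))[H _]] := @near_lt_nat R N (x, 0%R).
  by exists n => i /=; rewrite in_itv/= -ler_norml ltW.
have mfin n (F : Rn -> \bar R) : measurable_fun (K n) F ->
    measurable (K n `&` [set x | F x \is a fin_num]).
  by move=> mF; exact: emeasurable_fin_num.
have mG : measurable G.
  (* [F1] and [F2] are known to be measurable only on compact sets, through their local
     integrability, so [G] is assembled from cubes. *)
  rewrite (_ : G = \bigcup_n ((K n `&` [set x | F1 x \is a fin_num]) `&`
     (K n `&` [set x | F2 x \is a fin_num]))); last first.
    apply/seteqP; split=> [x [x1 x2]|x [n _ [[_ ?] [_ ?]]]]; last by split.
    by have [n xn] := KT x; exists n.
  apply: bigcupT_measurable => n; have [i1 i2] := levy (cK n).
  by apply: measurableI; apply: mfin; [exact: measurable_int i1|exact: measurable_int i2].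
exists G; split => //; last by move=> x r [? ?]; exact: F_fin.
suff : leb.-negligible (~` G) by move/negligibleP; apply; exact: measurableC.
have : {ae leb, forall x, forall n, K n x -> F1 x \is a fin_num /\ F2 x \is a fin_num}.
  apply: ae_foralln => n; have [i1 i2] := levy (cK n).
  have := integrable_ae (mK n) i2; have := integrable_ae (mK n) i1.
  apply: filterS2 => x H1 H2 Kx; split; [exact: H1|exact: H2].
apply: negligibleS => x /= nG H; apply: nG.
by have [n xn] := KT x; exact: H xn.
Qed.

End levy_good_set.

(** * The quadratic form in time *)

Section sigma_finite_product.
Context d1 d2 (T1 : measurableType d1) (T2 : measurableType d2) (R : realType).
Variables (m1 : {sigma_finite_measure set T1 -> \bar R})
  (m2 : {sigma_finite_measure set T2 -> \bar R}).

(** A copy of the product measure that carries the sigma-finite structure, so that it can itself be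
    a factor of a product. *)
Definition sfprod : set (T1 * T2) -> \bar R := (m1 \x m2)%E.

HB.instance Definition _ := Measure.on sfprod.

HB.instance Definition _ :=
  Measure_isSigmaFinite.Build _ _ _ sfprod (sigma_finite_prod m1 m2).

End sigma_finite_product.

Section quadratic_form.
Context dW dS (W : measurableType dW) (S : measurableType dS) (R : realType).
Variables (L : {sigma_finite_measure set W -> \bar R})
  (tau : {sigma_finite_measure set S -> \bar R}).
Hypothesis tau_fin : (tau setT < +oo)%E.
Variables (kap : S * S -> R) (C : R).
Hypotheses (mkap : measurable_fun setT kap) (kapC : forall z, `|kap z| <= C).
Local Open Scope ereal_scope.
Local Notation M := (L \x tau).
Local Notation M2 := (L \x sfprod tau tau).
Implicit Types a h : W * S -> R.

Definition sqint a := measurable_fun setT a /\ \int[M]_z (a z ^+ 2)%:E < +oo.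

Definition qform a h : \bar R :=
  \int[M2]_z (a (z.1, z.2.1) * h (z.1, z.2.2) * kap z.2)%:E.

Let mp1 : measurable_fun setT (fun z : W * (S * S) => (z.1, z.2.1)).
Proof.
apply: measurable_fun_pair; first exact: measurable_fst.
exact: (measurableT_comp measurable_fst measurable_snd).
Qed.

Let mp2 : measurable_fun setT (fun z : W * (S * S) => (z.1, z.2.2)).
Proof.
apply: measurable_fun_pair; first exact: measurable_fst.
exact: (measurableT_comp measurable_snd measurable_snd).
Qed.

Lemma ge0_integral_proj1 (g : W * S -> \bar R) :
  (forall z, 0 <= g z) -> measurable_fun setT g ->
  \int[M2]_z g (z.1, z.2.1) = tau setT * \int[M]_z g z.
Proof.
move=> g0 mg.
have mg1 w : measurable_fun setT (fun t => g (w, t)) by exact: measurableT_comp.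
rewrite (@fubini_tonelli1 _ _ _ _ _ _ _ (fun z => g (z.1, z.2.1)))//; last first.
  exact: (measurableT_comp mg mp1).
rewrite fubini_tonelli1// -ge0_integralZl//; last 2 first.
- exact: measurable_fun_fubini_tonelli_F.
- by move=> w _; exact: integral_ge0.
apply: eq_integral => w _; rewrite /fubini_F /sfprod.
rewrite (@fubini_tonelli1 _ _ _ _ _ tau tau (fun z => g (w, z.1)))//; last first.
  exact: (measurableT_comp (mg1 w) measurable_fst).
rewrite /fubini_F -ge0_integralZl//; apply: eq_integral => t _ /=.
by rewrite (integral_cst tau measurableT) muleC.
Qed.

Lemma ge0_integral_proj2 (g : W * S -> \bar R) :
  (forall z, 0 <= g z) -> measurable_fun setT g ->
  \int[M2]_z g (z.1, z.2.2) = tau setT * \int[M]_z g z.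
Proof.
move=> g0 mg.
have mg1 w : measurable_fun setT (fun t => g (w, t)) by exact: measurableT_comp.
rewrite (@fubini_tonelli1 _ _ _ _ _ _ _ (fun z => g (z.1, z.2.2)))//; last first.
  exact: (measurableT_comp mg mp2).
rewrite fubini_tonelli1// -ge0_integralZl//; last 2 first.
- exact: measurable_fun_fubini_tonelli_F.
- by move=> w _; exact: integral_ge0.
apply: eq_integral => w _; rewrite /fubini_F /sfprod.
rewrite (@fubini_tonelli2 _ _ _ _ _ tau tau (fun z => g (w, z.2)))//; last first.
  exact: (measurableT_comp (mg1 w) measurable_snd).
rewrite /fubini_G -ge0_integralZl//; apply: eq_integral => t _ /=.
by rewrite (integral_cst tau measurableT) muleC.
Qed.

Let C_ge0 : (0 <= C)%R.
Proof. exact: le_trans (normr_ge0 _) (kapC point). Qed.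

Let mint a h : measurable_fun setT a -> measurable_fun setT h ->
  measurable_fun setT (fun z : W * (S * S) =>
    (a (z.1, z.2.1) * h (z.1, z.2.2) * kap z.2)%R).
Proof.
move=> ma mh; apply: measurable_funM.
  by apply: measurable_funM; [exact: (measurableT_comp ma mp1)|exact: (measurableT_comp mh mp2)].
exact: (measurableT_comp mkap measurable_snd).
Qed.

Let msq a : measurable_fun setT a -> measurable_fun setT (fun z => (a z ^+ 2)%:E).
Proof. by move=> ma; apply/measurable_EFinP; exact: measurable_funX. Qed.

(* Young's inequality with a free parameter, used with [e -> 0]. *)
Let le_qform_abs a h (e : R) : measurable_fun setT a -> measurable_fun setT h ->
  (0 < e)%R ->
  \int[M2]_z `|(a (z.1, z.2.1) * h (z.1, z.2.2) * kap z.2)%:E| <=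
  C%:E * (tau setT * (e%:E * \int[M]_z (a z ^+ 2)%:E
                      + (e^-1)%:E * \int[M]_z (h z ^+ 2)%:E)).
Proof.
move=> ma mh e0.
have i0 (g : W * S -> R) : 0 <= \int[M]_z (g z ^+ 2)%:E.
  by apply: integral_ge0 => z _; rewrite lee_fin sqr_ge0.
have ie0 : (0 <= e^-1)%R by rewrite invr_ge0 ltW.
have sq0 (g : W * S -> R) : forall z, [set: W * S] z -> 0 <= (g z ^+ 2)%:E.
  by move=> z _; rewrite lee_fin sqr_ge0.
have p0 (g : W * S -> R) (k : R) : (0 <= k)%R -> forall z, 0 <= k%:E * (g z ^+ 2)%:E.
  by move=> k0 z; rewrite mule_ge0 ?lee_fin ?sqr_ge0.
have Ea : tau setT * (e%:E * \int[M]_z (a z ^+ 2)%:E) =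
    \int[M2]_z (e%:E * (a (z.1, z.2.1) ^+ 2)%:E).
  rewrite -(ge0_integralZl _ measurableT (msq ma) (sq0 a)) ?lee_fin ?(ltW e0)//.
  rewrite -(@ge0_integral_proj1 (fun z => e%:E * (a z ^+ 2)%:E))//.
    exact: (p0 _ _ (ltW e0)).
  by apply: measurable_funeM; exact: (msq ma).
have Eh : tau setT * ((e^-1)%:E * \int[M]_z (h z ^+ 2)%:E) =
    \int[M2]_z ((e^-1)%:E * (h (z.1, z.2.2) ^+ 2)%:E).
  rewrite -(ge0_integralZl _ measurableT (msq mh) (sq0 h)) ?lee_fin//.
  rewrite -(@ge0_integral_proj2 (fun z => (e^-1)%:E * (h z ^+ 2)%:E))//.
    exact: (p0 _ _ ie0).
  by apply: measurable_funeM; exact: (msq mh).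
rewrite ge0_muleDr ?mule_ge0 ?lee_fin ?(ltW e0)// Ea Eh.
have ma1 : measurable_fun setT (fun z : W * (S * S) => e%:E * (a (z.1, z.2.1) ^+ 2)%:E).
  by apply: measurable_funeM; apply: (measurableT_comp (msq ma) mp1).
have mh2 : measurable_fun setT (fun z : W * (S * S) => (e^-1)%:E * (h (z.1, z.2.2) ^+ 2)%:E).
  by apply: measurable_funeM; apply: (measurableT_comp (msq mh) mp2).
have p1 z : 0 <= e%:E * (a (z.1, z.2.1) ^+ 2)%:E := p0 a e (ltW e0) _.
have p2 z : 0 <= (e^-1)%:E * (h (z.1, z.2.2) ^+ 2)%:E := p0 h _ ie0 _.
rewrite -ge0_integralD//; last 2 first.
- by move=> z _; exact: p1.
- by move=> z _; exact: p2.
rewrite -ge0_integralZl//; last 2 first.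
- exact: emeasurable_funD.
- by move=> z _; rewrite adde_ge0 ?p1 ?p2.
apply: ge0_le_integral => //.
- by apply: measurableT_comp => //; apply/measurable_EFinP; exact: mint.
- by apply: measurable_funeM; exact: emeasurable_funD.
move=> z _; set x := a _; set y := h _.
rewrite -[leRHS]/((C * (e * x ^+ 2 + e^-1 * y ^+ 2))%:E) lee_fin normrM mulrC.
rewrite ler_pM//.
rewrite -subr_ge0.
(* [s] is the sign of [x * y]; completing the square treats both signs at once. *)
suff H s : (s ^+ 2 = 1 -> 0 <= e * x ^+ 2 + e^-1 * y ^+ 2 - s * (x * y))%R.
  have [xy|xy] := leP 0%R (x * y)%R.
    by rewrite ger0_norm// -[X in (_ - X)%R]mul1r H// expr1n.
  by rewrite ltr0_norm// -[X in (_ - X)%R]mulN1r H// sqrrN expr1n.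
move=> s1; have -> : (e * x ^+ 2 + e^-1 * y ^+ 2 - s * (x * y) =
  e^-1 * ((e * x - s * y / 2) ^+ 2 + 3 / 4 * y ^+ 2))%R.
  have e00 : e != 0%R by rewrite gt_eqF.
  transitivity (e^-1 * ((e * x) ^+ 2 - e * x * s * y + s ^+ 2 * y ^+ 2 / 4 + 3 / 4 * y ^+ 2))%R.
    by rewrite s1; field.
  by field.
by rewrite mulr_ge0 ?invr_ge0 ?(ltW e0)// addr_ge0 ?sqr_ge0// mulr_ge0 ?sqr_ge0.
Qed.

Lemma qform_integrable a h : sqint a -> sqint h ->
  M2.-integrable setT (fun z => (a (z.1, z.2.1) * h (z.1, z.2.2) * kap z.2)%:E).
Proof.
move=> [ma ia] [mh ih]; apply/integrableP; split.
  by apply/measurable_EFinP; exact: mint.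
apply: le_lt_trans (le_qform_abs ma mh ltr01) _.
have sq_fin (g : W * S -> R) : \int[M]_z (g z ^+ 2)%:E < +oo ->
    \int[M]_z (g z ^+ 2)%:E \is a fin_num.
  move=> ig; rewrite ge0_fin_numE//; apply: integral_ge0 => z _.
  by rewrite lee_fin sqr_ge0.
have tfin : tau setT \is a fin_num by rewrite ge0_fin_numE.
rewrite -(fineK (sq_fin _ ia)) -(fineK (sq_fin _ ih)) -(fineK tfin).
by have : forall c t e1 x e2 y : R, c%:E * (t%:E * (e1%:E * x%:E + e2%:E * y%:E)) < +oo
  by move=> *; exact: ltry.
Qed.

Lemma qformBl a b h : sqint a -> sqint b -> sqint h ->
  qform (a \- b)%R h = qform a h - qform b h.
Proof.
move=> sa sb sh; rewrite -integralB//; [|exact: qform_integrable..].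
by apply: eq_integral => z _ /=; rewrite -EFinB !mulrBl.
Qed.

Lemma qformBr a b h : sqint a -> sqint b -> sqint h ->
  qform h (a \- b)%R = qform h a - qform h b.
Proof.
move=> sa sb sh; rewrite -integralB//; [|exact: qform_integrable..].
by apply: eq_integral => z _ /=; rewrite -EFinB mulrBr mulrBl.
Qed.

Lemma qform_fin_num a h : sqint a -> sqint h -> qform a h \is a fin_num.
Proof. by move=> sa sh; apply: integrable_fin_num => //; exact: qform_integrable. Qed.

Lemma qform_cvg a h (h_ : nat -> W * S -> R) : sqint a -> sqint h ->
  (forall n, sqint (h_ n)) ->
  (\int[M]_z ((h_ n z - h z) ^+ 2)%:E @[n --> \oo] --> 0) ->
  qform a (h_ n) @[n --> \oo] --> qform a h.
Proof.
move=> sa sh sh_ cv.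
have [ma ia] := sa; have [mh ih] := sh.
have tfin : tau setT \is a fin_num by rewrite ge0_fin_numE.
have i0 (g : W * S -> R) : 0 <= \int[M]_z (g z ^+ 2)%:E.
  by apply: integral_ge0 => z _; rewrite lee_fin sqr_ge0.
have afin : \int[M]_z (a z ^+ 2)%:E \is a fin_num by rewrite ge0_fin_numE.
pose A := fine (\int[M]_z (a z ^+ 2)%:E); pose t := fine (tau setT).
have A0 : (0 <= A)%R by exact: fine_ge0.
have t0 : (0 <= t)%R by exact: fine_ge0.
have Ct0 : (0 <= C * t)%R by exact: mulr_ge0.
have [cfin cv0] := (fine_cvgP _ _).1 cv.
rewrite -(fineK (qform_fin_num sa sh)); apply/fine_cvgP; split.
  by apply: nearW => n; exact: qform_fin_num.
apply/cvgrPdist_le => eps eps0.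
(* Young's bound is [C * t * A * e + C * t * I / e], where [I] is the squared distance. [e] makes
   the first term at most [eps / 2]; then [d] is the size of [I] that does the same for the second.
   Each [+ 1] keeps a denominator positive. *)
pose e := (eps / 2 / (C * t * A + 1))%R.
have e0 : (0 < e)%R.
  by apply: divr_gt0; [exact: divr_gt0|rewrite ltr_wpDl// mulr_ge0].
pose d := (eps / 2 * e / (C * t + 1))%R.
have d0 : (0 < d)%R.
  apply: divr_gt0; last by rewrite ltr_wpDl.
  by apply: mulr_gt0 => //; exact: divr_gt0.
near=> n.
have nfin : \int[M]_z ((h_ n z - h z) ^+ 2)%:E \is a fin_num by near: n.
have sn : sqint (h_ n \- h)%R.
  split; last by rewrite -ge0_fin_numE.
  by apply: measurable_funB => //; have [] := sh_ n.
have Id : (fine (\int[M]_z ((h_ n z - h z) ^+ 2)%:E) <= d)%R.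
  have : (`|0 - fine (\int[M]_z ((h_ n z - h z) ^+ 2)%:E)| <= d)%R.
    by near: n; move/cvgrPdist_le : cv0; apply.
  by rewrite sub0r normrN => /(le_trans (ler_norm _)).
rewrite distrC -fineB ?qform_fin_num// -qformBr//.
rewrite -lee_fin -abse_EFin fineK ?qform_fin_num//.
have mn : measurable_fun setT (h_ n \- h)%R by have [] := sn.
apply: le_trans (le_abse_integral _ _ _) _ => //.
  by apply/measurable_EFinP; exact: mint.
apply: le_trans (le_qform_abs ma mn e0) _.
rewrite -(fineK nfin) -(fineK afin) -(fineK tfin) -/A -/t.
set I := fine _ in Id *.
rewrite -[leLHS]/((C * (t * (e * A + e^-1 * I)))%:E) lee_fin.
have -> : (C * (t * (e * A + e^-1 * I)) = C * t * A * e + C * t * I / e)%R by ring.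
rewrite (splitr eps) lerD//.
  rewrite /e mulrCA ler_piMr ?divr_ge0 ?(ltW eps0)//.
  by rewrite ler_pdivrMr ?mul1r ?lerDl// ltr_wpDl// mulr_ge0.
rewrite ler_pdivrMr//; apply: (le_trans (ler_wpM2l Ct0 Id)).
have -> : (C * t * d = eps / 2 * e * (C * t / (C * t + 1)))%R by rewrite /d mulrCA.
apply: ler_piMr; first by rewrite mulr_ge0// ltW// divr_gt0.
by rewrite ler_pdivrMr ?mul1r ?lerDl// ltr_wpDl.
Unshelve. all: by end_near. Qed.

End quadratic_form.

Section time_measure.
Context {R : realType}.
Local Notation Rt := (measurableTypeR R).
Local Notation leb1 := (@lebesgue_measure R).
Variable T : R.

(** The interval is put into the measure, so that product measures and Fubini's theorem are used on
    whole spaces. *)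
Definition tleb : set Rt -> \bar R :=
  mrestr leb1 (measurable_itv `]0, T[ : measurable (`]0, T[%classic : set Rt)).

HB.instance Definition _ := Measure.on tleb.

Lemma tlebE A : tleb A = leb1 (A `&` `]0, T[%classic).
Proof. by []. Qed.

Lemma tleb_setT_lty : (tleb setT < +oo)%E.
Proof. by rewrite tlebE setTI lebesgue_measure_itv/=; case: ifP => _; rewrite ltry. Qed.

Let tleb_sigma_finite : sigma_finite setT tleb.
Proof.
exists (fun=> setT); first by rewrite bigcup_const//; exists 0%N.
by move=> k; split => //; exact: tleb_setT_lty.
Qed.

HB.instance Definition _ := Measure_isSigmaFinite.Build _ _ _ tleb tleb_sigma_finite.

Lemma integrable_tleb_cst1 : tleb.-integrable setT (EFin \o (cst 1 : Rt -> R)).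
Proof.
apply/integrableP; split; first by apply/measurable_EFinP; exact: measurable_cst.
rewrite (_ : (fun t => _) = cst 1%E); last by apply/funext => t; rewrite /= normr1.
by rewrite (integral_cst _ measurableT) mul1e; exact: tleb_setT_lty.
Qed.

Lemma tleb_conull : tleb (~` `]0, T[%classic) = 0%E.
Proof. by rewrite tlebE setICl measure0. Qed.

Lemma ae_tleb : {ae tleb, forall t, 0 < t < T}.
Proof.
exists (~` `]0, T[%classic); split.
- exact: measurableC.
- exact: tleb_conull.
- by move=> t /= tT; rewrite in_itv.
Qed.

Lemma integral_tleb (f : Rt -> \bar R) :
  (\int[tleb]_t f t = \int[leb1]_(t in `]0%R, T[) f t)%E.
Proof.
transitivity (\int[tleb]_(t in `]0%R, T[) f t)%E.
  by rewrite [RHS]integral_mkcond; exact: (integral_conull _ tleb_conull).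
by apply: eq_measure_integral => A mA AT; rewrite -[in RHS](setIidl AT).
Qed.

Lemma tleb_set1 (t : R) : tleb [set t] = 0%E.
Proof.
apply/eqP; rewrite eq_le measure_ge0 andbT -(lebesgue_measure_set1 t).
by apply: le_measure; rewrite ?inE//; exact: measurableI.
Qed.

Lemma ae_tleb_leb (P : R -> Prop) :
  {ae tleb, forall t, P t} <-> {ae leb1, forall t, 0 < t < T -> P t}.
Proof.
split=> [[A [mA A0 sA]]|[A [mA A0 sA]]].
  exists (A `&` `]0, T[); split => //; first exact: measurableI.
  move=> t /= /not_implyP[tT nP]; split; last by rewrite /= in_itv.
  exact: sA.
exists (A `|` ~` `]0, T[%classic); split.
- by apply: measurableU => //; exact: measurableC.
- rewrite tlebE setIUl setICl setU0; apply/eqP; rewrite eq_le measure_ge0 andbT.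
  rewrite -[leRHS]A0; apply: le_measure; rewrite ?inE//; exact: measurableI.
- move=> t /= nP; have [tT|tT] := pselect (0 < t < T); [left|right].
    by apply: sA => /(_ tT).
  by rewrite /= in_itv.
Qed.

Variable al : Rt -> R.
Hypothesis ial : tleb.-integrable setT (EFin \o al).

Definition time_cumul (r : R) : R := \int[tleb]_t (al t * (t <= r)%R%:R).

(* The Lebesgue differentiation theorem. *)
Lemma time_cumul_eq0 : {ae tleb, forall r, time_cumul r = 0} ->
  {ae tleb, forall t, al t = 0}.
Proof.
move=> /ae_tleb_leb G0; apply/ae_tleb_leb.
pose f : R -> R := al \_ `]0, T[.
have intf : leb1.-integrable setT (EFin \o f).
  rewrite /f -restrict_EFin; apply/integrable_restrict => //; rewrite setTI.
  apply/integrableP; split.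
    by apply: measurable_funTS; exact: measurable_int ial.
  by move/integrableP : ial => [_]; rewrite integral_tleb.
pose F x := (\int[leb1]_(t in [set` `]-oo, x]%R]) (f t))%R.
have FG x : F x = time_cumul x.
  rewrite /F /time_cumul /Rintegral integral_tleb integral_mkcond [in RHS]integral_mkcond.
  congr fine; apply: eq_integral => t _; rewrite !patchE mem_setE in_itv/=.
  rewrite /f patchE; case: ifP => _; case: ifP => _ //=; rewrite ?mulr1 ?mulr0 ?mul0r//.
have intfy y : leb1.-integrable `]-oo, y] (EFin \o f) by exact: integrableS intf.
have locf : locally_integrable [set: R] f.
  by apply: open_integrable_locally => //; exact: openT.
have := FTC1Ny intfy locf.
rewrite -/F => F'f.
(* Zeros of [F] accumulate from the right at every point of (0, T), since no nonempty interval lies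
   in a null set. Where [F] is differentiable, continuity then gives [F x = 0], and the difference
   quotients along these zeros force the derivative [al x] to vanish. *)
have dense (x e : R) : 0 < x < T -> 0 < e ->
    exists y, [/\ x < y, y < x + e & F y = 0].
  move=> /andP[x0 xT] e0; apply: contrapT => H.
  have [A [mA A0 sA]] := G0.
  pose m := Num.min (x + e) T.
  have : (leb1 `]x, m[%classic <= leb1 A)%E.
    apply: le_measure; rewrite ?inE// => y /=; rewrite /m in_itv/= lt_min.
    move=> /and3P[xy yxe yT]; apply: sA => /= /(_ _).
    rewrite yT (lt_trans x0 xy) => /(_ isT) Gy.
    by apply: H; exists y; split => //; rewrite FG.
  rewrite A0 lebesgue_measure_itv/= lte_fin /m lt_min xT ltrDl e0/= -EFinB lee_fin.
  by rewrite subr_le0 ge_min leNgt ltrDl e0/= leNgt xT.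
have [A [mA A0 sA]] := F'f; exists A; split => // x /= nx.
apply: sA => -[dF dFx]; apply: nx => xT.
have fx : f x = al x by rewrite /f patchE mem_set//= in_itv.
have cF : {for x, continuous F} by exact/differentiable_continuous/derivable1_diffP.
have Fx : F x = 0.
  apply/eqP/negP => /negP Fx0.
  have /cvgrPdist_lt /(_ `|F x|) := cF; rewrite normr_gt0 => /(_ Fx0).
  move=> /nbhs_ballP[e /= e0 He].
  have [y [xy ye Fy]] := dense x e xT e0.
  have xy_e : ball x e y by rewrite -ball_normE/= ltr0_norm ?subr_lt0// opprB ltrBlDl.
  by have := He y xy_e; rewrite /= Fy subr0 ltxx.
apply/eqP/negP => /negP al0.
have al1 : 0 < `|al x| by rewrite normr_gt0.
have : (fun h => h^-1 *: (F (h + x) - F x)) @ 0^' --> al x.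
  rewrite -fx -dFx derive1E; have := dF.
  rewrite /derivable /derive; set q := (q in cvg (q @ _) -> _).
  set q' := (q' in _ -> q' @ _ --> _); have -> : q' = q; last by [].
  by apply: funext => h; rewrite /q /q' /= [h *: _]mulr1.
move=> /cvgrPdist_lt /(_ _ al1) [e /= e0 He].
have [y [xy ye Fy]] := dense x e xT e0.
have := He (y - x).
rewrite /= sub0r normrN subrK Fy Fx subrr scaler0 subr0 ltxx subr_eq0.
rewrite gtr0_norm ?subr_gt0// ltrBlDl => /(_ ye).
by rewrite gt_eqF// => /(_ isT).
Qed.

End time_measure.

Section tensor_product.
Context d1 d2 (X : measurableType d1) (Y : measurableType d2) (R : realType).
Variables (m1 : {sigma_finite_measure set X -> \bar R})
  (m2 : {sigma_finite_measure set Y -> \bar R}) (p : X -> R) (q : Y -> R).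
Hypotheses (ip : m1.-integrable setT (EFin \o p)) (iq : m2.-integrable setT (EFin \o q)).
Local Open Scope ereal_scope.

Let mp : measurable_fun setT p.
Proof. by apply/measurable_EFinP; exact: measurable_int ip. Qed.

Let mq : measurable_fun setT q.
Proof. by apply/measurable_EFinP; exact: measurable_int iq. Qed.

Lemma measurable_tensor : measurable_fun setT (fun z : X * Y => (p z.1 * q z.2)%:E).
Proof.
apply/measurable_EFinP; apply: measurable_funM.
  exact: (measurableT_comp mp measurable_fst).
exact: (measurableT_comp mq measurable_snd).
Qed.

Lemma integrable_tensor : (m1 \x m2).-integrable setT (fun z => (p z.1 * q z.2)%:E).
Proof.
apply/(integrable12ltyP _ _ measurable_tensor) => /=.
have Iq := integrableP _ _ _ iq; have Ip := integrableP _ _ _ ip.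
have E x : \int[m2]_y `|(p x * q y)%:E| = `|(p x)%:E| * \int[m2]_y `|(q y)%:E|.
  rewrite -ge0_integralZl//; last by apply: measurableT_comp; [|exact: Iq.1].
  by apply: eq_integral => y _; rewrite EFinM abseM.
under eq_integral do rewrite E.
rewrite ge0_integralZr//; last 2 first.
- by apply: measurableT_comp => //; exact: Ip.1.
- exact: integral_ge0.
apply: lte_mul_pinfty; first exact: integral_ge0.
  by rewrite ge0_fin_numE; [exact: Ip.2|exact: integral_ge0].
exact: Iq.2.
Qed.

Lemma integral_tensor : \int[m1 \x m2]_z (p z.1 * q z.2)%:E =
  \int[m1]_x (p x)%:E * \int[m2]_y (q y)%:E.
Proof.
rewrite -(integral12_prod_meas1 integrable_tensor) /fubini_F /=.
have fq : \int[m2]_y (q y)%:E \is a fin_num by exact: integrable_fin_num.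
rewrite -(fineK fq) -integralZr//; apply: eq_integral => x _.
rewrite (fineK fq) -integralZl//.
Qed.

End tensor_product.

(** * The square of a cumulated integral as a double integral *)

Section time_kernel.
Context {R : realType}.
Local Notation Rt := (measurableTypeR R).
Variable T : R.
Local Notation tau := (tleb T).

Lemma measurable_boolR : measurable_fun setT (fun b : bool => b%:R : R).
Proof. by move=> _ Y mY. Qed.

(* With this kernel, the double time integral of [al t * al s] is half the
   integral over r of the square of the cumulated integral of [al] up to r. *)
Definition tkernel (z : Rt * Rt) : R :=
  (z.1 <= z.2)%R%:R * (0 < z.2 < T)%R%:R * (T - z.2).

Lemma measurable_tkernel : measurable_fun setT tkernel.
Proof.
apply: measurable_funM; last by apply: measurable_funB => //; exact: measurable_snd.
apply: measurable_funM; apply: (measurableT_comp measurable_boolR).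
  by apply: measurable_fun_ler; [exact: measurable_fst|exact: measurable_snd].
by apply: measurable_and; apply: measurable_fun_ltr => //; exact: measurable_snd.
Qed.

(** The indicator of (0, T) in the second variable confines the weight to values between 0 and T on
    the whole plane. *)
Lemma tkernel_bound z : 0 < T -> `|tkernel z| <= T.
Proof.
move=> T0; rewrite /tkernel; case: (z.1 <= z.2); rewrite ?mul0r ?normr0 ?(ltW T0)//.
rewrite mul1r; case: (boolP (0 < z.2 < T)) => [/andP[z0 zT]|_]; rewrite ?mul0r ?normr0 ?(ltW T0)//.
by rewrite mul1r gtr0_norm; [rewrite lerBlDr lerDl ltW|rewrite subr_gt0].
Qed.

Variable al : Rt -> R.
Hypotheses (T_gt0 : 0 < T) (ial : tau.-integrable setT (EFin \o al)).
Local Open Scope ereal_scope.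

Let mal : measurable_fun setT al.
Proof. by apply/measurable_EFinP; exact: measurable_int ial. Qed.

Let mle (r : R) : measurable_fun setT (fun t : Rt => (t <= r)%R%:R : R).
Proof. by apply: (measurableT_comp measurable_boolR); exact: measurable_fun_ler. Qed.

Let ial_le r : tau.-integrable setT (fun t => (al t * (t <= r)%R%:R)%:E).
Proof.
apply: le_integrable ial => //.
  by apply/measurable_EFinP; exact: measurable_funM.
move=> t _ /=; rewrite lee_fin normrM ler_piMr//.
by case: (t <= r)%R; rewrite ?normr1 ?normr0.
Qed.

(** For [w = (r, (t, s))]. Integrating over [(t, s)] gives the square of the cumulated integral at
    [r]; integrating over [r] gives [al t * al s * (T - max t s)]. *)
Let Phi (w : Rt * (Rt * Rt)) : R :=
  (al w.2.1 * (w.2.1 <= w.1)%R%:R) * (al w.2.2 * (w.2.2 <= w.1)%R%:R).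

Let mPhi : measurable_fun setT Phi.
Proof.
have m21 : measurable_fun setT (fun w : Rt * (Rt * Rt) => w.2.1).
  exact: (measurableT_comp measurable_fst measurable_snd).
have m22 : measurable_fun setT (fun w : Rt * (Rt * Rt) => w.2.2).
  exact: (measurableT_comp measurable_snd measurable_snd).
apply: measurable_funM; apply: measurable_funM.
- exact: (measurableT_comp mal m21).
- by apply: (measurableT_comp measurable_boolR); apply: measurable_fun_ler.
- exact: (measurableT_comp mal m22).
- by apply: (measurableT_comp measurable_boolR); apply: measurable_fun_ler.
Qed.

Let i2 : (sfprod tau tau).-integrable setT (EFin \o (fun z : Rt * Rt => (al z.1 * al z.2)%R)).
Proof. exact: (integrable_tensor ial ial). Qed.

Let i1 := integrable_tleb_cst1 T.

Let iPhi : (tau \x sfprod tau tau).-integrable setT (EFin \o Phi).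
Proof.
apply: le_integrable (integrable_tensor i1 i2) => //; first exact/measurable_EFinP.
have b1 (b : bool) : (`|b%:R : R| <= 1)%R by case: b; rewrite ?normr1 ?normr0.
move=> w _ /=; rewrite lee_fin mul1r /Phi !normrM.
by apply: ler_pM; rewrite ?mulr_ge0// ler_piMr.
Qed.

Let fubini_r : \int[tau \x sfprod tau tau]_w (Phi w)%:E =
  \int[tau]_r (time_cumul T al r ^+ 2)%:E.
Proof.
rewrite -(integral12_prod_meas1 iPhi) /fubini_F; apply: eq_integral => r _ /=.
transitivity (\int[tau \x tau]_z ((al z.1 * (z.1 <= r)%R%:R) *
   (al z.2 * (z.2 <= r)%R%:R))%:E); first by [].
rewrite (integral_tensor (ial_le r) (ial_le r)).
by rewrite -(fineK (integrable_fin_num measurableT (ial_le r))) -EFinM -expr2.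
Qed.

Let swap_integral (f : Rt * Rt -> R) :
  (sfprod tau tau).-integrable setT (EFin \o f) ->
  \int[sfprod tau tau]_z (f z)%:E = \int[sfprod tau tau]_z (f (z.2, z.1))%:E.
Proof.
move=> If; have mf := measurable_int _ If.
have mswap : measurable_fun setT (fun z : Rt * Rt => (z.2, z.1)).
  by apply: measurable_fun_pair; [exact: measurable_snd|exact: measurable_fst].
have Ifs : (tau \x tau).-integrable setT (EFin \o (fun z : Rt * Rt => f (z.2, z.1))).
  apply/integrable21ltyP; first exact: (measurableT_comp mf mswap).
  by have /(integrable12ltyP _ _ mf) := If.
by rewrite /sfprod -(integral12_prod_meas1 If) -(integral21_prod_meas1 Ifs).
Qed.

Let overlap (t s : R) : (0 < t < T)%R -> (0 < s < T)%R ->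
  \int[tau]_r ((t <= r)%R%:R * (s <= r)%R%:R)%:E = (T - Num.max t s)%:E.
Proof.
move=> /andP[t0 tT] /andP[s0 sT].
rewrite integral_tleb.
transitivity (\int[@lebesgue_measure R]_(r in `[Num.max t s, T[) cst 1 r).
  rewrite integral_mkcond [RHS]integral_mkcond; apply: eq_integral => r _.
  rewrite !patchE !mem_setE !in_itv/= ge_max.
  have [tr|tr] := leP t r; have [sr|sr] := leP s r;
    rewrite /= ?mulr0 ?mul0r ?mulr1 ?if_same//.
  by rewrite (lt_le_trans t0 tr).
rewrite integral_cst//= mul1e lebesgue_measure_itv/= lte_fin gt_max tT sT/=.
by rewrite EFinB.
Qed.

Let ioverlap t s : tau.-integrable setT
  (fun r => ((t <= r)%R%:R * (s <= r)%R%:R)%:E).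
Proof.
have mge (u : R) : measurable_fun setT (fun r : Rt => (u <= r)%R%:R : R).
  by apply: (measurableT_comp measurable_boolR); exact: measurable_fun_ler.
apply: le_integrable i1 => //; first by apply/measurable_EFinP; exact: measurable_funM.
have b1 (b : bool) : (`|b%:R : R| <= 1)%R by case: b; rewrite ?normr1 ?normr0.
by move=> r _ /=; rewrite lee_fin normr1 normrM mulr_ile1.
Qed.

Let itkernel : (sfprod tau tau).-integrable setT
  (EFin \o (fun z : Rt * Rt => (al z.1 * al z.2 * tkernel z)%R)).
Proof.
apply: le_integrable (integrable_EFinZ measurableT T i2) => //.
  apply/measurable_EFinP; apply: measurable_funM; last exact: measurable_tkernel.
  apply: measurable_funM; first exact: (measurableT_comp mal measurable_fst).
  exact: (measurableT_comp mal measurable_snd).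
move=> z _ /=; rewrite lee_fin [X in (`|X| <= _)%R]mulrC [leLHS]normrM [leRHS]normrM.
apply: ler_wpM2r => //.
by rewrite (le_trans (tkernel_bound z T_gt0))// ler_norm.
Qed.

(** The diagonal is excluded because there [tkernel] and its transpose are both [T - t], and their
    sum would count the overlap twice. It is null since points have no mass. *)
Let ae_offdiag : {ae sfprod tau tau, forall z,
  [/\ (0 < z.1 < T)%R, (0 < z.2 < T)%R & z.1 != z.2]}.
Proof.
pose N : set (Rt * Rt) := [set z | ~~ [&& (0 < z.1 < T)%R, (0 < z.2 < T)%R & z.1 != z.2]].
have mN : measurable N.
  rewrite (_ : N = (fun z : Rt * Rt => ~~ [&& (0 < z.1 < T)%R, (0 < z.2 < T)%R & z.1 != z.2])
    @^-1` [set true]); last by apply/seteqP; split => z /=.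
  rewrite -[X in measurable X]setTI.
  have : measurable_fun setT (fun z : Rt * Rt => ~~ [&& (0 < z.1 < T)%R, (0 < z.2 < T)%R & z.1 != z.2]).
    apply: measurable_neg; apply: measurable_and.
      by apply: measurable_and; apply: measurable_fun_ltr => //; exact: measurable_fst.
    apply: measurable_and.
      by apply: measurable_and; apply: measurable_fun_ltr => //; exact: measurable_snd.
    by apply: measurable_neg; apply: measurable_fun_eqr; [exact: measurable_fst|exact: measurable_snd].
  by apply.
exists N; split => //; last first.
  by move=> z /= H; apply/negP => /and3P.
rewrite /sfprod /product_measure1 /=.
rewrite (ae_eq_integral (cst 0)) ?integral0//.
  exact: measurable_fun_xsection.
have := ae_tleb T; apply: filterS; first exact: (ae_filter_ringOfSetsType tau).
move=> x x0T _ /=.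
have mx := measurable_xsection x mN.
apply/eqP; rewrite eq_le measure_ge0 andbT.
have m1 : measurable (~` `]0%R, T[%classic : set Rt) by exact: measurableC.
apply: (@le_trans _ _ (tau ([set x] `|` ~` `]0%R, T[%classic))).
  apply: le_measure; rewrite ?inE//; first exact: measurableU.
  move=> y /xsectionP; rewrite /N /= x0T /= negb_and negbK => /orP[yT|/eqP ->]; [right|left] => //.
  by rewrite /= in_itv/=; exact/negP.
apply: le_trans (measureU2 _ _ _) _ => //.
by rewrite [X in _ + X]tleb_conull [X in X + _]tleb_set1 adde0.
Qed.

(** Fubini's theorem for [Phi] in both orders. Off the diagonal [T - max t s] is the sum of
    [tkernel] and its transpose, and by symmetry of [al t * al s] both contribute the same
    integral. *)
Lemma integral_time_cumul_sqr : \int[tau]_r (time_cumul T al r ^+ 2)%:E =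
  2%:E * \int[sfprod tau tau]_z (al z.1 * al z.2 * tkernel z)%:E.
Proof.
have mswap : measurable_fun setT (fun z : Rt * Rt => (z.2, z.1)).
  by apply: measurable_fun_pair; [exact: measurable_snd|exact: measurable_fst].
have mk : measurable_fun setT (fun z : Rt * Rt => (al z.1 * al z.2 * tkernel z)%R).
  by apply/measurable_EFinP; exact: measurable_int itkernel.
have iks : (sfprod tau tau).-integrable setT (EFin \o (fun z : Rt * Rt =>
    (al z.2 * al z.1 * tkernel (z.2, z.1))%R)).
  apply: le_integrable (integrable_EFinZ measurableT T i2) => //.
    by apply/measurable_EFinP; exact: (measurableT_comp mk mswap).
  move=> z _ /=; rewrite lee_fin [(al z.2 * _)%R]mulrC [X in (`|X| <= _)%R]mulrC [leLHS]normrM [leRHS]normrM.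
  apply: ler_wpM2r => //.
  by rewrite (le_trans (tkernel_bound _ T_gt0))// ler_norm.
rewrite -fubini_r -(integral21_prod_meas1 iPhi) /fubini_G /=.
transitivity (\int[sfprod tau tau]_z (al z.1 * al z.2 * tkernel z
   + al z.2 * al z.1 * tkernel (z.2, z.1))%:E).
  apply: ae_eq_integral => //.
  - exact: (measurable_fubini_G iPhi).
  - apply/measurable_EFinP; apply: measurable_funD => //.
    exact: (measurableT_comp mk mswap).
  move: ae_offdiag; apply: filterS.
    exact: (ae_filter_ringOfSetsType (sfprod tau tau)).
  move=> -[t s] /= [tT sT ts] _.
  transitivity (\int[tau]_r ((al t * al s)%:E * ((t <= r)%R%:R * (s <= r)%R%:R)%:E)).
    by apply: eq_integral => r _; rewrite /Phi/= -EFinM; congr _%:E; ring.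
  rewrite (integralZl measurableT (ioverlap t s)).
  rewrite overlap// -EFinM; congr _%:E.
  rewrite /tkernel /= tT sT /= !mulr1; move: ts; rewrite neq_lt => /orP[ts|ts].
    by rewrite (ltW ts) leNgt ts /=; rewrite max_r ?(ltW ts)//; ring.
  by rewrite (ltW ts) leNgt ts /=; rewrite max_l ?(ltW ts)//; ring.
transitivity (\int[sfprod tau tau]_z (al z.1 * al z.2 * tkernel z)%:E +
   \int[sfprod tau tau]_z (al z.2 * al z.1 * tkernel (z.2, z.1))%:E).
  by rewrite -integralD.
rewrite -(swap_integral itkernel).
by rewrite mule_natl mule2n.
Qed.

End time_kernel.

Section time_qform.
Context dW (W : measurableType dW) {R : realType}.
Local Notation Rt := (measurableTypeR R).
Variables (L : {sigma_finite_measure set W -> \bar R}) (T : R).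
Hypothesis T_gt0 : 0 < T.
Local Notation tau := (tleb T).
Local Open Scope ereal_scope.

Let i1 := integrable_tleb_cst1 T.

Let measurable_time_cumul (al : Rt -> R) : tau.-integrable setT (EFin \o al) ->
  measurable_fun setT (time_cumul T al).
Proof.
move=> ial.
have mal : measurable_fun setT al by apply/measurable_EFinP; exact: measurable_int ial.
have If : (tau \x tau).-integrable setT
    (fun z : Rt * Rt => (al z.2 * (z.2 <= z.1)%R%:R)%:E).
  apply: le_integrable (integrable_tensor i1 ial) => //.
    apply/measurable_EFinP; apply: measurable_funM.
      exact: (measurableT_comp mal measurable_snd).
    apply: (measurableT_comp measurable_boolR).
    by apply: measurable_fun_ler; [exact: measurable_snd|exact: measurable_fst].
  move=> z _ /=; rewrite lee_fin mul1r normrM ler_piMr//.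
  by case: (z.2 <= z.1)%R; rewrite ?normr1 ?normr0.
exact: (measurableT_comp (fine_measurable measurableT) (measurable_fubini_F If)).
Qed.

Variable a : W * Rt -> R.
Hypothesis sa : sqint L tau a.

Let ma : measurable_fun setT a := sa.1.

Let msq : measurable_fun setT (fun z => (a z ^+ 2)%:E).
Proof. by apply/measurable_EFinP; exact: measurable_funX. Qed.

Let isq : (L \x tau).-integrable setT (fun z => (a z ^+ 2)%:E).
Proof.
apply/integrableP; split => //; have := sa.2; congr (_ < _).
by apply: eq_integral => z _; rewrite gee0_abs// lee_fin sqr_ge0.
Qed.

(** Almost every slice is square integrable, and [tau] is finite: the absolute value of [x] is at
    most [1 + x ^+ 2]. *)
Let ae_slice : {ae L, forall w, tau.-integrable setT (EFin \o (fun t => a (w, t)))}.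
Proof.
have := ae_integrable1 isq; apply: filterS.
move=> w iw; have i2 := integrableD measurableT i1 iw.
apply: le_integrable i2 => //; first by apply/measurable_EFinP; exact: measurableT_comp.
move=> t _ /=; rewrite lee_fin; set x := a (w, t).
rewrite (ger0_norm (addr_ge0 ler01 (sqr_ge0 x))).
have := sqr_ge0 (`|x| - 1)%R; rewrite sqrrB1 real_normK ?num_real//.
have := normr_ge0 x; nra.
Qed.

Let b w : \bar R := \int[sfprod tau tau]_z (a (w, z.1) * a (w, z.2) * tkernel T z)%:E.

Let iq := qform_integrable (tleb_setT_lty T) (measurable_tkernel T)
  (fun z => tkernel_bound z T_gt0) sa sa.

Let qform_b : qform L tau (tkernel T) a a = \int[L]_w b w.
Proof. by rewrite /qform -(integral12_prod_meas1 iq). Qed.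

Let ae_b : {ae L, forall w, 2%:E * b w =
  \int[tau]_r (time_cumul T (fun t => a (w, t)) r ^+ 2)%:E}.
Proof.
move: ae_slice; apply: filterS.
by move=> w iw; rewrite (integral_time_cumul_sqr T_gt0 iw).
Qed.

Let ib : L.-integrable setT b.
Proof. exact: (integrable_fubini_F iq). Qed.

Let ae_b_ge0 : {ae L, forall w, 0 <= b w}.
Proof.
move: ae_b; apply: filterS.
move=> w bw.
have : 0 <= 2%:E * b w.
  by rewrite bw; apply: integral_ge0 => r _; rewrite lee_fin sqr_ge0.
by rewrite pmule_rge0.
Qed.

Let integral_b_abs : \int[L]_w b w = \int[L]_w `|b w|.
Proof.
apply: ae_eq_integral => //; first exact: measurable_int ib.
  by apply: measurableT_comp => //; exact: measurable_int ib.
move: ae_b_ge0; apply: filterS.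
by move=> w bw _ /=; rewrite gee0_abs.
Qed.

Lemma qform_ge0 : 0 <= qform L tau (tkernel T) a a.
Proof. by rewrite qform_b integral_b_abs; apply: integral_ge0. Qed.

Lemma qform_eq0 : qform L tau (tkernel T) a a = 0 ->
  {ae L \x tau, forall z, a z = 0%R}.
Proof.
rewrite qform_b integral_b_abs => b0.
have /(ae_eq_integral_abs L measurableT (measurable_int _ ib)) bae := b0.
have slice0 : {ae L, forall w, {ae tau, forall t, a (w, t) = 0%R}}.
  move: bae ae_slice; apply: filterS2.
  move=> w /(_ I) /= bw iw; apply: time_cumul_eq0 => //.
  have := integral_time_cumul_sqr T_gt0 iw; rewrite -/(b w) bw mule0 => c0.
  have mc := measurable_time_cumul iw.
  have : \int[tau]_r `|(time_cumul T (fun t => a (w, t)) r ^+ 2)%:E| = 0.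
    by rewrite -[RHS]c0; apply: eq_integral => r _; rewrite gee0_abs// lee_fin sqr_ge0.
  move=> /ae_eq_integral_abs => /(_ measurableT).
  have mc2 : measurable_fun setT (fun r => (time_cumul T (fun t => a (w, t)) r ^+ 2)%:E).
    by apply/measurable_EFinP; exact: measurable_funX.
  move=> /(_ mc2); apply: filterS.
  by move=> r /(_ I) [] /eqP; rewrite expf_eq0/= => /eqP.
(* Vanishing on almost every slice is brought back to the product by Tonelli's theorem for the
   square. *)
have : \int[L \x tau]_z `|(a z ^+ 2)%:E| = 0.
  rewrite fubini_tonelli1//; last exact: measurableT_comp.
  rewrite (ae_eq_integral (cst 0)) ?integral0//.
    by apply: measurable_fun_fubini_tonelli_F => //; exact: measurableT_comp.
  move: slice0; apply: filterS.
  move=> w aw _; rewrite /fubini_F /=.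
  rewrite (ae_eq_integral (cst 0)) ?integral0//.
    apply/measurable_EFinP; apply: measurableT_comp => //; apply: measurable_funX.
    exact: (measurable_fun_pair2 w ma).
  move: aw; apply: filterS.
  by move=> t -> _; rewrite expr0n /= normr0.
move=> /ae_eq_integral_abs => /(_ measurableT msq).
apply: filterS.
by move=> z /(_ I) [] /eqP; rewrite expf_eq0/= => /eqP.
Qed.

End time_qform.

(** * Energies as integrals with respect to Lambda *)

Section integral_helpers.
Local Open Scope ereal_scope.

(* No integrability is required: both sides may be infinite. *)
Lemma integral_pushforward_measurable d1 d2 (X : measurableType d1)
    (Y : measurableType d2) (R : realType) (phi : X -> Y)
    (mphi : measurable_fun setT phi) (mu : {measure set X -> \bar R})
    (D : set Y) (f : Y -> \bar R) : measurable D -> measurable_fun D f ->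
  \int[pushforward mu phi]_(y in D) f y = \int[mu]_(x in phi @^-1` D) f (phi x).
Proof.
move=> mD mf; rewrite [LHS]integralE [RHS]integralE.
rewrite (ge0_integral_pushforward mphi)//; last exact: measurable_funepos.
rewrite (ge0_integral_pushforward mphi)//; last exact: measurable_funeneg.
by congr (_ - _); apply: eq_integral => x _; rewrite /= ?funeposE ?funenegE.
Qed.

Lemma measurable_integral_swap d1 d2 (X : measurableType d1)
    (Y : measurableType d2) (R : realType)
    (m : {sigma_finite_measure set X -> \bar R}) (f : X * Y -> \bar R) :
  measurable_fun setT f -> measurable_fun setT (fun y => \int[m]_x f (x, y)).
Proof.
move=> mf.
rewrite (_ : (fun y => _) = (fun y => \int[m]_x f^\+ (x, y)) \-
    (fun y => \int[m]_x f^\- (x, y))).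
  apply: emeasurable_funB.
    by apply: (@measurable_fun_fubini_tonelli_G _ _ _ _ _ m f^\+) => //; exact: measurable_funepos.
  by apply: (@measurable_fun_fubini_tonelli_G _ _ _ _ _ m f^\-) => //; exact: measurable_funeneg.
apply/funext => y; rewrite [LHS]integralE.
under eq_integral do rewrite funepos_comp/=.
by under [X in _ - X = _]eq_integral do rewrite funeneg_comp/=.
Qed.

End integral_helpers.

Section energy_integrals.
Context {R : realType} {N : nat}.
Local Notation Rn := ('rV[R]_N).
Local Notation Rt := (measurableTypeR R).
Local Notation leb := (rV_lebesgue R N).
Variables (lamt : R.-ker Rn ~> Rn) (G : set Rn) (mG : measurable G).
Hypotheses (G0 : leb (~` G) = 0%E)
  (lamt_fin : forall x r, G x -> 0 < r -> (lamt x [set y | (r < `|y - x|)%R] < +oo)%E)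
  (lamt_diag : punctured_kernel lamt).
Local Open Scope ereal_scope.

Definition good_kernel : Rn -> {measure set Rn -> \bar R} :=
  krestr lamt (@measurable_id _ Rn setT) mG.

Let K := good_kernel.

Lemma measurable_good_kernel C : measurable C ->
  measurable_fun [set: Rn] (fun x => K x (xsection C x)).
Proof. exact: measurable_krestr_xsection. Qed.

(** The substitution [y = x + z] removes the translation. The excluded point [y = x] may be put back
    because the integrand vanishes there, and the points outside [G] are null. *)
Lemma energyE (f g : Rn -> R) : measurable_fun setT f -> measurable_fun setT g ->
  energy (translated lamt) f g =
  2^-1%:E * \int[leb]_x \int[K x]_y ((f y - f x) * (g y - g x))%:E.
Proof.
move=> mf mg; rewrite /energy; congr (_ * _).
have inner x : \int[translated lamt x]_(z in [set z | (0 < enorm z)%R])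
     ((f (x + z) - f x) * (g (x + z) - g x))%:E =
   \int[lamt x]_y ((f y - f x) * (g y - g x))%:E.
  have mD : measurable [set z : Rn | (0 < enorm z)%R].
    rewrite (_ : [set _ | _] = setT `&` @enorm R N @^-1` `]0%R, +oo[); last first.
      by rewrite setTI; apply/seteqP; split => z /=; rewrite in_itv/= andbT.
    by apply: measurable_enorm.
  rewrite (integral_pushforward_measurable (measurable_rV_sub x))//; last first.
    apply: measurable_funTS; apply/measurable_EFinP.
    by apply: measurable_funM; apply: measurable_funB => //;
      apply: measurableT_comp => //; exact: measurable_rV_add.
  rewrite integral_mkcond; apply: eq_integral => y _; rewrite patchE.
  have -> : (x + (y - x) = y)%R by rewrite addrC subrK.
  case: ifPn => // yD; suff -> : y = x by rewrite subrr mul0r.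
  apply/eqP; apply: contraNT yD => yx; apply/mem_set.
  by rewrite /preimage/= enorm_gt0 subr_eq0.
under eq_integral do rewrite inner.
rewrite (integral_conull mG G0) [RHS](integral_conull mG G0).
apply: eq_integral => x _; rewrite !patchE; case: ifPn => // xG.
by rewrite /K /good_kernel /krestr xG.
Qed.

Definition incr (F : Rn * Rt -> R) (z : (Rn * Rn) * Rt) : R :=
  F (z.1.2, z.2) - F (z.1.1, z.2).

Definition energy_at (F H : Rn * Rt -> R) (t : Rt) : \bar R :=
  energy (translated lamt) (fun x => F (x, t)) (fun x => H (x, t)).

Section measurability.
Variables (F H : Rn * Rt -> R).
Hypotheses (mF : measurable_fun setT F) (mH : measurable_fun setT H).

Lemma measurable_incr (F' : Rn * Rt -> R) : measurable_fun setT F' ->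
  measurable_fun setT (incr F').
Proof.
move=> mF'; apply: measurable_funB; apply: (measurableT_comp mF');
  apply: measurable_fun_pair; try exact: measurable_snd.
  exact: (measurableT_comp measurable_snd measurable_fst).
exact: (measurableT_comp measurable_fst measurable_fst).
Qed.

Lemma energy_atE t : energy_at F H t =
  2^-1%:E * \int[leb]_x \int[K x]_y (incr F ((x, y), t) * incr H ((x, y), t))%:E.
Proof. by rewrite /energy_at energyE//; exact: measurable_fun_pair1. Qed.

Lemma measurable_energy_at : measurable_fun setT (energy_at F H).
Proof.
rewrite (_ : energy_at F H = fun t => 2^-1%:E * \int[leb]_x
    \int[K x]_y (incr F ((x, y), t) * incr H ((x, y), t))%:E); last first.
  by apply/funext => t; rewrite energy_atE.
apply: measurable_funeM.
apply: (@measurable_integral_swap _ _ _ _ _ _ (fun z : Rn * Rt =>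
  \int[K z.1]_y (incr F ((z.1, y), z.2) * incr H ((z.1, y), z.2))%:E)).
have mperm : measurable_fun setT (fun w : (Rn * Rt) * Rn => ((w.1.1, w.2), w.1.2)).
  apply: measurable_fun_pair.
    apply: measurable_fun_pair; last exact: measurable_snd.
    exact: (measurableT_comp measurable_fst measurable_fst).
  exact: (measurableT_comp measurable_snd measurable_fst).
(* Here the parameter of the kernel is a point of space-time, of which only the space component
   selects the measure. *)
apply: (@measurable_integral_sections _ _ (Rn * Rt)%type Rn R
  (krestr lamt measurable_fst mG) _
  (fun w => (incr F ((w.1.1, w.2), w.1.2) * incr H ((w.1.1, w.2), w.1.2))%:E)).
  exact: measurable_krestr_xsection.
apply/measurable_EFinP; apply: measurable_funM.
  exact: (measurableT_comp (measurable_incr mF) mperm).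
exact: (measurableT_comp (measurable_incr mH) mperm).
Qed.

End measurability.

End energy_integrals.

Lemma integrable_fubini_G d1 d2 (T1 : measurableType d1)
    (T2 : measurableType d2) (R : realType)
    (m1 : {sigma_finite_measure set T1 -> \bar R})
    (m2 : {sigma_finite_measure set T2 -> \bar R}) (f : T1 * T2 -> \bar R) :
  ((m1 \x m2)%E).-integrable setT f -> m2.-integrable setT (fubini_G m1 f).
Proof.
move=> imf; have mf := measurable_int _ imf.
apply/integrableP; split; first exact: measurable_fubini_G imf.
apply: le_lt_trans ((integrable21ltyP _ _ mf).1 imf).
have maf : measurable_fun setT (abse \o f) by exact: measurableT_comp.
apply: ge0_le_integral => //.
- by apply: measurableT_comp => //; exact: measurable_fubini_G imf.
- by apply: (measurable_fun_fubini_tonelli_G _ maf) => z; exact: abse_ge0.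
- by move=> y _; apply: le_abse_integral => //; exact: measurable_fun_pair1.
Qed.

Section energy_of_measure.
Context {R : realType} {N : nat}.
Local Notation Rn := ('rV[R]_N).
Local Notation Rt := (measurableTypeR R).
Local Notation leb := (rV_lebesgue R N).
Variables (lamt : R.-ker Rn ~> Rn) (G : set Rn) (mG : measurable G).
Hypotheses (G0 : leb (~` G) = 0%E)
  (lamt_fin : forall x r, G x -> 0 < r -> (lamt x [set y | (r < `|y - x|)%R] < +oo)%E)
  (lamt_diag : punctured_kernel lamt).
Local Notation K := (good_kernel lamt mG).
Variable L : {sigma_finite_measure set (Rn * Rn)%type -> \bar R}.
Hypothesis LK : forall C, measurable C -> L C = (\int[leb]_x K x (xsection C x))%E.
Variable T : R.
Local Notation tau := (tleb T).
Local Open Scope ereal_scope.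

Let mK := measurable_good_kernel mG lamt_fin lamt_diag.

Let incr_sqr_ge0 (F : Rn * Rt -> R) z : 0 <= (incr F z ^+ 2)%:E.
Proof. by rewrite lee_fin sqr_ge0. Qed.

Let measurable_incr_sqr (F : Rn * Rt -> R) : measurable_fun setT F ->
  measurable_fun setT (fun z => (incr F z ^+ 2)%:E).
Proof.
by move=> mF; apply/measurable_EFinP; apply: measurable_funX; exact: measurable_incr.
Qed.

Lemma integral_energy_sqr (F : Rn * Rt -> R) : measurable_fun setT F ->
  \int[tau]_t energy_at lamt F F t =
  2^-1%:E * \int[L \x tau]_z (incr F z ^+ 2)%:E.
Proof.
move=> mF; have mi := measurable_incr_sqr mF.
rewrite fubini_tonelli2// -ge0_integralZl//; last 2 first.
- exact: (measurable_fun_fubini_tonelli_G _ mi (incr_sqr_ge0 F)).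
- by move=> t _; apply: integral_ge0.
apply: eq_integral => t _; rewrite (energy_atE _ mG G0)//; congr (_ * _).
rewrite /fubini_G (ge0_integral_disintegration mK LK _ (measurable_fun_pair1 t mi))//.
Qed.

(** The integrand has no sign, so integrability is what allows the exchange; the disintegration of
    the slice then holds at almost every time. *)
Lemma integral_energy (F H : Rn * Rt -> R) :
  measurable_fun setT F -> measurable_fun setT H ->
  (L \x tau).-integrable setT (fun z => (incr F z * incr H z)%:E) ->
  \int[tau]_t energy_at lamt F H t =
  2^-1%:E * \int[L \x tau]_z (incr F z * incr H z)%:E.
Proof.
move=> mF mH i.
rewrite -(integral21_prod_meas1 i) -integralZl//; last exact: integrable_fubini_G.
apply: ae_eq_integral => //.
- exact: (measurable_energy_at mG G0 lamt_fin lamt_diag mF mH).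
- by apply: measurable_funeM; exact: measurable_fubini_G i.
have := ae_integrable2 i; apply: filterS => t it _.
rewrite (energy_atE _ mG G0)//; congr (_ * _).
by rewrite /fubini_G (integral_disintegration mK LK it).
Qed.

(** Products with [incr H] may fail to be integrable, so Tonelli's theorem is applied to the
    nonnegative [d] instead. It carries the null set through the three nested integrals: almost
    every [t], then almost every [x], then almost every [y] for [K x]. *)
Lemma energy_at_ae_eq (F F' H : Rn * Rt -> R) :
  measurable_fun setT F -> measurable_fun setT F' -> measurable_fun setT H ->
  {ae L \x tau, forall z, incr F z = incr F' z} ->
  {ae tau, forall t, energy_at lamt F H t = energy_at lamt F' H t}.
Proof.
move=> mF mF' mH FF'.
pose d (z : (Rn * Rn) * Rt) := `|(incr F z - incr F' z)%:E|.
have md : measurable_fun setT d.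
  apply: measurableT_comp => //; apply/measurable_EFinP.
  by apply: measurable_funB; exact: measurable_incr.
have d0 z : 0 <= d z by exact: abse_ge0.
have : \int[L \x tau]_z `|d z| = 0.
  rewrite (ae_eq_integral (cst 0)) ?integral0//; first exact: measurableT_comp.
  by move: FF'; apply: filterS => z e _; rewrite /d e subrr /= !normr0.
under eq_integral do rewrite gee0_abs//.
rewrite fubini_tonelli2// => Id.
have : \int[tau]_t `|fubini_G L d t| = 0.
  by rewrite -[RHS]Id; apply: eq_integral => t _; rewrite gee0_abs// integral_ge0.
move=> /ae_eq_integral_abs => /(_ measurableT (measurable_fun_fubini_tonelli_G _ md d0)).
apply: filterS => t /(_ I); rewrite /fubini_G.
have mdt : measurable_fun setT (fun w : Rn * Rn => d (w, t)) by exact: (measurable_fun_pair1 t md).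
rewrite (ge0_integral_disintegration mK LK _ mdt)// => Idt.
rewrite !(energy_atE _ mG G0)//; congr (_ * _).
have mI (F1 : Rn * Rt -> R) : measurable_fun setT F1 -> measurable_fun setT
    (fun x => \int[K x]_y (incr F1 ((x, y), t) * incr H ((x, y), t))%:E).
  move=> mF1.
  apply: (measurable_integral_sections mK
    (f := fun w => (incr F1 (w, t) * incr H (w, t))%:E)).
  apply/measurable_EFinP; apply: measurable_funM.
    exact: (measurable_fun_pair1 t (measurable_incr mF1)).
  exact: (measurable_fun_pair1 t (measurable_incr mH)).
apply: ae_eq_integral => //; [exact: mI|exact: mI|].
have mJ : measurable_fun setT (fun x => \int[K x]_y d ((x, y), t)).
  exact: (ge0_measurable_integral_sections mK _ mdt).
have : \int[leb]_x `|\int[K x]_y d ((x, y), t)| = 0.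
  by rewrite -[RHS]Idt; apply: eq_integral => x _; rewrite gee0_abs// integral_ge0.
move=> /ae_eq_integral_abs => /(_ measurableT mJ).
apply: filterS => x /(_ I) Jx _.
have my (F1 : Rn * Rt -> R) : measurable_fun setT F1 ->
    measurable_fun setT (fun y => incr F1 ((x, y), t)).
  move=> mF1; apply: measurable_funB; last exact: (measurable_cst (F1 (x, t))).
  exact: (measurable_fun_pair1 t mF1).
have mdx : measurable_fun setT (fun y => d ((x, y), t)).
  exact: (measurable_fun_pair2 x mdt).
apply: ae_eq_integral => //.
- by apply/measurable_EFinP; apply: measurable_funM; exact: my.
- by apply/measurable_EFinP; apply: measurable_funM; exact: my.
have : \int[K x]_y `|d ((x, y), t)| = 0.
  by rewrite -[RHS]Jx; apply: eq_integral => y _; rewrite gee0_abs.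
move=> /ae_eq_integral_abs => /(_ measurableT mdx).
apply: filterS => y /(_ I) /eqP; rewrite /d abse_eq0 => /eqP[/eqP].
by rewrite subr_eq0 => /eqP -> _.
Qed.

End energy_of_measure.

Section sigma_finite_packaging.
Context d (X : measurableType d) (R : realType).
Variables (mu : {measure set X -> \bar R}) (mu_sf : sigma_finite setT mu).

(** The proof is an argument of the copy so that the sigma-finite structure can be attached to
    it. *)
Definition sf_measure of sigma_finite setT mu : set X -> \bar R := mu.

HB.instance Definition _ := Measure.on (sf_measure mu_sf).

HB.instance Definition _ :=
  Measure_isSigmaFinite.Build _ _ _ (sf_measure mu_sf) mu_sf.

End sigma_finite_packaging.

(** * Sigma-finiteness and disintegration of the Radon measure *)

Section radon_kernel.
Context {R : realType} {N : nat}.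
Local Notation Rn := ('rV[R]_N).
Local Notation leb := (rV_lebesgue R N).
Local Open Scope ereal_scope.

Lemma measurable_diagonal : measurable (diagonal : set (Rn * Rn)).
Proof.
rewrite -[X in measurable X]setCK; apply: measurableC.
rewrite (_ : ~` _ = \bigcup_j (off_diag_left j `*` off_diag_right j)).
  apply: bigcupT_measurable => j; apply: measurableX.
    exact: measurable_off_diag_left.
  exact: measurable_off_diag_right.
apply/seteqP; split => [[x y] /= xy|[x y] [j _ [/= xj yj]]].
  have /off_diag_cover[j jP] : x != y by apply/eqP.
  by exists j.
have [r r0 /(_ _ _ xj yj)] := @off_diag_dist R N j.
by rewrite /diagonal/= => + xy; rewrite xy subrr normr0 ltNge ltW.
Qed.

Let cbox (n : nat) : set Rn := [set v | forall i, [set` `[(- n%:R)%R, n%:R%R]%R] (v ord0 i)].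

Let compact_cbox n : compact (cbox n).
Proof.
by apply: (@rV_compact R N (fun=> [set` `[(- n%:R)%R, n%:R%R]%R])) => i; exact: segment_compact.
Qed.

Let off_diag_box (n : nat) : set (Rn * Rn) :=
  (cbox n `*` cbox n) `&` [set p | (n.+1%:R^-1 <= `|p.2 - p.1|)%R].

Let continuous_dist : continuous (fun p : Rn * Rn => `|p.2 - p.1|%R).
Proof.
move=> p; apply: (@continuous_comp _ _ _ (fun p : Rn * Rn => p.2 - p.1)%R Num.norm).
  by apply: (@cvgB _ _ _ (nbhs p) _ snd fst); [exact: cvg_snd|exact: cvg_fst].
exact: norm_continuous.
Qed.

Let compact_off_diag_box n : compact (off_diag_box n).
Proof.
apply: (@subclosed_compact _ _ (cbox n `*` cbox n)); last by move=> p [].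
  apply: closedI.
    apply: compact_closed => //.
    by apply: compact_setX; exact: compact_cbox.
  rewrite (_ : [set p | _] = (fun p : Rn * Rn => `|p.2 - p.1|%R) @^-1` `[(n.+1%:R^-1)%R, +oo[%classic); last first.
    by apply/seteqP; split => p /=; rewrite in_itv/= andbT.
  apply: closed_comp; last exact: interval_closed.
  by move=> p _; exact: continuous_dist.
by apply: compact_setX; exact: compact_cbox.
Qed.

Let measurable_off_diag_box n : measurable (off_diag_box n).
Proof.
have mc : measurable (cbox n) by apply: rV_compact_measurable.
apply: measurableI; first exact: measurableX.
have msub : measurable_fun setT (fun p : Rn * Rn => (p.2 - p.1)%R).
  apply: rV_measurableP => i; under eq_fun do rewrite !mxE.
  apply: measurable_funB; apply: coord1_measurable.
    exact: measurable_snd.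
  exact: measurable_fst.
rewrite -[X in measurable X]setTI; apply: (msub _ [set v | (n.+1%:R^-1 <= `|v|)%R]) => //.
rewrite -[X in measurable X]setCK; apply: measurableC; apply: rV_open_measurable.
apply: closed_openC.
rewrite (_ : [set _ | _] = (@Num.norm R Rn) @^-1` `[(n.+1%:R^-1)%R, +oo[%classic); last first.
  by apply/seteqP; split => p /=; rewrite in_itv/= andbT.
apply: closed_comp; last exact: interval_closed.
by move=> p _; exact: norm_continuous.
Qed.

(** The complement of the diagonal is exhausted by the compact sets of pairs in a cube at distance
    at least [n.+1%:R^-1] from each other; the diagonal is null. *)
Lemma radon_sigma_finite (Lambda : {measure set (Rn * Rn)%type -> \bar R}) :
  radon_off_diagonal Lambda -> sigma_finite setT Lambda.
Proof.
move=> [D0 Kfin]; exists (fun n => diagonal `|` off_diag_box n).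
  apply/seteqP; split => // -[x y] _.
  have [->|xy] := eqVneq x y; first by exists 0%N => //; left.
  have d0 : (0 < `|y - x|)%R by rewrite normr_gt0 subr_eq0 eq_sym.
  have nearc (v : Rn) : \forall n \near \oo, cbox n v.
    near=> n; move=> i; rewrite /= in_itv/= -ler_norml; move: i; near: n.
    apply: filter_forall => i; exact: nbhs_infty_ger.
  have [n _ /(_ n (leqnn n))[nx ny nd]] :
      \forall n \near \oo, [/\ cbox n x, cbox n y & (n.+1%:R^-1 <= `|y - x|)%R].
    near=> n; split; [by near: n; exact: nearc|by near: n; exact: nearc|].
    rewrite invf_ple ?posrE// -natr1 ler_wpDr//; near: n; exact: nbhs_infty_ger.
  by exists n => //; right.
move=> n; split.
  apply: measurableU; [exact: measurable_diagonal|exact: measurable_off_diag_box].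
apply: (@le_lt_trans _ _ (Lambda diagonal + Lambda (off_diag_box n))).
  exact: measureU2 measurable_diagonal (measurable_off_diag_box n).
rewrite D0 add0e; apply: Kfin; first exact: compact_off_diag_box.
move=> [x y] [_ /= nxy] xy; move: nxy; rewrite (xy : x = y).
by rewrite subrr normr0 leNgt invr_gt0 ltr0Sn.
Unshelve. all: by end_near. Qed.

(** The formula extends from sets off the diagonal to all Borel sets because neither side sees the
    diagonal, and from [lamt] to its restriction because the complement of [G] is null. *)
Lemma disintegrates_good_kernel (Lambda : {measure set (Rn * Rn)%type -> \bar R})
    (lamt : R.-ker Rn ~> Rn) (G : set Rn) (mG : measurable G) :
  radon_off_diagonal Lambda -> disintegrates Lambda lamt ->
  punctured_kernel lamt -> leb (~` G) = 0 ->
  forall C, measurable C ->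
    Lambda C = \int[leb]_x good_kernel lamt mG x (xsection C x).
Proof.
move=> [D0 _] dis punct G0 C mC.
have mCD : measurable (C `\` diagonal) by apply: measurableD => //; exact: measurable_diagonal.
have CD : Lambda C = Lambda (C `\` diagonal).
  rewrite (measureDI _ mC measurable_diagonal) [X in _ + X](_ : _ = 0) ?adde0//.
  apply/eqP; rewrite eq_le measure_ge0 andbT.
  apply: (@le_trans _ _ (Lambda diagonal)); last by rewrite D0.
  by apply: le_measure; rewrite ?inE//; [apply: measurableI => //|]; exact: measurable_diagonal.
apply: (etrans CD); apply: (etrans (dis _ mCD _)); first by move=> p [].
rewrite (integral_conull mG G0).
apply: eq_integral => x _; rewrite patchE /good_kernel /krestr; case: ifPn => // xG.
have m1 : measurable [set x] by apply: rV_compact_measurable; exact: compact_set1.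
have mCx : measurable (xsection C x) by exact: measurable_xsection.
rewrite [RHS](measureDI _ mCx m1) [X in _ = _ + X](_ : _ = 0) ?adde0; last first.
  apply/eqP; rewrite eq_le measure_ge0 andbT -(punct x).
  by apply: le_measure; rewrite ?inE//; exact: measurableI.
congr (lamt x _); apply/seteqP; split => y.
  by move=> /xsectionP[Cxy nxy]; split; [exact/xsectionP|move=> /= yx; apply: nxy].
by move=> [/xsectionP Cxy nxy]; apply/xsectionP; split => // xy; apply: nxy.
Qed.

End radon_kernel.

(** * The weak equation *)

Section general_integration.
Local Open Scope ereal_scope.
Context d (X : measurableType d) (R : realType).
Variable mu : {measure set X -> \bar R}.
Implicit Types f g : X -> \bar R.

(* Since [+oo - +oo = -oo], a finite value of the integral forces the positive
   and negative parts to be both integrable. *)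
Lemma fin_num_integrable f : measurable_fun setT f ->
  \int[mu]_x f x \is a fin_num -> mu.-integrable setT f.
Proof.
move=> mf; rewrite integralE.
have p0 : 0 <= \int[mu]_x f^\+ x by exact: integral_ge0.
have n0 : 0 <= \int[mu]_x f^\- x by exact: integral_ge0.
move=> fin; apply/integrableP; split => //.
under eq_integral do rewrite -/((abse \o f) _) fune_abse.
rewrite ge0_integralD//; [|exact: measurable_funepos|exact: measurable_funeneg].
move: fin p0 n0.
by case: (\int[mu]_x f^\+ x) => [p| |]; case: (\int[mu]_x f^\- x) => [n| |]//= *; rewrite ltry.
Qed.

Lemma ae_eq_integrable f g : measurable_fun setT g ->
  {ae mu, forall x, f x = g x} -> mu.-integrable setT f -> mu.-integrable setT g.
Proof.
move=> mg fg /integrableP[mf fi]; apply/integrableP; split => //.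
apply: le_lt_trans fi; rewrite le_eqVlt; apply/orP; left; apply/eqP.
apply: ae_eq_integral => //; [exact: measurableT_comp..|].
by apply: filterS fg => x -> _.
Qed.

(** In the weak equation [f] will be the term with the time derivative and [g] the energy, about
    which nothing is known beforehand. *)
Lemma integrable_sub_ae f g : measurable_fun setT g -> mu.-integrable setT f ->
  \int[mu]_x (f x - g x) \is a fin_num ->
  mu.-integrable setT g /\
  \int[mu]_x g x = \int[mu]_x f x - \int[mu]_x (f x - g x).
Proof.
move=> mg fi fin.
have mf := measurable_int _ fi.
have di : mu.-integrable setT (fun x => f x - g x).
  by apply: fin_num_integrable => //; exact: emeasurable_funB.
(* True wherever [f] is finite, even if [g] is infinite there. *)
have ge : {ae mu, forall x, f x - (f x - g x) = g x}.
  have := integrable_ae measurableT fi; apply: filterS => x /(_ I).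
  by case: (f x) => //= r _; case: (g x) => //= s; rewrite -!EFinB subKr.
split.
  by apply: (ae_eq_integrable mg ge); exact: integrableB.
rewrite -integralB//; apply: ae_eq_integral => //.
  by apply: emeasurable_funB => //; exact: emeasurable_funB.
by apply: filterS ge => x -> _.
Qed.

Lemma integrable_mul_bounded (h g : X -> R) (C : R) : mu.-integrable setT (EFin \o h) ->
  measurable_fun setT g -> (forall x, `|g x| <= C)%R ->
  mu.-integrable setT (fun x => (h x * g x)%:E).
Proof.
move=> hi mg gC.
have mh : measurable_fun setT h by apply/measurable_EFinP; exact: measurable_int hi.
apply: (@le_integrable _ _ _ _ _ measurableT _ (fun x => (C * h x)%:E)).
- by apply/measurable_EFinP; exact: measurable_funM.
- move=> x _; rewrite lee_fin mulrC !normrM ler_wpM2r//.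
  exact: le_trans (gC x) (ler_norm _).
- under eq_fun do rewrite EFinM.
  exact: integrableZl hi.
Qed.

End general_integration.

Section compact_support.
Context {R : realType} {N : nat}.
Local Notation Rn := ('rV[R]_N).

Lemma compact_supp_bounded (g : Rn * R -> R) : continuous g -> compact (supp g) ->
  exists C, forall p, `|g p| <= C.
Proof.
move=> cg cs.
have [M [Mr MP]] := compact_bounded (continuous_compact (continuous_subspaceT cg) cs).
exists (Num.max 0 (M + 1)) => p.
have [sp|/supp0 ->] := pselect (supp g p); last by rewrite normr0 le_max lexx.
by rewrite le_max (MP (M + 1)) ?orbT ?ltrDl//; exists p.
Qed.

End compact_support.

Section slab.
Context {R : realType} {N : nat}.
Local Notation Rn := ('rV[R]_N).
Local Notation Rt := (measurableTypeR R).
Local Notation leb := (rV_lebesgue R N).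
Variable T : R.
Local Notation tau := (tleb T).
Local Notation P := (leb \x tau)%E.
Local Notation mQ := (measurable_Q T : measurable (Q T : set (Rn * Rt))).
Local Open Scope ereal_scope.

Let P_conull : P (~` (Q T : set (Rn * Rt))) = 0.
Proof.
rewrite /product_measure1; rewrite (eq_integral (cst 0)) ?integral0// => x _.
rewrite /= (_ : xsection _ x = ~` `]0%R, T[%classic) ?tleb_conull//.
apply/seteqP; split => t; first by move=> /xsectionP nQ; move: nQ; rewrite /Q/= in_itv.
by move=> tT; apply/xsectionP; move: tT; rewrite /Q/= in_itv.
Qed.

Lemma integral_slab (f : Rn * Rt -> \bar R) :
  \int[P]_p f p = \int[lebQ R N]_(p in Q T) f p.
Proof.
transitivity (\int[P]_(p in Q T) f p).
  by rewrite [RHS]integral_mkcond; exact: (integral_conull mQ P_conull).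
apply: eq_measure_integral => A mA AQ; apply: eq_integral => x _.
rewrite /= tlebE; congr (lebesgue_measure _); apply: setIidl => t /xsectionP /AQ.
by rewrite /Q/= in_itv.
Qed.

Lemma integrable_slab (f : Rn * Rt -> R) : in_L1 (lebQ R N) (Q T) f ->
  P.-integrable setT (EFin \o (f \_ (Q T))).
Proof.
move=> /integrableP[mf fi].
have mf' : measurable_fun (Q T : set (Rn * Rt)) f by apply/measurable_EFinP.
apply/integrableP; split.
  by apply/measurable_EFinP; apply/(measurable_restrictT _ mQ).
rewrite integral_slab; apply: le_lt_trans fi.
rewrite le_eqVlt; apply/orP; left; apply/eqP; apply: eq_integral => p pQ.
by rewrite /= patchE pQ.
Qed.

End slab.

Section weak_equation.
Context {R : realType} {N : nat}.
Local Notation Rn := ('rV[R]_N).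
Local Notation Rt := (measurableTypeR R).
Local Notation leb := (rV_lebesgue R N).
Variables (lamt : R.-ker Rn ~> Rn) (G : set Rn) (mG : measurable G).
Hypotheses (G0 : leb (~` G) = 0%E)
  (lamt_fin : forall x r, G x -> 0 < r -> (lamt x [set y | (r < `|y - x|)%R] < +oo)%E)
  (lamt_diag : punctured_kernel lamt).
Variables (T : R) (T_gt0 : 0 < T).
Variables (phi : R -> R) (phi_cont : continuous phi).
Variables (u0 : Rn -> R) (u0_L1 : in_L1 leb setT u0).
Variables (u : Rn * R -> R).
Hypotheses (u_L1 : in_L1 (lebQ R N) (Q T) u)
  (u_sol : energy_solution (translated lamt) T phi u0 u).
Local Notation tau := (tleb T).
Local Notation P := (leb \x tau)%E.
Local Notation ut := (u \_ (Q T) : Rn * Rt -> R).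
Local Open Scope ereal_scope.

Lemma measurable_slab_ext : measurable_fun setT ut.
Proof. by apply/measurable_EFinP; exact: measurable_int (integrable_slab u_L1). Qed.

Lemma measurable_phi_slab_ext : measurable_fun setT (phi \o ut).
Proof.
apply: measurableT_comp measurable_slab_ext.
exact: continuous_measurable_fun.
Qed.

(** Testing with the time primitive turns the time derivative into [- g], so no derivative is left.
    The integrability of the energy in time is a conclusion: it is read off from the equation. *)
Lemma weak_equation (g : Rn * R -> R) :
  is_smooth g -> compact (supp g) -> supp g `<=` [set p | (p.2 < T)%R] ->
  [/\ tau.-integrable setT (energy_at lamt (phi \o ut) (time_primitive T g)),
      P.-integrable setT (fun p => (ut p * g p)%:E),
      \int[leb]_x (u0 x * time_primitive T g (x, 0%R))%:E \is a fin_num &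
      \int[P]_p (ut p * g p)%:E +
        \int[tau]_t energy_at lamt (phi \o ut) (time_primitive T g) t =
      \int[leb]_x (u0 x * time_primitive T g (x, 0%R))%:E].
Proof.
move=> sg cg gT.
have test := time_primitive_test T_gt0 sg cg gT.
have [szeta czeta _] := test.
have cont_g := is_Ck_continuous (sg 0%N).
have cont_zeta := is_Ck_continuous (szeta 0%N).
have [C gC] := compact_supp_bounded cont_g cg.
have [C' zC] := compact_supp_bounded cont_zeta czeta.
have mg : measurable_fun setT (g : Rn * Rt -> R) by exact: continuous_prod_measurable.
have mz : measurable_fun setT (time_primitive T g : Rn * Rt -> R).
  exact: continuous_prod_measurable.
have iug := integrable_mul_bounded (integrable_slab u_L1) mg gC.
set c := \int[leb]_x _.
have cfin : c \is a fin_num.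
  apply: integrable_fin_num => //; apply: (integrable_mul_bounded u0_L1).
    exact: (measurable_fun_pair1 (0%R : Rt) mz).
  by move=> x; exact: zC.
set e := energy_at lamt (phi \o ut) (time_primitive T g).
have me : measurable_fun setT e.
  exact: (measurable_energy_at mG G0 lamt_fin lamt_diag measurable_phi_slab_ext mz).
have iNug : P.-integrable setT (fun p => (ut p * - g p)%:E).
  under eq_fun do rewrite mulrN EFinN; exact: integrableN.
pose A := fubini_G leb (fun p => (ut p * - g p)%:E).
have iA : tau.-integrable setT A by exact: integrable_fubini_G.
have IA : \int[tau]_t A t = - \int[P]_p (ut p * g p)%:E.
  rewrite /A integral21_prod_meas1// -integralN; last exact: integrable_add_def.
  by apply: eq_integral => p _; rewrite mulrN.
have E : \int[tau]_t (A t - e t) + c = 0.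
  have [_ _ /(_ _ test) sol] := u_sol.
  rewrite -[RHS]sol; apply: (congr1 (fun y => y + c)).
  rewrite integral_tleb; apply: eq_integral => t /set_mem/=.
  rewrite in_itv/= => /andP[t0 tT].
  have utE x : ut (x, t) = u (x, t) by rewrite patchE mem_set// /Q/= t0.
  have -> : A t = \int[leb]_x (u (x, t) * derive1 (fun s => time_primitive T g (x, s)) t)%:E.
    by apply: eq_integral => x _; rewrite derive1_time_primitive// utE.
  have -> : (fun x => phi (u (x, t))) = (fun x => (phi \o ut) (x, t)).
    by apply/funext => x /=; rewrite utE.
  by [].
(* An infinite value could not be cancelled by the finite initial term [c]. *)
have fin : \int[tau]_t (A t - e t) \is a fin_num.
  by move: E cfin; case: c => // r; case: (\int[tau]_t _).
have [ie Ie] := integrable_sub_ae me iA fin.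
split => //.
rewrite Ie IA.
have Pfin : \int[P]_p (ut p * g p)%:E \is a fin_num by exact: integrable_fin_num.
move: Pfin fin cfin E.
case: (\int[P]_p _) => // a; case: (\int[tau]_t _) => // b; case: c => // r _ _ _.
move=> [] /eqP; rewrite addr_eq0 => /eqP br.
by suff -> : r = (a + (- a - b))%R by []; rewrite addrA subrr add0r br opprK.
Qed.

End weak_equation.

Section product_assoc.
Context dW dS dS' (W : measurableType dW) (S : measurableType dS)
  (S' : measurableType dS') (R : realType).
Variables (L : {sigma_finite_measure set W -> \bar R})
  (tau : {sigma_finite_measure set S -> \bar R})
  (tau' : {sigma_finite_measure set S' -> \bar R}).
Local Open Scope ereal_scope.
Local Notation assoc := (fun z : (W * S) * S' => (z.1.1, (z.1.2, z.2))).

Lemma measurable_prod_assoc : measurable_fun setT assoc.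
Proof.
apply: measurable_fun_pair.
  exact: (measurableT_comp measurable_fst measurable_fst).
apply: measurable_fun_pair; last exact: measurable_snd.
exact: (measurableT_comp measurable_snd measurable_fst).
Qed.

Lemma ge0_integral_prod_assoc (f : W * (S * S') -> \bar R) :
  (forall z, 0 <= f z) -> measurable_fun setT f ->
  \int[sfprod L tau \x tau']_z f (z.1.1, (z.1.2, z.2)) =
  \int[L \x sfprod tau tau']_z f z.
Proof.
move=> f0 mf.
have mfa : measurable_fun setT (fun z : (W * S) * S' => f (z.1.1, (z.1.2, z.2))).
  exact: (measurableT_comp mf measurable_prod_assoc).
have fa0 (z : (W * S) * S') : 0 <= f (z.1.1, (z.1.2, z.2)) by [].
rewrite (@fubini_tonelli1 _ _ _ _ _ _ _ _ mfa fa0) (@fubini_tonelli1 _ _ _ _ _ _ _ f)//.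
have mF := measurable_fun_fubini_tonelli_F (m2 := tau') _ mfa fa0.
rewrite /sfprod (@fubini_tonelli1 _ _ _ _ _ L tau _ mF); last first.
  by move=> z; apply: integral_ge0.
apply: eq_integral => w _; rewrite /fubini_F.
rewrite (@fubini_tonelli1 _ _ _ _ _ tau tau' (fun y => f (w, y)))//.
exact: (measurableT_comp mf).
Qed.

Lemma integral_prod_assoc (f : W * (S * S') -> \bar R) : measurable_fun setT f ->
  \int[sfprod L tau \x tau']_z f (z.1.1, (z.1.2, z.2)) =
  \int[L \x sfprod tau tau']_z f z.
Proof.
move=> mf; rewrite integralE [RHS]integralE.
rewrite -(ge0_integral_prod_assoc (f := f^\+))//; last exact: measurable_funepos.
rewrite -(ge0_integral_prod_assoc (f := f^\-))//; last exact: measurable_funeneg.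
by congr (_ - _); apply: eq_integral => z _; rewrite /= ?funeposE ?funenegE.
Qed.

Lemma integral_prod_assoc_iter (f : W * (S * S') -> \bar R) :
  (L \x sfprod tau tau').-integrable setT f ->
  let F (z : W * S) := \int[tau']_s f (z.1, (z.2, s)) in
  (L \x tau).-integrable setT F /\
  \int[L \x tau]_z F z = \int[L \x sfprod tau tau']_z f z.
Proof.
move=> fi F; have mf := measurable_int _ fi.
have fai : (sfprod L tau \x tau').-integrable setT (fun z => f (z.1.1, (z.1.2, z.2))).
  apply/integrableP; split; first exact: (measurableT_comp mf measurable_prod_assoc).
  have maf : measurable_fun setT (abse \o f) by exact: measurableT_comp.
  by rewrite (integral_prod_assoc maf); move/integrableP : fi => [].
split; first exact: integrable_fubini_F fai.
by rewrite -integral_prod_assoc// -(integral12_prod_meas1 fai).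
Qed.

End product_assoc.

Section smooth_id.
Context {R : realType}.

Lemma is_smooth_id : is_smooth (id : R -> R).
Proof.
case=> [|k]; first by split => // x; exact: cvg_id.
split=> [x|v]; first exact: cvg_id.
split=> [x|]; first exact: derivable_id.
rewrite (_ : 'D_v id = cst v); first exact: is_Ck_cst.
by apply/funext => x; exact: derive_id.
Qed.

End smooth_id.

Section qform_time_primitive.
Context {R : realType} {N : nat}.
Local Notation Rn := ('rV[R]_N).
Local Notation Rt := (measurableTypeR R).
Variable L : {sigma_finite_measure set (Rn * Rn)%type -> \bar R}.
Variables (T : R) (T_gt0 : 0 < T).
Local Notation tau := (tleb T).
Local Open Scope ereal_scope.

Variable psi : Rn * R -> R.
Hypotheses (sg : is_smooth psi) (cg : compact (supp psi))
  (gT : supp psi `<=` [set p | (p.2 < T)%R]).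
Local Notation kpsi := (fun p : Rn * R => (T - p.2) * psi p)%R.

Lemma weight_smooth : is_smooth kpsi.
Proof.
apply: is_smoothM => //.
rewrite (_ : (fun p : Rn * R => T - p.2)%R = (fun p => id (- p.2 + T)%R)); last first.
  by apply/funext => p; rewrite addrC.
apply: (@is_smooth_comp_affine _ _ (fun p : Rn * R => (- p.2)%R) T _ _ id).
- by move=> s p q /=; rewrite opprD -scalerN.
- by move=> p; apply: (@cvgN _ _ _ (nbhs p) _ snd); exact: cvg_snd.
- exact: is_smooth_id.
Qed.

Lemma weight_compact : compact (supp kpsi).
Proof. exact: suppM_compact. Qed.

Lemma weight_sub : supp kpsi `<=` [set p | (p.2 < T)%R].
Proof. by move=> p /suppM_sub; exact: gT. Qed.

Let mpsi : measurable_fun setT (psi : Rn * Rt -> R).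
Proof. exact: continuous_prod_measurable (is_Ck_continuous (sg 0%N)). Qed.

(** [tkernel T (t, s)] combines the cutoff [t <= s] of the primitive with the weight [T - s]. *)
Lemma time_primitive_weight (x : Rn) (t : R) : (0 < t < T)%R ->
  tau.-integrable setT (fun s => (psi (x, s) * tkernel T (t, s))%:E) /\
  (time_primitive T kpsi (x, t))%:E = \int[tau]_s (psi (x, s) * tkernel T (t, s))%:E.
Proof.
move=> tT; 
have mk : measurable_fun setT (fun s : Rt => psi (x, s) * tkernel T (t, s))%R.
  apply: measurable_funM; first exact: (measurable_fun_pair2 x mpsi).
  exact: (measurable_fun_pair2 (t : Rt) (measurable_tkernel T)).
have ik : tau.-integrable setT (fun s => (psi (x, s) * tkernel T (t, s))%:E).
  have [C psiC] := compact_supp_bounded (is_Ck_continuous (sg 0%N)) cg.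
  have := integrable_mul_bounded (C := (C * T)%R) (integrable_tleb_cst1 T) mk.
  under eq_fun do rewrite mul1r; apply=> s.
  by rewrite normrM ler_pM// tkernel_bound.
split => //.
rewrite (time_primitive_itv T_gt0 weight_smooth weight_compact weight_sub)//.
rewrite /Rintegral -[RHS]fineK; last exact: integrable_fin_num.
congr (fine _)%:E; rewrite integral_tleb integral_mkcond [RHS]integral_mkcond.
apply: eq_integral => s _; rewrite !patchE !mem_setE !in_itv/= /tkernel /=.
have [st|ts] := ltP s t; first by rewrite mul0r mul0r mulr0; case: ifP.
have s0 : (0 < s)%R by apply: lt_le_trans ts; case/andP: tT.
(* At [s = T], which belongs to the closed interval of the primitive but is cut off by the kernel,
   the weight is 0. *)
rewrite s0/=; case: ltgtP => // [sT|->]; first by rewrite !mul1r mulrC.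
by rewrite subrr mul0r.
Qed.

(** Integrating the second time out of the quadratic form turns the increments of [psi] into those
    of the time primitive of the weighted [psi]. Integrability comes from the form, as the energy of
    the primitive itself is not controlled. *)
Lemma qform_time_primitive (a : (Rn * Rn) * Rt -> R) :
  sqint L tau a -> sqint L tau (incr (psi : Rn * Rt -> R)) ->
  (L \x tau).-integrable setT (fun z => (a z * incr (time_primitive T kpsi : Rn * Rt -> R) z)%:E) /\
  \int[L \x tau]_z (a z * incr (time_primitive T kpsi : Rn * Rt -> R) z)%:E =
  qform L tau (tkernel T) a (incr (psi : Rn * Rt -> R)).
Proof.
move=> sa sh.
have qi := qform_integrable (tleb_setT_lty T) (measurable_tkernel T) (@tkernel_bound _ T ^~ T_gt0) sa sh.
have [Fi Fq] := integral_prod_assoc_iter qi.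
have aeF : {ae L \x tau, forall z, \int[tau]_s (a (z.1, z.2) *
    incr (psi : Rn * Rt -> R) (z.1, s) * tkernel T (z.2, s))%:E =
    (a z * incr (time_primitive T kpsi : Rn * Rt -> R) z)%:E}.
  (* The two integrands are compared only at times in (0, T); the others are null for [tau]. *)
  exists (setT `*` ~` `]0%R, T[%classic); split.
  - by apply: measurableX => //; exact: measurableC.
  - rewrite product_measure1E//; last exact: measurableC.
    by rewrite [X in _ * X](_ : _ = 0) ?mule0//; exact: tleb_conull.
  move=> [w t] /= nF; split => // tT; apply: nF; move: tT; rewrite /= in_itv/= => tT.
  have [i2 p2] := time_primitive_weight w.2 tT.
  have [i1 p1] := time_primitive_weight w.1 tT.
  rewrite -[RHS]/((a (w, t))%:E * ((time_primitive T kpsi (w.2, t))%:E -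
    (time_primitive T kpsi (w.1, t))%:E)).
  rewrite [X in X - _]p2 [X in _ - X]p1 -(integralB measurableT i2 i1).
  rewrite -(integralZl measurableT); last exact: integrableB.
  apply: eq_integral => s _; rewrite /incr /= -[RHS]/((a (w, t) *
    (psi (w.2, s) * tkernel T (t, s) - psi (w.1, s) * tkernel T (t, s)))%:E).
  by rewrite -mulrBl -[in LHS]mulrA.
have ma : measurable_fun setT (fun z => (a z * incr (time_primitive T kpsi : Rn * Rt -> R) z)%:E).
  apply/measurable_EFinP; apply: measurable_funM; first by have [] := sa.
  apply: measurable_incr; apply: continuous_prod_measurable.
  have [szeta _ _] := time_primitive_test T_gt0 weight_smooth weight_compact weight_sub.
  exact: is_Ck_continuous (szeta 0%N).
split; first exact: (ae_eq_integrable ma aeF).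
rewrite /qform -Fq; apply: ae_eq_integral => //; first exact: measurable_int Fi.
by apply: filterS aeF => z <-.
Qed.

End qform_time_primitive.

Section sqint_operations.
Context dW dS (W : measurableType dW) (S : measurableType dS) (R : realType).
Variables (L : {sigma_finite_measure set W -> \bar R})
  (tau : {sigma_finite_measure set S -> \bar R}).
Local Open Scope ereal_scope.

Lemma sqintB (a b : W * S -> R) : sqint L tau a -> sqint L tau b ->
  sqint L tau (a \- b)%R.
Proof.
move=> [ma ia] [mb ib]; split; first exact: measurable_funB.
have msq (f : W * S -> R) : measurable_fun setT f ->
    measurable_fun setT (fun z => (2 * f z ^+ 2)%:E).
  by move=> mf; apply/measurable_EFinP/measurable_funM => //; exact: measurable_funX.
have sq0 (f : W * S -> R) z : 0 <= (2 * f z ^+ 2)%:E by rewrite lee_fin mulr_ge0 ?sqr_ge0.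
have I2 (f : W * S -> R) : measurable_fun setT f ->
    \int[L \x tau]_z (2 * f z ^+ 2)%:E = 2%:E * \int[L \x tau]_z (f z ^+ 2)%:E.
  move=> mf; under eq_integral do rewrite EFinM.
  rewrite ge0_integralZl//; last by move=> z _; rewrite lee_fin sqr_ge0.
  by apply/measurable_EFinP; exact: measurable_funX.
apply: (@le_lt_trans _ _ (\int[L \x tau]_z ((2 * a z ^+ 2)%:E + (2 * b z ^+ 2)%:E))).
  apply: ge0_le_integral => //.
  - by move=> z _; rewrite lee_fin sqr_ge0.
  - by apply/measurable_EFinP; apply: measurable_funX; exact: measurable_funB.
  - by apply: emeasurable_funD; exact: msq.
  move=> z _; rewrite -EFinD lee_fin /=.
  by have := sqr_ge0 (a z + b z); rewrite !expr2; nra.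
rewrite ge0_integralD//; [|exact: msq|exact: msq].
by rewrite !I2// lte_add_pinfty// lte_mul_pinfty.
Qed.

End sqint_operations.

Section energy_norm.
Context {R : realType} {N : nat}.
Local Notation Rn := ('rV[R]_N).
Local Notation Rt := (measurableTypeR R).
Local Notation leb := (rV_lebesgue R N).
Variables (lamt : R.-ker Rn ~> Rn) (G : set Rn) (mG : measurable G).
Hypotheses (G0 : leb (~` G) = 0%E)
  (lamt_fin : forall x r, G x -> 0 < r -> (lamt x [set y | (r < `|y - x|)%R] < +oo)%E)
  (lamt_diag : punctured_kernel lamt).
Local Notation K := (good_kernel lamt mG).
Variable L : {sigma_finite_measure set (Rn * Rn)%type -> \bar R}.
Hypothesis LK : forall C, measurable C -> L C = (\int[leb]_x K x (xsection C x))%E.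
Variable T : R.
Local Notation tau := (tleb T).
Local Open Scope ereal_scope.

Lemma energy_normT_slab (f F : Rn * Rt -> R) : (forall p, Q T p -> f p = F p) ->
  measurable_fun setT F ->
  energy_normT (translated lamt) T f =
  (2^-1%:E * \int[L \x tau]_z (incr F z ^+ 2)%:E) `^ 2^-1.
Proof.
move=> fF mF; rewrite /energy_normT.
rewrite -(integral_energy_sqr G0 lamt_fin lamt_diag LK T mF) integral_tleb.
apply: (congr1 (fun y => y `^ 2^-1)%E); apply: eq_integral => t /set_mem/=; rewrite in_itv/= => tT.
rewrite /energy_at.
suff -> : (fun x => f (x, t)) = (fun x => F (x, t)) by [].
by apply/funext => x; apply: fF.
Qed.

Lemma energy_normT_sqint (f F : Rn * Rt -> R) : (forall p, Q T p -> f p = F p) ->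
  measurable_fun setT F -> energy_normT (translated lamt) T f < +oo ->
  sqint L tau (incr F).
Proof.
move=> fF mF; rewrite (energy_normT_slab fF mF) => fin; split.
  exact: measurable_incr.
have := lty_poweRy (_ : 2^-1 != 0 :> R)%R fin => /(_ _).
rewrite invr_neq0// => /(_ isT).
have : 0 <= \int[L \x tau]_z (incr F z ^+ 2)%:E.
  by apply: integral_ge0 => z _; rewrite lee_fin sqr_ge0.
case: (\int[L \x tau]_z _) => [r _ _|_|]; [exact: ltry| |by []].
by rewrite gt0_muley// lte_fin invr_gt0.
Qed.

Lemma energy_normT_cvg0 (f_ F_ : nat -> Rn * Rt -> R) :
  (forall n p, Q T p -> f_ n p = F_ n p) -> (forall n, measurable_fun setT (F_ n)) ->
  energy_normT (translated lamt) T (f_ n) @[n --> \oo] --> 0 ->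
  \int[L \x tau]_z (incr (F_ n) z ^+ 2)%:E @[n --> \oo] --> 0.
Proof.
move=> fF mF cv.
have I0 n : 0 <= \int[L \x tau]_z (incr (F_ n) z ^+ 2)%:E.
  by apply: integral_ge0 => z _; rewrite lee_fin sqr_ge0.
(* The factor 2 undoes the [2^-1] in the definition of the energy. *)
rewrite (_ : (fun n => _) = (fun n => 2%:E * (energy_normT (translated lamt) T (f_ n) *
    energy_normT (translated lamt) T (f_ n)))); last first.
  apply/funext => n; rewrite (energy_normT_slab (fF n) (mF n)).
  rewrite poweR12_sqrt ?mule_ge0 ?lee_fin ?invr_ge0// -expe2 sqr_sqrte ?mule_ge0 ?lee_fin ?invr_ge0//.
  by rewrite muleA -EFinM divff// mul1e.
have /(cvgeZl (y := 2%:E)) : energy_normT (translated lamt) T (f_ n) *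
    energy_normT (translated lamt) T (f_ n) @[n --> \oo] --> 0 * 0.
  by apply: cvgeM => //; rewrite mule_def_fin.
by rewrite mule0 mule0; apply.
Qed.

End energy_norm.

(** * Uniqueness *)

Lemma sub_eq0_of_add (R : realType) (x y q : \bar R) : x \is a fin_num ->
  y \is a fin_num -> q \is a fin_num -> (x + q = y + q -> x - y = 0)%E.
Proof.
case: x => // x; case: y => // y; case: q => // q _ _ _ [xy].
by rewrite (addIr _ xy) subee.
Qed.

Section uniqueness.
Context {R : realType} {N : nat}.
Local Notation Rn := ('rV[R]_N).
Local Notation Rt := (measurableTypeR R).
Local Notation leb := (rV_lebesgue R N).
Variables (lamt : R.-ker Rn ~> Rn) (G : set Rn) (mG : measurable G).
Hypotheses (G0 : leb (~` G) = 0%E)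
  (lamt_fin : forall x r, G x -> 0 < r -> (lamt x [set y | (r < `|y - x|)%R] < +oo)%E)
  (lamt_diag : punctured_kernel lamt).
Local Notation K := (good_kernel lamt mG).
Variable L : {sigma_finite_measure set (Rn * Rn)%type -> \bar R}.
Hypothesis LK : forall C, measurable C -> L C = (\int[leb]_x K x (xsection C x))%E.
Variables (T : R) (T_gt0 : 0 < T).
Variables (phi : R -> R) (phi_cont : continuous phi)
  (phi_nd : {homo phi : x y / x <= y}).
Variables (u0 : Rn -> R) (u0_L1 : in_L1 leb setT u0).
Variables (u v : Rn * R -> R).
Hypotheses (u_UC : in_UC (translated lamt) T phi u)
  (u_sol : energy_solution (translated lamt) T phi u0 u)
  (v_UC : in_UC (translated lamt) T phi v)
  (v_sol : energy_solution (translated lamt) T phi u0 v).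
Local Notation tau := (tleb T).
Local Notation P := (leb \x tau)%E.
Local Notation ut := (u \_ (Q T) : Rn * Rt -> R).
Local Notation vt := (v \_ (Q T) : Rn * Rt -> R).
Local Notation Fu := (phi \o ut : Rn * Rt -> R).
Local Notation Fv := (phi \o vt : Rn * Rt -> R).
Local Notation qf := (qform L tau (tkernel T)).
Local Open Scope ereal_scope.

Let u_L1 : in_L1 (lebQ R N) (Q T) u. Proof. by have [] := u_UC. Qed.
Let v_L1 : in_L1 (lebQ R N) (Q T) v. Proof. by have [] := v_UC. Qed.
Let mut : measurable_fun setT ut := measurable_slab_ext u_L1.
Let mvt : measurable_fun setT vt := measurable_slab_ext v_L1.
Let mFu : measurable_fun setT Fu := measurable_phi_slab_ext phi_cont u_L1.
Let mFv : measurable_fun setT Fv := measurable_phi_slab_ext phi_cont v_L1.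

Let FuE p : Q T p -> (phi \o u) p = Fu p.
Proof. by move=> pQ; rewrite /= patchE mem_set. Qed.
Let FvE p : Q T p -> (phi \o v) p = Fv p.
Proof. by move=> pQ; rewrite /= patchE mem_set. Qed.

Let sFu : sqint L tau (incr Fu).
Proof.
have [_ [_ fin] _] := u_sol.
exact: (energy_normT_sqint G0 lamt_fin lamt_diag LK FuE mFu fin).
Qed.

Let sFv : sqint L tau (incr Fv).
Proof.
have [_ [_ fin] _] := v_sol.
exact: (energy_normT_sqint G0 lamt_fin lamt_diag LK FvE mFv fin).
Qed.

Let tau_fin := tleb_setT_lty T.
Let mtk := measurable_tkernel T.
Let tk_bound z := tkernel_bound z T_gt0.

(** In the notation of the overview, [a] is [Dw], and [h] below is [(T - t) U]. *)
Let a : (Rn * Rn) * Rt -> R := (incr Fu \- incr Fv)%R.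
Let sa : sqint L tau a. Proof. exact: sqintB. Qed.
Let h (p : Rn * Rt) : R := ((ut p - vt p) * (T - p.2))%R.

Let mh : measurable_fun setT h.
Proof. by apply: measurable_funM; apply: measurable_funB => //; exact: measurable_snd. Qed.

(** The initial terms of the two equations cancel. Square integrability of the increments is
    required of [psi] because a test function may have infinite energy. *)
Let weak_difference (psi : Rn * R -> R) : is_smooth psi -> compact (supp psi) ->
  supp psi `<=` [set p | (p.2 < T)%R] -> sqint L tau (incr (psi : Rn * Rt -> R)) ->
  \int[P]_p (psi p * h p)%:E = - (2^-1%:E * qf a (incr (psi : Rn * Rt -> R))).
Proof.
move=> sg cg gT sp.
have sk := weight_smooth T sg; have ck : compact (supp _) := weight_compact (T := T) cg.
have kT := weight_sub gT.
set kpsi := (fun p : Rn * R => ((T - p.2) * psi p)%R) in sk ck kT.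
have [_ iu ufin Eu] := weak_equation mG G0 lamt_fin lamt_diag T_gt0 phi_cont
  u0_L1 u_L1 u_sol sk ck kT.
have [_ iv _ Ev] := weak_equation mG G0 lamt_fin lamt_diag T_gt0 phi_cont
  u0_L1 v_L1 v_sol sk ck kT.
have mz : measurable_fun setT (time_primitive T kpsi : Rn * Rt -> R).
  have [szeta _ _] := time_primitive_test T_gt0 sk ck kT.
  by apply: continuous_prod_measurable; exact: is_Ck_continuous (szeta 0%N).
have [ju Ju] := qform_time_primitive T_gt0 sg cg gT sFu sp.
have [jv Jv] := qform_time_primitive T_gt0 sg cg gT sFv sp.
rewrite (integral_energy G0 lamt_fin lamt_diag LK mFu mz ju) Ju in Eu.
rewrite (integral_energy G0 lamt_fin lamt_diag LK mFv mz jv) Jv in Ev.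
rewrite (qformBl tau_fin mtk tk_bound sFu sFv sp).
have -> : \int[P]_p (psi p * h p)%:E =
    \int[P]_p (ut p * kpsi p)%:E - \int[P]_p (vt p * kpsi p)%:E.
  rewrite -integralB//; apply: eq_integral => p _; rewrite -EFinB; congr EFin.
  by rewrite /h /kpsi; ring.
have q1 : qf (incr Fu) (incr (psi : Rn * Rt -> R)) \is a fin_num.
  exact: (qform_fin_num tau_fin mtk tk_bound).
have q2 : qf (incr Fv) (incr (psi : Rn * Rt -> R)) \is a fin_num.
  exact: (qform_fin_num tau_fin mtk tk_bound).
move: Eu Ev q1 q2 ufin (integrable_fin_num measurableT iu) (integrable_fin_num measurableT iv).
case: (\int[leb]_x _) => // c; case: (\int[P]_p (ut p * _)%:E) => // x.
case: (\int[P]_p _) => // y; case: (qf _ _) => // q; case: (qf _ _) => // r.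
move=> [E1] [E2] _ _ _ _ _.
have E : (x - y = - (2^-1 * (q - r)))%R by move: E1 E2; lra.
exact: (congr1 EFin E).
Qed.

Let weak_difference_lim (f F : Rn * R -> R) : (forall p, Q T p -> f p = F p) ->
  measurable_fun setT (F : Rn * Rt -> R) -> in_X (translated lamt) T f ->
  \int[P]_p (F p * h p)%:E = - (2^-1%:E * qf a (incr (F : Rn * Rt -> R))).
Proof.
move=> fF mF [_ [_ ffin] [psi_ [tst cvE cvW]]].
have sF := energy_normT_sqint G0 lamt_fin lamt_diag LK fF mF ffin.
have mpsi n : measurable_fun setT (psi_ n : Rn * Rt -> R).
  by have [sg _ _] := tst n; apply: continuous_prod_measurable; exact: is_Ck_continuous (sg 0%N).
have cvD : \int[L \x tau]_z ((incr (psi_ n : Rn * Rt -> R) z - incr (F : Rn * Rt -> R) z) ^+ 2)%:E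
    @[n --> \oo] --> 0.
  have fFD n p : Q T p -> (psi_ n \- f)%R p = (psi_ n \- F)%R p.
    by move=> pQ /=; rewrite (fF p pQ).
  have mD n : measurable_fun setT ((psi_ n \- F)%R : Rn * Rt -> R) by exact: measurable_funB.
  have := energy_normT_cvg0 G0 lamt_fin lamt_diag LK (f_ := fun n => (psi_ n \- f)%R)
    (F_ := fun n => (psi_ n \- F)%R) fFD mD cvE.
  rewrite (_ : (fun n => _) = (fun n => \int[L \x tau]_z
    ((incr (psi_ n : Rn * Rt -> R) z - incr (F : Rn * Rt -> R) z) ^+ 2)%:E)); last first.
    apply/funext => n; apply: eq_integral => z _; congr (_ ^+ 2)%:E.
    by rewrite /incr /=; ring.
  exact.
(* The first approximants may have infinite energy. From [m] on their distance to [F] is finite,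
   hence so is their own energy, and the sequence is shifted accordingly. *)
have [[m _ mfin] _] := (fine_cvgP _ _).1 cvD.
pose psi n := psi_ (n + m)%N.
have sp n : sqint L tau (incr (psi n : Rn * Rt -> R)).
  rewrite (_ : incr _ = (incr (F : Rn * Rt -> R) \-
      (incr (F : Rn * Rt -> R) \- incr (psi n : Rn * Rt -> R)))%R); last first.
    by apply/funext => z /=; rewrite subKr.
  apply: sqintB => //; split.
    by apply: measurable_funB; [exact: (measurable_incr mF)|exact: (measurable_incr (mpsi _))].
  have /= := mfin (n + m)%N (leq_addl _ _); rewrite ge0_fin_numE; last first.
    by apply: integral_ge0 => z _; rewrite lee_fin sqr_ge0.
  apply: le_lt_trans; rewrite le_eqVlt; apply/orP; left; apply/eqP.
  by apply: eq_integral => z _; rewrite /= -sqrrN opprB.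
have cvq : qf a (incr (psi n : Rn * Rt -> R)) @[n --> \oo] --> qf a (incr (F : Rn * Rt -> R)).
  apply: (qform_cvg tau_fin mtk tk_bound sa sF sp).
  exact: (cvg_comp _ _ (cvg_addnr m) cvD).
(* This makes [h] admissible in the weak convergence of the definition of X; on the slab the weight
   lies between 0 and T. *)
have hL : in_L1 (lebQ R N) (Q T) h.
  have i := integrable_EFinB (measurable_Q T) u_L1 v_L1.
  apply: (le_integrable (measurable_Q T) _ _ (integrable_EFinZ (measurable_Q T) T i)).
    by apply: measurable_funTS; apply/measurable_EFinP.
  move=> p pQ; rewrite /= lee_fin /h !patchE mem_set//.
  rewrite [leLHS]normrM [leRHS]normrM mulrC ler_wpM2r//.
  move: pQ; rewrite /Q/= => /andP[p0 pT].
  by rewrite gtr0_norm ?subr_gt0// gtr0_norm// lerBlDr lerDl ltW.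
have cvP : \int[P]_p (psi n p * h p)%:E @[n --> \oo] --> \int[P]_p (F p * h p)%:E.
  have := cvg_comp _ _ (cvg_addnr m) (cvW _ hL).
  rewrite (_ : \int[P]_p (F p * h p)%:E = \int[lebQ R N]_(p in Q T) (f p * h p)%:E); last first.
    by rewrite integral_slab; apply: eq_integral => p /set_mem pQ; rewrite fF.
  by under [X in _ -> X @ _ --> _]eq_fun do rewrite integral_slab.
have cvP' : \int[P]_p (psi n p * h p)%:E @[n --> \oo] -->
    - (2^-1%:E * qf a (incr (F : Rn * Rt -> R))).
  rewrite (_ : (fun n => _) = (fun n => - (2^-1%:E * qf a (incr (psi n : Rn * Rt -> R))))).
    by apply: cvgeN; exact: cvgeZl.
  apply/funext => n; have [sg cg gT] := tst (n + m)%N.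
  exact: weak_difference.
exact: (cvg_unique _ cvP cvP').
Qed.

Let incr_phi_eq : {ae L \x tau, forall z, incr Fu z = incr Fv z}.
Proof.
have Eu : \int[P]_p (Fu p * h p)%:E = - (2^-1%:E * qf a (incr Fu)).
  by apply: weak_difference_lim FuE mFu _; have [] := u_UC.
have Ev : \int[P]_p (Fv p * h p)%:E = - (2^-1%:E * qf a (incr Fv)).
  by apply: weak_difference_lim FvE mFv _; have [] := v_UC.
have q1 := qform_fin_num tau_fin mtk tk_bound sa sFu.
have q2 := qform_fin_num tau_fin mtk tk_bound sa sFv.
(* Integrability is read off from the finite value given by [Eu]. *)
have iu : P.-integrable setT (fun p => (Fu p * h p)%:E).
  apply: fin_num_integrable; last by rewrite Eu fin_numN fin_numM.
  by apply/measurable_EFinP; exact: measurable_funM.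
have iv : P.-integrable setT (fun p => (Fv p * h p)%:E).
  apply: fin_num_integrable; last by rewrite Ev fin_numN fin_numM.
  by apply/measurable_EFinP; exact: measurable_funM.
have ge : 0 <= \int[P]_p (Fu p * h p)%:E - \int[P]_p (Fv p * h p)%:E.
  rewrite -integralB//; apply: integral_ge0 => p _; rewrite -EFinB lee_fin -mulrBl.
  rewrite /h /= !patchE; case: ifPn => [|_]; last by rewrite !subrr mul0r.
  move=> /set_mem; rewrite /Q/= => /andP[_ pT].
  have Tp : (0 <= T - p.2)%R by rewrite subr_ge0 ltW.
  rewrite mulrA mulr_ge0//; have [uv|/ltW vu] := leP (u p) (v p).
    by rewrite mulr_le0 ?subr_le0// phi_nd.
  by rewrite mulr_ge0 ?subr_ge0// phi_nd.
have qa0 : qf a a = 0.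
  have := qform_ge0 T_gt0 sa; have := qform_fin_num tau_fin mtk tk_bound sa sa.
  (* Only the second arguments are expanded, to match [Eu] and [Ev]. Their difference says that
     [- 2^-1 * qf a a] is nonnegative, while [qform_ge0] gives the opposite sign. *)
  rewrite {2 4 6}/a (qformBr tau_fin mtk tk_bound sFu sFv sa) => _.
  move: ge; rewrite Eu Ev.
  case: (qf _ _) q1 => // q _; case: (qf _ _) q2 => // r _.
  rewrite !lee_fin => H1 H2; congr EFin; move: H1 H2; lra.
have := qform_eq0 T_gt0 sa qa0; apply: filterS => z /eqP.
by rewrite /a/= subr_eq0 => /eqP.
Qed.

Lemma solutions_ae_eq : {ae lebQ R N, forall p, Q T p -> u p = v p}.
Proof.
have i : in_L1 (lebQ R N) (Q T) (u \- v)%R.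
  exact: (integrable_EFinB (measurable_Q T) u_L1 v_L1).
suff H : {ae lebQ R N, forall p, Q T p -> (u \- v)%R p = 0%R}.
  move: H; apply: filterS; first exact: (ae_filter_ringOfSetsType (lebQ R N)).
  by move=> p H /H /= /eqP; rewrite subr_eq0 => /eqP.
apply: box_bumps_determine => // b c d e n eT.
set g := box_bump _ _ _ _ _.
have sg : is_smooth g by exact: is_smooth_box_bump.
have cg : compact (supp g) by exact: compact_supp_box_bump.
have gT : supp g `<=` [set p | (p.2 < T)%R].
  move=> p /supp_box_bump[_ /=]; rewrite in_itv/= => /andP[_ pe].
  exact: le_lt_trans eT.
(* The bump enters without the weight [T - t]: the energies already agree, so no quadratic form has
   to be built. *)
have [_ iu ufin Eu] := weak_equation mG G0 lamt_fin lamt_diag T_gt0 phi_cont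
  u0_L1 u_L1 u_sol sg cg gT.
have [jv iv _ Ev] := weak_equation mG G0 lamt_fin lamt_diag T_gt0 phi_cont
  u0_L1 v_L1 v_sol sg cg gT.
have [ju _ _ _] := weak_equation mG G0 lamt_fin lamt_diag T_gt0 phi_cont
  u0_L1 u_L1 u_sol sg cg gT.
have mz : measurable_fun setT (time_primitive T g : Rn * Rt -> R).
  have [szeta _ _] := time_primitive_test T_gt0 sg cg gT.
  by apply: continuous_prod_measurable; exact: is_Ck_continuous (szeta 0%N).
have ee := energy_at_ae_eq G0 lamt_fin lamt_diag LK mFu mFv mz incr_phi_eq.
have Euv : \int[tau]_t energy_at lamt Fu (time_primitive T g) t =
    \int[tau]_t energy_at lamt Fv (time_primitive T g) t.
  apply: ae_eq_integral => //; [exact: measurable_int ju|exact: measurable_int jv|].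
  by apply: filterS ee => t -> _.
transitivity (\int[P]_p (ut p * g p)%:E - \int[P]_p (vt p * g p)%:E).
  rewrite -(integralB measurableT iu iv) integral_slab; apply: eq_integral => p pQ.
  have up : ut p = u p by rewrite patchE pQ.
  have vp : vt p = v p by rewrite patchE pQ.
  by rewrite up vp mulrBl.
have efin := integrable_fin_num measurableT jv.
rewrite [X in _ + X = _]Euv in Eu.
exact: (sub_eq0_of_add (integrable_fin_num measurableT iu)
  (integrable_fin_num measurableT iv) efin (etrans Eu (esym Ev))).
Qed.

End uniqueness.
Theorem theorem2p4 (R : realType) (N : nat) (hN : (0 < N)%N)
    (T : R) (hT : 0 < T)
    (phi : R -> R) (phi_cont : continuous phi)
    (phi_nd : {homo phi : x y / x <= y})
    (u0 : 'rV[R]_N -> R)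
    (u0_L1 : in_L1 (rV_lebesgue R N) setT u0)
    (u0_Linfty : in_Linfty (rV_lebesgue R N) setT u0)
    (Lambda : {measure set ('rV[R]_N * 'rV[R]_N) -> \bar R})
    (Lambda_radon : radon_off_diagonal Lambda)
    (lamt : R.-ker 'rV[R]_N ~> 'rV[R]_N)
    (lamt_punctured : punctured_kernel lamt)
    (A_lambda0 : disintegrates Lambda lamt)
    (A_lambda1 : levy_integrable (translated lamt))
    (u v : 'rV[R]_N * R -> R)
    (u_UC : in_UC (translated lamt) T phi u)
    (u_sol : energy_solution (translated lamt) T phi u0 u)
    (v_UC : in_UC (translated lamt) T phi v)
    (v_sol : energy_solution (translated lamt) T phi u0 v) :
  {ae lebQ R N, forall p, Q T p -> u p = v p}.
Proof.
have [G [mG G0 lamt_fin]] := levy_good_set A_lambda1.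
exact: (solutions_ae_eq (mG := mG) G0 lamt_fin lamt_punctured
  (L := sf_measure (radon_sigma_finite Lambda_radon))
  (disintegrates_good_kernel mG Lambda_radon A_lambda0 lamt_punctured G0)
  hT phi_cont phi_nd u0_L1 u_UC u_sol v_UC v_sol).
Qed.
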